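(* Let $d\ge3$ and let $p\colon S^{d-1}\to(0,\infty)$ be lower semi-continuous with $Z:=\int_{S^{d-1}}p\,d\sigma_{d-1}\in(0,\infty)$, and $\pi(dx)=\frac1Zp(x)\sigma_{d-1}(dx)$. Assume there is a Borel set $C$ with $\sigma_{d-1}(C)>0$, $\inf_{x\in C}p(x)>0$ and $\sup_{x\in S^{d-1}}p(x)<\infty$. Set $\beta:=\frac{\inf_{y\in C}p(y)}{\sup_{y\in S^{d-1}}p(y)}\in(0,1]$ and $\rho:=1-\frac{\beta}{2\pi}\frac{\sigma_{d-1}(C)}{\omega_{d-2}}\in(0,1)$. Then the geodesic shrinkage slice sampling kernel $\widetilde H$ satisfies $$\sup_{x\in S^{d-1}}d_{TV}\big(\widetilde H^n(x,\cdot),\pi\big)\le\rho^n\qquad\text{for all }n\in\mathbb N.$$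
   Context: $S^{d-1}$ is the Euclidean unit sphere in $\mathbb R^d$ with Borel $\sigma$-algebra, $\sigma_{d-1}$ its volume measure, $\omega_{d-1}:=\sigma_{d-1}(S^{d-1})$. For $x\in S^{d-1}$: $S^{d-2}_x:=\{v\in S^{d-1}:\langle v,x\rangle=0\}$ with natural volume measure $\mu_x$ (image of $\sigma_{d-2}$ under a linear isometry of $\mathbb R^{d-1}$ onto $x^\perp$; total mass $\omega_{d-2}$). $\gamma_{(x,v)}(\theta):=\cos(\theta)x+\sin(\theta)v$. Shrinkage procedure $\mathrm{shrink}(x,v,t)$ for $x\in S^{d-1}$, $v\in S^{d-2}_x$, $t\in(0,p(x))$: draw $\theta\sim\mathcal U(0,2\pi)$, set $\theta_{\min}=\theta-2\pi$, $\theta_{\max}=\theta$; while $p(\cos(\theta)x+\sin(\theta)v)\le t$: if $\theta<0$ set $\theta_{\min}=\theta$, else set $\theta_{\max}=\theta$, then draw a new $\theta\sim\mathcal U(\theta_{\min},\theta_{\max})$; output $\theta$. Let $\alpha_{x,v,t}(A):=\mathbb P(\mathrm{shrink}(x,v,t)\bmod 2\pi\in A)$ for Borel $A\subseteq[0,2\pi)$ (well defined for lower semi-continuous $p$). Define $$\widetilde H_t(x,A):=\frac1{\omega_{d-2}}\int_{S^{d-2}_x}\int_{[0,2\pi)}\mathbb 1_A(\gamma_{(x,v)}(\theta))\,\alpha_{x,v,t}(d\theta)\,\mu_x(dv),\qquad \widetilde H(x,A):=\frac1{p(x)}\int_0^{p(x)}\widetilde H_t(x,A)\,dt.$$ $d_{TV}$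 denotes total variation distance. *)

(* Defs.v *)
From mathcomp Require Import all_boot all_order all_algebra.
From mathcomp Require Import all_classical all_reals all_analysis.
Set Implicit Arguments. Unset Strict Implicit. Unset Printing Implicit Defensive.
Import Order.TTheory GRing.Theory Num.Theory numFieldNormedType.Exports.
Local Open Scope classical_set_scope.
Local Open Scope ring_scope.

Definition dotv (R : realType) (n : nat) (u v : 'rV[R]_n) : R :=
  \sum_(i < n) u 0 i * v 0 i.
Definition enorm (R : realType) (n : nat) (u : 'rV[R]_n) : R :=
  Num.sqrt (dotv u u).
Definition sphere (R : realType) (n : nat) : set 'rV[R]_n :=
  [set x | dotv x x = 1].
Arguments sphere {R} n.

Definition borel_sph (R : realType) (n : nat) (A : set 'rV[R]_n) : Prop :=
  A `<=` sphere n /\ <<s open >> A.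

Definition vext (R : realType) (n : nat) (t : R) (y : 'rV[R]_n) : 'rV[R]_n.+1 :=
  \row_(i < n.+1) (if unlift ord0 i is Some j then y 0 j else t).

(* Lebesgue integral on R^n of a nonnegative function, as the iterated
   one-dimensional Lebesgue integral (Tonelli); on R^0 it is evaluation
   at the unique point. *)
Fixpoint lebint (R : realType) (n : nat) : ('rV[R]_n -> \bar R) -> \bar R :=
  match n return ('rV[R]_n -> \bar R) -> \bar R with
  | 0 => fun f => f 0
  | n'.+1 => fun f =>
      (\int[@lebesgue_measure R]_(t in setT) lebint (fun y => f (vext t y)))%E
  end.

(* Integral w.r.t. the surface (volume) measure sigma_{n-1} of S^{n-1},
   via the cone formula  int f dsigma = n * int_{0<|y|<=1} f(y/|y|) dy. *)
Definition sphint (R : realType) (n : nat) (f : 'rV[R]_n -> \bar R) : \bar R :=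
  (((n%:R)%R)%:E * lebint (fun y : 'rV[R]_n =>
      if (0 < dotv y y <= 1)%R then f (((Num.sqrt (dotv y y))^-1 *: y)%R) else 0%E))%E.

Definition sph_mass (R : realType) (n : nat) : R :=
  fine (sphint (fun _ : 'rV[R]_n => 1%E)).
Arguments sph_mass {R} n.

(* A linear isometry of R^{n-1} onto x^perp: v |-> v *m M with
   M having orthonormal rows orthogonal to x; one is chosen. *)
Definition perp_isom (R : realType) (n : nat) (x : 'rV[R]_n)
  (M : 'M[R]_(n.-1, n)) : Prop :=
  M *m M^T = 1%:M /\ M *m x^T = 0.
Definition Uperp (R : realType) (n : nat) (x : 'rV[R]_n) : 'M[R]_(n.-1, n) :=
  xget 0 [set M | perp_isom x M].

Definition subsph_int (R : realType) (n : nat) (x : 'rV[R]_n)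
  (f : 'rV[R]_n -> \bar R) : \bar R :=
  sphint (fun v : 'rV[R]_(n.-1) => f (v *m Uperp x)).

Definition geod (R : realType) (n : nat) (x v : 'rV[R]_n) (th : R) : 'rV[R]_n :=
  cos th *: x + sin th *: v.

Definition mod2pi (R : realType) (th : R) : R :=
  th - 2 * pi * (Num.floor (th / (2 * pi)))%:~R.

(* Shrinkage procedure, truncated after k further loop iterations:
   state (theta_min, theta_max, theta); returns the contribution
   E[ g(output mod 2pi) ; procedure stops within k more redraws ]. *)
Fixpoint shrink_step (R : realType) (n : nat) (p : 'rV[R]_n -> R)
  (x v : 'rV[R]_n) (t : R) (k : nat) (a b th : R) (g : R -> \bar R) : \bar R :=
  if t < p (geod x v th) then g (mod2pi th) else
  match k with
  | 0 => 0%E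
  | k'.+1 =>
      let a' := if th < 0 then th else a in
      let b' := if th < 0 then b else th in
      (((b' - a')^-1)%R%:E *
        \int[@lebesgue_measure R]_(s in `[a', b']) shrink_step p x v t k' a' b' s g)%E
  end.

(* integral of g against alpha_{x,v,t}: supremum over k (monotone limit) of
   the probability-weighted output after the initial draw theta~U(0,2pi) *)
Definition alpha_int (R : realType) (n : nat) (p : 'rV[R]_n -> R)
  (x v : 'rV[R]_n) (t : R) (g : R -> \bar R) : \bar R :=
  let tau : R := (2 * pi)%R in
  ereal_sup (range (fun k : nat =>
    ((tau^-1)%R%:E *
      \int[@lebesgue_measure R]_(s in `[0%R, tau]) shrink_step p x v t k (s - tau)%R s s g)%E)).

Definition Ht_int (R : realType) (n : nat) (p : 'rV[R]_n -> R)
  (x : 'rV[R]_n) (t : R) (f : 'rV[R]_n -> \bar R) : \bar R :=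
  (((sph_mass n.-1)^-1)%R%:E *
    subsph_int x (fun v => alpha_int p x v t (fun th => f (geod x v th))))%E.

Definition H_op (R : realType) (n : nat) (p : 'rV[R]_n -> R)
  (f : 'rV[R]_n -> \bar R) (x : 'rV[R]_n) : \bar R :=
  (((p x)^-1)%R%:E * \int[@lebesgue_measure R]_(t in `]0%R, p x[) Ht_int p x t f)%E.

Definition Hn (R : realType) (n : nat) (p : 'rV[R]_n -> R) (k : nat)
  (x : 'rV[R]_n) (A : set 'rV[R]_n) : \bar R :=
  iter k (H_op p) (fun y => (\1_A y)%:E) x.

Definition sph_meas (R : realType) (n : nat) (A : set 'rV[R]_n) : \bar R :=
  sphint (fun y => (\1_A y)%:E).

Definition Zconst (R : realType) (n : nat) (p : 'rV[R]_n -> R) : \bar R :=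
  sphint (fun y => (p y)%:E).
Definition target (R : realType) (n : nat) (p : 'rV[R]_n -> R)
  (A : set 'rV[R]_n) : \bar R :=
  (((fine (Zconst p))^-1)%R%:E * sphint (fun y => (p y * \1_A y)%R%:E))%E.

Definition dTV (R : realType) (n : nat) (mu nu : set 'rV[R]_n -> \bar R) : \bar R :=
  ereal_sup [set `|(mu A - nu A)%E|%E | A in @borel_sph R n].

Definition lsc_sph (R : realType) (n : nat) (p : 'rV[R]_n -> R) : Prop :=
  forall x, sphere n x -> forall a, a < p x ->
    exists2 e, 0 < e & forall y, sphere n y -> enorm (y - x) < e -> a < p y.

(* Main.v *)
(* For a fixed level t the shrinkage procedure on a great circle is reversible:
   started from z, it reaches y with the same density as it reaches z from y,
   because a rejected point cuts the bracket in the same way for both, as long as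
   it does not separate them. Since the geodesic flow preserves the uniform
   distribution on unit tangent vectors, averaging over the directions v and
   then over the levels t shows that the kernel preserves p.
   If the very first draw is accepted the chain jumps to gamma(theta) with theta
   uniform, which in polar coordinates has a density at least 1 / (2 pi omega_(d-2))
   on the sphere; for t < beta p(x) all of C is accepted. Hence the kernel H
   dominates (1 - rho) times the uniform distribution on C, one application
   of H shrinks the oscillation of a function by the factor rho, and the integral
   against the invariant distribution always stays in the range. *)

From HB Require Import structures.
Require Import Defs.
From mathcomp Require Import all_boot all_order all_algebra.
From mathcomp Require Import all_classical all_reals all_analysis.
From mathcomp Require Import measurable_realfun unstable ring lra.
Set Implicit Arguments. Unset Strict Implicit. Unset Printing Implicit Defensive.
Import Order.TTheory GRing.Theory Num.Theory numFieldNormedType.Exports.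
Local Open Scope classical_set_scope.
Local Open Scope ring_scope.

(** The integrals are given as functionals: [lebint] is an iterated integral, [sphint] a cone
    formula. Tonelli's theorem needs measures, so each functional is first represented by a
    sigma-finite one. After that no differential geometry is used: Gaussian elimination gives
    rotation invariance of [sphint] up to a constant, which the total mass fixes; polar coordinates
    come from slicing the ball into cones and substituting a tangent; the flow is handled by
    exchanging the endpoints of a geodesic. Two obstacles shape the rest. The isometry [Uperp x] is
    merely chosen and [p] is arbitrary off the sphere, so measurable replacements ([tangent],
    [in_level], [kernelH]) that agree with the given kernel on the sphere carry the argument. And
    all integrands take values in [[0, +oo]]: reversibility is proved for boundedly many redraws,
    stationarity follows in the monotone limit since lower semi-continuity makes the procedure stop
    almost surely, and signed functions are avoided by treating [phi - m] and [m + w - phi] as two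
    nonnegative ones. *)

Local Notation mfT := (measurable_fun setT).

(** * Iterated Lebesgue integrals *)

(** Generated by the open sets, so that measurability here is the condition [<<s open >>] of
    [borel_sph]. *)
HB.instance Definition _ (R : realType) (n : nat) :=
  Measurable.copy 'rV[R]_n (g_sigma_algebraType (@open 'rV[R]_n)).

Lemma measurable_coord (R : realType) n (i : 'I_n) :
  mfT (fun y : 'rV[R]_n => y 0 i).
Proof.
apply: (measurability _ (RGenOpens.measurableE R)).
move=> _ [_ [a [b ->]] <-]; rewrite setTI; apply: sub_sigma_algebra.
by apply: open_comp; [move=> y _ /=; exact: coord_continuous|exact: interval_open].
Qed.

(** An open set is the union of the rational boxes it contains. These are countably many, and the
    preimage of a box is a finite intersection of coordinate preimages. *)
Lemma measurable_to_rV d (T : measurableType d) (R : realType) n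
    (f : T -> 'rV[R]_n) :
  (forall i, mfT (fun x => f x 0 i)) -> mfT f.
Proof.
move=> mf; apply: (@measurability _ _ _ _ setT f (@open 'rV[R]_n)) => //.
move=> _ [U oU <-]; rewrite setTI.
pose box (ab : {ffun 'I_n -> rat * rat}) : set 'rV[R]_n :=
  [set y | forall i, ratr (ab i).1 < y 0 i < ratr (ab i).2].
have -> : f @^-1` U = \bigcup_(ab in [set ab | box ab `<=` U]) (f @^-1` box ab).
  apply/seteqP; split=> x /=; last by move=> [ab /= abU] /abU.
  move=> Ufx; have : nbhs (f x) U by apply: open_nbhs_nbhs; split.
  move=> [P Pn PO].
  have e_ i : exists ab : rat * rat,
      (ratr ab.1 < f x 0 i < ratr ab.2) /\
      (forall r : R, ratr ab.1 < r < ratr ab.2 -> P 0 i r).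
    have /nbhs_ballP[e /= e0 eP] := Pn 0 i.
    have [a] := @rat_in_itvoo R (f x 0 i - e) (f x 0 i) ltac:(lra).
    have [b] := @rat_in_itvoo R (f x 0 i) (f x 0 i + e) ltac:(lra).
    rewrite !in_itv/= => /andP[b1 b2] /andP[a1 a2].
    exists (a, b); split => /=; first by rewrite a2 b1.
    move=> r /andP[ar rb]; apply: eP; rewrite /ball/= ltr_norml.
    by apply/andP; split; lra.
  exists [ffun i => sval (cid (e_ i))] => /=.
    move=> y /= yb; apply: PO => i j; rewrite [i]ord1.
    by have := yb j; rewrite ffunE; case: cid => /= ab [_]; apply.
  by move=> i; rewrite ffunE; case: cid => /= ab [].
rewrite bigcup_mkcond.
apply: countable_bigcupT_measurable => // ab; case: ifP => // _.
rewrite (_ : f @^-1` box ab =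
   \big[setI/setT]_(i < n) ((fun x => f x 0 i) @^-1` `](ratr (ab i).1), (ratr (ab i).2)[ )); last first.
  apply/seteqP; split => x /=; rewrite -bigcap_seq/=.
    by move=> h i _ /=; rewrite in_itv/=; exact: h.
  by move=> h i; have := h i; rewrite /= mem_index_enum in_itv/=; exact.
apply: bigsetI_measurable => i _.
by rewrite -[X in measurable X]setTI; exact: mf.
Qed.

Lemma vext0 (R : realType) n (t : R) (y : 'rV[R]_n) : vext t y 0 ord0 = t.
Proof. by rewrite mxE unlift_none. Qed.

Lemma vextS (R : realType) n (t : R) (y : 'rV[R]_n) j :
  vext t y 0 (lift ord0 j) = y 0 j.
Proof. by rewrite mxE liftK. Qed.

Definition vrest (R : realType) n (x : 'rV[R]_n.+1) : 'rV[R]_n :=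
  \row_j x 0 (lift ord0 j).

Lemma vextK (R : realType) n (t : R) (y : 'rV[R]_n) : vrest (vext t y) = y.
Proof. by apply/rowP => j; rewrite mxE vextS. Qed.

(** * Measurability of vector operations *)

Section measurability.
Context d (T : measurableType d) (R : realType).

Lemma measurable_vext n (t : T -> R) (y : T -> 'rV[R]_n) :
  mfT t -> mfT y -> mfT (fun w => vext (t w) (y w)).
Proof.
move=> mt my; apply: measurable_to_rV => i; have [j ->|->] := unliftP ord0 i.
  under eq_fun do rewrite vextS.
  exact: (measurableT_comp (measurable_coord j) my).
by under eq_fun do rewrite vext0.
Qed.

Lemma measurable_rVP n (y : T -> 'rV[R]_n) :
  mfT y <-> forall i, mfT (fun w => y w 0 i).
Proof.
split => [my i|]; last exact: measurable_to_rV.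
exact: (measurableT_comp (measurable_coord i) my).
Qed.

Lemma measurable_vrest n (y : T -> 'rV[R]_n.+1) :
  mfT y -> mfT (fun w => vrest (y w)).
Proof.
move=> /measurable_rVP my; apply/measurable_rVP => i.
by under eq_fun do rewrite mxE; exact: my.
Qed.

Lemma measurable_rVZ n (t : T -> R) (y : T -> 'rV[R]_n) :
  mfT t -> mfT y -> mfT (fun w => t w *: y w).
Proof.
move=> mt /measurable_rVP my; apply/measurable_rVP => i.
by under eq_fun do rewrite mxE; exact: measurable_funM.
Qed.

Lemma measurable_rVD n (x y : T -> 'rV[R]_n) :
  mfT x -> mfT y -> mfT (fun w => x w + y w).
Proof.
move=> /measurable_rVP mx /measurable_rVP my; apply/measurable_rVP => i.
by under eq_fun do rewrite mxE; exact: measurable_funD.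
Qed.

Lemma measurable_rVB n (x y : T -> 'rV[R]_n) :
  mfT x -> mfT y -> mfT (fun w => x w - y w).
Proof.
move=> /measurable_rVP mx /measurable_rVP my; apply/measurable_rVP => i.
by under eq_fun do rewrite !mxE; exact: measurable_funB.
Qed.

Lemma measurable_mulmx n m (x : T -> 'rV[R]_n) (M : T -> 'M[R]_(n, m)) :
  mfT x -> (forall i j, mfT (fun w => M w i j)) ->
  mfT (fun w => x w *m M w).
Proof.
move=> /measurable_rVP mx mM; apply/measurable_rVP => i.
under eq_fun do rewrite mxE.
by apply: measurable_sum => j; exact: measurable_funM.
Qed.

Lemma measurable_dotv n (x y : T -> 'rV[R]_n) :
  mfT x -> mfT y -> mfT (fun w => dotv (x w) (y w)).
Proof.
move=> /measurable_rVP mx /measurable_rVP my.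
by apply: measurable_sum => j; exact: measurable_funM.
Qed.

End measurability.

(** * Tonelli's theorem and image measures *)

Section tonelli.
Local Open Scope ereal_scope.
Context d1 d2 (T1 : measurableType d1) (T2 : measurableType d2) (R : realType).
Variable m2 : {sigma_finite_measure set T2 -> \bar R}.
Variable f : T1 -> T2 -> \bar R.
Hypothesis mf : mfT (fun z : T1 * T2 => f z.1 z.2).
Hypothesis f0 : forall x y, 0 <= f x y.

Lemma measurable_integral_snd : mfT (fun x => \int[m2]_y f x y).
Proof. exact: (measurable_fun_fubini_tonelli_F (fun z => f z.1 z.2)). Qed.

Lemma tonelli (m1 : {sigma_finite_measure set T1 -> \bar R}) :
  \int[m1]_x \int[m2]_y f x y = \int[m2]_y \int[m1]_x f x y.
Proof. exact: (fubini_tonelli (fun z => f z.1 z.2)). Qed.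

End tonelli.

Section lebesgue_tonelli.
Context d (T : measurableType d) (R : realType).

(* [lebesgue_measure] lives on [measurableTypeR R], whose display differs from
   that of [R]; the next two lemmas move product measurability across. *)
Lemma measurable_fun_RX d' (T' : measurableType d') (f : R * T -> T') :
  mfT f ->
  @measurable_fun _ _ (measurableTypeR R * T)%type T' setT f.
Proof. by []. Qed.

Lemma measurable_fun_XR d' (T' : measurableType d') (f : T * R -> T') :
  mfT f ->
  @measurable_fun _ _ (T * measurableTypeR R)%type T' setT f.
Proof. by []. Qed.

Local Open Scope ereal_scope.
Local Notation mu := (@lebesgue_measure R).
Variable f : T -> R -> \bar R.
Hypothesis mf : mfT (fun z : T * R => f z.1 z.2).
Hypothesis f0 : forall x y, 0 <= f x y.

Lemma measurable_integral_leb : mfT (fun x => \int[mu]_y f x y).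
Proof.
exact: (@measurable_integral_snd _ _ T (measurableTypeR R) _ mu f (measurable_fun_XR mf)).
Qed.

Lemma tonelli_leb (m : {sigma_finite_measure set T -> \bar R}) :
  \int[m]_x \int[mu]_y f x y = \int[mu]_y \int[m]_x f x y.
Proof.
exact: (@tonelli _ _ T (measurableTypeR R) _ mu f (measurable_fun_XR mf)).
Qed.

End lebesgue_tonelli.

Section image_measure.
Local Open Scope ereal_scope.
Context (R : realType).

(** Packs a proof of sigma-finiteness into the structure that Tonelli's theorem asks for. *)
Lemma sigma_finite_measureP d (T : measurableType d) (m : {measure set T -> \bar R}) :
  sigma_finite setT m ->
  exists P : {sigma_finite_measure set T -> \bar R}, P = m :> (set T -> \bar R).
Proof.
move=> sf.
pose H1 := @isSFinite.Build _ T R (Measure.sort m) (sfinite_measure_sigma_finite sf).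
pose H2 := @isSigmaFinite.Build _ T R (Measure.sort m) sf.
pose P := HB.pack_for (SigmaFiniteMeasure.type T R) (Measure.sort m) H1 H2.
by exists P.
Qed.

Context d d' (T : measurableType d) (T' : measurableType d').

(** Stated as an existence, so that of the packed image measure only the change of variables formula
    is remembered. *)
Lemma image_measure (m : {measure set T -> \bar R}) (phi : T -> T') :
  mfT phi -> sigma_finite setT (pushforward m phi) ->
  exists P : {sigma_finite_measure set T' -> \bar R},
  forall f, mfT f -> (forall x, 0 <= f x) ->
    \int[P]_x f x = \int[m]_x f (phi x).
Proof.
move=> mphi sf.
pose m' := @measure_function_pushforward__canonical__measure_function_Measure
  _ _ _ _ R m phi mphi.
have [P PE] : exists P : {sigma_finite_measure set T' -> \bar R},
    P = m' :> (set T' -> \bar R) by exact: sigma_finite_measureP.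
exists P => f mf f0; transitivity (\int[pushforward m phi]_x f x).
  by apply: eq_measure_integral => A mA _; have := congr1 (@^~ A) PE.
by rewrite ge0_integral_pushforward.
Qed.

End image_measure.

(** * Lebesgue measure on [R^n] *)

Section lebn.
Variable R : realType.
Local Open Scope ereal_scope.

(** By induction, the measure is the image under [vext] of the product of the one-dimensional
    Lebesgue measure with the one already found. *)
Lemma lebint_measure n : exists m : {sigma_finite_measure set 'rV[R]_n -> \bar R},
  forall f, mfT f -> (forall x, 0 <= f x) ->
    lebint f = \int[m]_x f x.
Proof.
elim: n => [|n [m IH]].
  exists (@dirac _ 'rV[R]_0 0%R R) => f mf f0 /=.
  by rewrite integral_dirac//= diracT mul1e.
pose phi (z : measurableTypeR R * 'rV[R]_n) := vext z.1 z.2.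
have mphi : @measurable_fun _ _ (measurableTypeR R * 'rV[R]_n)%type _ setT phi.
  by apply: measurable_fun_RX; exact: measurable_vext.
pose M : {measure set (measurableTypeR R * 'rV[R]_n)%type -> \bar R} :=
  (@lebesgue_measure R \x m).
have sf : sigma_finite setT (pushforward M phi).
  have /sigma_finiteP[F [TF ndF Foo]] := sigma_finiteT (@lebesgue_measure R).
  have /sigma_finiteP[G [TG ndG Goo]] := sigma_finiteT m.
  (* The image measure is sigma-finite because an exhaustion of the product by rectangles pulls back
     along [psi], the measurable inverse of [phi]. *)
  pose psi (x : 'rV[R]_n.+1) : measurableTypeR R * 'rV[R]_n := (x 0%R ord0, vrest x).
  have mpsi : @measurable_fun _ _ _ (measurableTypeR R * 'rV[R]_n)%type setT psi.
    by apply/measurable_fun_pairP; split; [exact: measurable_coord|exact: measurable_vrest].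
  exists (fun i => psi @^-1` (F i `*` G i)) => [|i].
    rewrite -preimage_bigcup -(preimage_setT psi); congr (_ @^-1` _).
    apply/esym/seteqP; split => // -[x y] _.
    have [k _ Fkx] : (\bigcup_k F k) x by rewrite -TF.
    have [l _ Gly] : (\bigcup_k G k) y by rewrite -TG.
    exists (maxn k l) => //; split => /=.
      by move: x Fkx; exact/subsetPset/ndF/leq_maxl.
    by move: y Gly; exact/subsetPset/ndG/leq_maxr.
  have [mFi Fioo] := Foo i; have [mGi Gioo] := Goo i; split.
    by rewrite -[X in measurable X]setTI; apply: mpsi => //; exact: measurableX.
  rewrite /pushforward -comp_preimage (_ : psi \o phi = id); last first.
    by apply/funext => -[a b]; rewrite /psi/phi /= vext0 vextK.
  rewrite preimage_id.
  have -> : M (F i `*` G i) = lebesgue_measure (F i) * m (G i).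
    exact: product_measure1E.
  by rewrite lte_mul_pinfty// ge0_fin_numE.
have [P PE] := image_measure mphi sf.
exists P => f mf f0; rewrite PE//=.
transitivity (\int[lebesgue_measure \x m]_z f (phi z)); last by [].
rewrite fubini_tonelli1//=; last exact: measurableT_comp.
apply: eq_integral => t _; rewrite IH//.
by apply: measurableT_comp => //; exact: measurable_vext.
Qed.

Definition lebn n := sval (cid (lebint_measure n)).

Lemma lebintE n (f : 'rV[R]_n -> \bar R) :
  mfT f -> (forall x, 0 <= f x) -> lebint f = \int[lebn n]_x f x.
Proof. by rewrite /lebn; case: cid => m /=; apply. Qed.

Lemma lebint_ge0 n (f : 'rV[R]_n -> \bar R) : (forall x, 0 <= f x) -> 0 <= lebint f.
Proof.
elim: n f => [f f0|n IH f f0]; first exact: f0.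
rewrite -[lebint f]/(\int[lebesgue_measure]_(t in setT) lebint (fun y => f (vext t y))).
by apply: integral_ge0 => t _; exact: IH.
Qed.

End lebn.

(** * Translations, scalings and linear maps *)

Section affine.
Variable R : realType.
Local Open Scope ereal_scope.
Local Notation mu := (@lebesgue_measure R).

Lemma integral_lebN (f : R -> \bar R) : mfT f -> (forall x, 0 <= f x) ->
  \int[mu]_x f (- x)%R = \int[mu]_x f x.
Proof.
move=> mf f0.
have mN : @measurable_fun _ _ (measurableTypeR R) (measurableTypeR R) setT (-%R : R -> R).
  exact: oppr_measurable.
transitivity (\int[pushforward mu (-%R : R -> measurableTypeR R)]_x f x).
  by rewrite (ge0_integral_pushforward mN) //= preimage_setT.
by apply: eq_measure_integral => A mA _; exact: lebesgue_measureN.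
Qed.

(** By uniqueness of Lebesgue measure: [a] times the image of [mu] under [x |-> a * x + b] gives
    half-open intervals their length. *)
Lemma integral_leb_affine_pos (a b : R) (f : R -> \bar R) : (0 < a)%R ->
  mfT f -> (forall x, 0 <= f x) ->
  \int[mu]_x f x = a%:E * \int[mu]_x f (a * x + b)%R.
Proof.
move=> a0 mf f0.
pose phi : measurableTypeR R -> measurableTypeR R := fun x => (a * x + b)%R.
have mphi : mfT phi by exact: measurable_funD.
pose nu := mscale (NngNum (ltW a0))
  (@measure_function_pushforward__canonical__measure_function_Measure _ _ _ _ R mu phi mphi).
transitivity (\int[nu]_x f x).
  apply: eq_measure_integral => A mA _; apply: lebesgue_measure_unique => //.
  move=> _ [[u v] _ <-]; rewrite /nu.
  transitivity (a%:E * mu (phi @^-1` `]u, v])); last by [].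
  rewrite (_ : phi @^-1` _ = `]((u - b) / a)%R, ((v - b) / a)%R]%classic); last first.
    apply/seteqP; split => x /=; rewrite !in_itv/= /phi.
      by move=> /andP[h1 h2]; rewrite ltr_pdivrMr// ler_pdivlMr//; lra.
    by rewrite ltr_pdivrMr// ler_pdivlMr// => /andP[h1 h2]; lra.
  rewrite !lebesgue_measure_itv/= !lte_fin ltr_pM2r ?invr_gt0// ltrD2r.
  case: ifPn; last by rewrite mule0.
  by move=> uv; rewrite -EFinM; congr EFin; field; rewrite gt_eqF.
rewrite ge0_integral_mscale//=; congr (_ * _).
by rewrite (ge0_integral_pushforward mphi).
Qed.

Lemma integral_leb_shift (b : R) (f : R -> \bar R) :
  mfT f -> (forall x, 0 <= f x) ->
  \int[mu]_x f (x + b)%R = \int[mu]_x f x.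
Proof.
move=> mf f0; rewrite (integral_leb_affine_pos b ltr01 mf f0) mul1e.
by apply: eq_integral => x _; rewrite mul1r.
Qed.

Lemma integral_leb_scale (a : R) (f : R -> \bar R) : a != 0%R ->
  mfT f -> (forall x, 0 <= f x) ->
  \int[mu]_x f (a * x)%R = (`|a|^-1)%:E * \int[mu]_x f x.
Proof.
move=> a0 mf f0.
wlog : a a0 f mf f0 / (0 < a)%R => [wlg|apos].
  have [an|ap|/eqP] := ltgtP a 0%R; [|exact: wlg|by rewrite (negbTE a0)].
  rewrite -(normrN a) -(integral_lebN mf f0) -(wlg (- a)%R) ?oppr_eq0 ?oppr_gt0//.
  - by apply: eq_integral => x _; rewrite mulNr opprK.
  - by apply: measurableT_comp => //; exact: oppr_measurable.
rewrite gtr0_norm// (integral_leb_affine_pos 0%R apos mf f0) muleA -EFinM.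
rewrite mulVf// mul1e; apply: eq_integral => x _; by rewrite addr0.
Qed.

End affine.

Section lebint_theory.
Variable R : realType.
Local Open Scope ereal_scope.
Local Notation mu := (@lebesgue_measure R).

Lemma lebintS n (f : 'rV[R]_n.+1 -> \bar R) :
  lebint f = \int[mu]_t lebint (fun y => f (vext t y)).
Proof. by []. Qed.

Lemma eq_lebint n (f g : 'rV[R]_n -> \bar R) : f =1 g -> lebint f = lebint g.
Proof. by move=> /funext ->. Qed.

Lemma measurable_section d1 d2 d3 (T1 : measurableType d1) (T2 : measurableType d2)
    (T3 : measurableType d3) (f : T1 -> T2 -> T3) (x : T1) :
  mfT (fun z : T1 * T2 => f z.1 z.2) -> mfT (f x).
Proof.
by move=> mf; apply: (measurableT_comp mf (g := pair x)); exact: pair1_measurable.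
Qed.

Lemma measurable_section2 d1 d2 d3 (T1 : measurableType d1) (T2 : measurableType d2)
    (T3 : measurableType d3) (f : T1 -> T2 -> T3) (y : T2) :
  mfT (fun z : T1 * T2 => f z.1 z.2) -> mfT (f^~ y).
Proof.
by move=> mf; apply: (measurableT_comp mf (g := pair^~ y)); exact: pair2_measurable.
Qed.

Lemma measurable_uncurry_swap d1 d2 d3 (T1 : measurableType d1) (T2 : measurableType d2)
    (T3 : measurableType d3) (f : T1 -> T2 -> T3) :
  mfT (fun z : T1 * T2 => f z.1 z.2) ->
  mfT (fun z : T2 * T1 => f z.2 z.1).
Proof.
move=> mf; apply: (measurableT_comp mf (g := fun z : T2 * T1 => (z.2, z.1))).
exact: measurable_fun_pair.
Qed.

Lemma measurable_lebint d (T : measurableType d) n (F : T -> 'rV[R]_n -> \bar R) :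
  mfT (fun z : T * 'rV[R]_n => F z.1 z.2) ->
  (forall x y, 0 <= F x y) -> mfT (fun w => lebint (F w)).
Proof.
move=> mF F0.
under eq_fun do rewrite (lebintE (measurable_section _ mF))//.
exact: measurable_integral_snd.
Qed.

Lemma lebint_leb_swap n (F : R -> 'rV[R]_n -> \bar R) :
  mfT (fun z : R * 'rV[R]_n => F z.1 z.2) ->
  (forall x y, 0 <= F x y) ->
  \int[mu]_t lebint (F t) = lebint (fun y => \int[mu]_t F t y).
Proof.
move=> mF F0.
under eq_integral do rewrite (lebintE (measurable_section _ mF))//.
have mF' : mfT (fun z : 'rV[R]_n * R => F z.2 z.1).
  exact: measurable_uncurry_swap.
rewrite lebintE; last 2 first.
- exact: (@measurable_integral_leb _ _ _ (fun y t => F t y)).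
- by move=> y; exact: integral_ge0.
by rewrite (@tonelli_leb _ _ _ (fun y t => F t y)).
Qed.

Lemma lebint_shift n (c : 'rV[R]_n) (f : 'rV[R]_n -> \bar R) :
  mfT f -> (forall x, 0 <= f x) ->
  lebint (fun y => f (y + c)%R) = lebint f.
Proof.
elim: n c f => [|n IH] c f mf f0; first by rewrite /= (thinmx0 (0 + c)%R).
rewrite !lebintS.
rewrite -(@integral_leb_shift _ (c 0%R 0%R) (fun t => lebint (fun y => f (vext t y)))).
- apply: eq_integral => t _.
  rewrite -(IH (vrest c) (fun y => f (vext _ y))) //; last first.
    by apply: measurableT_comp => //; exact: measurable_vext.
  apply: eq_lebint => y; congr f; apply/rowP => i.
  have [j ->|->] := unliftP ord0 i; first by rewrite [in LHS]mxE !vextS !mxE.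
  by rewrite [in LHS]mxE !vext0.
- apply: (@measurable_lebint _ _ _ (fun t y => f (vext t y))) => //.
  by apply: measurableT_comp => //; exact: measurable_vext.
- by move=> t; exact: lebint_ge0.
Qed.

(** Opens [vext] to block matrix computations. *)
Lemma vext_row_mx n (t : R) (y : 'rV[R]_n) : vext t y = row_mx t%:M y :> 'rV[R]_(1 + n).
Proof.
apply/rowP => i; have [j ->|->] := unliftP ord0 i.
  by rewrite vextS -rshift1 row_mxEr.
rewrite vext0; have -> : ord0 = lshift n ord0 :> 'I_(1 + n) by exact/val_inj.
by rewrite row_mxEl mxE eqxx.
Qed.

Lemma lebintZl n (c : R) (f : 'rV[R]_n -> \bar R) : (0 <= c)%R ->
  mfT f -> (forall x, 0 <= f x) ->
  lebint (fun y => c%:E * f y) = c%:E * lebint f.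
Proof.
move=> c0 mf f0; rewrite !lebintE//; first by rewrite ge0_integralZl_EFin.
- exact: measurable_funeM.
- by move=> y; rewrite mule_ge0.
Qed.

End lebint_theory.

Section linear_maps.
Variable R : realType.
Local Open Scope ereal_scope.
Local Notation mu := (@lebesgue_measure R).

(** In effect [c] is the inverse of the absolute determinant. It is kept abstract, since later only
    its existence matters and the total mass of the sphere determines it. *)
Definition lebint_scaled n (A : 'M[R]_n) (c : R) :=
  forall f : 'rV[R]_n -> \bar R, mfT f -> (forall x, 0 <= f x) ->
  lebint (fun y => f (y *m A)) = c%:E * lebint f.

Lemma measurable_mulmxr n m (A : 'M[R]_(n, m)) :
  mfT (fun y : 'rV[R]_n => y *m A).
Proof. exact: (measurable_mulmx (x := id) (M := fun _ => A)). Qed.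

Lemma lebint_scaledM n (A B : 'M[R]_n) a b : (0 <= a)%R -> (0 <= b)%R ->
  lebint_scaled A a -> lebint_scaled B b -> lebint_scaled (A *m B) (a * b).
Proof.
move=> a0 b0 Aa Bb f mf f0; under eq_lebint do rewrite mulmxA.
rewrite (Aa (fun y => f (y *m B))) ?Bb ?muleA//.
by apply: measurableT_comp => //; exact: measurable_mulmxr.
Qed.

Lemma vext_block n (t : R) (y : 'rV[R]_n) (a : R) b c (D : 'M[R]_n) :
  (vext t y : 'rV[R]_(1 + n)) *m block_mx a%:M b c D =
  vext (t * a + (y *m c) 0 0)%R (t *: b + y *m D)%R.
Proof.
rewrite !vext_row_mx mul_row_block !mul_scalar_mx; congr row_mx.
rewrite scale_scalar_mx.
by apply/matrixP => i j; rewrite !ord1 !mxE !eqxx !mulr1n.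
Qed.

(** For each fixed first coordinate the shear is a translation of the others. *)
Lemma lebint_scaled_upper n (b : 'rV[R]_n) :
  lebint_scaled (block_mx 1%:M b 0 1%:M : 'M[R]_(1 + n)) 1%R.
Proof.
move=> f mf f0; rewrite mul1e (lebintS f) lebintS; apply: eq_integral => t _.
rewrite -(lebint_shift (t *: b) (f := fun y => f (vext t y)))//; last first.
  by apply: measurableT_comp => //; exact: measurable_vext.
apply: eq_lebint => y; rewrite vext_block mulmx0 mxE addr0 mulr1 mulmx1.
by rewrite addrC.
Qed.

(** After Tonelli, the shear is for each fixed [y] a translation of the first coordinate. *)
Lemma lebint_scaled_lower n (c : 'cV[R]_n) :
  lebint_scaled (block_mx 1%:M 0 c 1%:M : 'M[R]_(1 + n)) 1%R.
Proof.
move=> f mf f0; rewrite mul1e (lebintS f) lebintS.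
pose F t y := f (vext t y).
have mF : mfT (fun z : R * 'rV[R]_n => F z.1 z.2).
  by apply: measurableT_comp => //; exact: measurable_vext.
pose G t y := F (t + (y *m c) 0 0)%R y.
have mG : mfT (fun z : R * 'rV[R]_n => G z.1 z.2).
  rewrite /G /F; apply: measurableT_comp => //; apply: measurable_vext => //.
  apply: measurable_funD => //.
  have /measurable_rVP/(_ 0%R) := measurableT_comp (measurable_mulmxr c) (@measurable_snd _ _ R 'rV[R]_n).
  exact.
rewrite [RHS](@lebint_leb_swap _ _ F)//; last by move=> *; exact: f0.
transitivity (lebint (fun y => \int[mu]_t G t y)); last first.
  apply: eq_lebint => y; apply: (@integral_leb_shift _ _ (F^~ y)).
    exact: measurable_section2 mF.
  by move=> t; exact: f0.
rewrite -[RHS](@lebint_leb_swap _ _ G)//; last by move=> *; exact: f0.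
apply: eq_integral => t _; apply: eq_lebint => y.
by rewrite vext_block mulr1 scaler0 add0r mulmx1.
Qed.

Lemma lebint_scaled_diag n (a : R) (S : 'M[R]_n) c : a != 0%R -> (0 <= c)%R ->
  lebint_scaled S c ->
  lebint_scaled (block_mx a%:M 0 0 S : 'M[R]_(1 + n)) (`|a|^-1 * c).
Proof.
move=> a0 c0 Sc f mf f0; rewrite (lebintS f) lebintS.
have mft t : mfT (fun y => f (vext t y)).
  by apply: measurableT_comp => //; exact: measurable_vext.
transitivity (\int[mu]_t (c%:E * lebint (fun y => f (vext (a * t)%R y)))).
  apply: eq_integral => t _; rewrite -Sc//; apply: eq_lebint => y.
  by rewrite vext_block mulmx0 mxE addr0 scaler0 add0r mulrC.
have mlf : mfT (fun t => lebint (fun y => f (vext t y))).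
  apply: measurable_lebint => //.
  by apply: measurableT_comp => //; exact: measurable_vext.
have lf0 t : 0 <= lebint (fun y => f (vext t y)) by exact: lebint_ge0.
rewrite (@integral_leb_scale _ a (fun t => c%:E * lebint (fun y => f (vext t y))))//.
- by rewrite ge0_integralZl_EFin// EFinM muleA.
- exact: measurable_funeM.
- by move=> t; rewrite mule_ge0.
Qed.

(* Gaussian elimination: a vanishing pivot is first removed by adding a lower
   row to the top one. *)
Lemma lebint_linear n (A : 'M[R]_n) : A \in unitmx ->
  exists2 c, (0 < c)%R & lebint_scaled A c.
Proof.
elim: n A => [|n IH] A uA.
  exists 1%R => // f mf f0; rewrite mul1e /=; congr f; exact: thinmx0.
have pivot (B : 'M[R]_(1 + n)) : B \in unitmx -> B ord0 ord0 != 0%R ->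
    exists2 c, (0 < c)%R & lebint_scaled B c.
  move=> uB B00; pose a := B ord0 ord0; pose r := ursubmx B; pose k := dlsubmx B.
  pose S := (drsubmx B - a^-1 *: (k *m r))%R.
  have ulE : ulsubmx B = a%:M.
    by rewrite [LHS]mx11_scalar !mxE; congr (B _ _)%:M; exact/val_inj.
  (* Lower shear, block diagonal and upper shear, where [S] is the Schur complement of the pivot
     [a]. *)
  have BE : B = block_mx 1%:M 0 (a^-1 *: k) 1%:M *m
      (block_mx a%:M 0 0 S *m block_mx 1%:M (a^-1 *: r) 0 1%:M).
    rewrite !mulmx_block !(mulmx0, mul0mx, mulmx1, mul1mx, addr0, add0r).
    rewrite -{1}[B]submxK ulE -/r -/k; congr block_mx.
    - by rewrite mul_scalar_mx scalerA mulfV// scale1r.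
    - by rewrite mul_mx_scalar scalerA mulfV// scale1r.
    - rewrite mul_scalar_mx scalerA mulfV// scale1r -scalemxAl /S.
      by rewrite addrC subrK.
  have uS : S \in unitmx.
    move: uB; rewrite BE !unitmx_mul => /and3P[_ + _].
    by rewrite !unitmxE det_ublock unitrM => /andP[].
  have [c c0 Sc] := IH _ uS.
  exists (1 * (`|a|^-1 * c * 1))%R.
    by rewrite mul1r mulr1 mulr_gt0// invr_gt0 normr_gt0.
  have ac0 : (0 <= `|a|^-1 * c)%R by rewrite mulr_ge0// ltW.
  rewrite BE; apply: lebint_scaledM; rewrite ?mulr1//; first exact: lebint_scaled_lower.
  rewrite -[X in lebint_scaled _ X]mulr1; apply: lebint_scaledM => //.
    by apply: lebint_scaled_diag => //; exact: ltW.
  exact: lebint_scaled_upper.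
have [A00|A00] := eqVneq (A ord0 ord0) 0%R; last exact: pivot A00.
have [j Aj0] : exists j, A (lift ord0 j) ord0 != 0%R.
  apply/existsP; rewrite -[[exists _, _]]negbK negb_exists; apply/negP => /forallP A0.
  have : (delta_mx ord0 ord0 : 'cV[R]_n.+1) = 0%R.
    rewrite -(mulKmx uA (delta_mx ord0 ord0)) -colE (_ : col ord0 A = 0%R) ?mulmx0//.
    apply/colP => i; rewrite !mxE; have [l ->|->//] := unliftP ord0 i.
    by apply/eqP; rewrite -[_ == _]negbK A0.
  by move/colP/(_ ord0); rewrite !mxE/= => /eqP; rewrite oner_eq0.
pose e (s : R) : 'M[R]_(1 + n) := block_mx 1%:M (s *: delta_mx ord0 j) 0 1%:M.
have eK : e (-1)%R *m e 1%R = 1%:M.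
  rewrite mulmx_block !(mulmx0, mul0mx, mulmx1, mul1mx, addr0, add0r).
  by rewrite scaleN1r scale1r subrr -scalar_mx_block.
have [ue1 _] := mulmx1_unit eK.
have [_ ue2] := mulmx1_unit eK.
pose A1 : 'M[R]_(1 + n) := A.
have [c c0 Bc] : exists2 c, (0 < c)%R & lebint_scaled (e 1%R *m A1) c.
  apply: pivot; first by rewrite unitmx_mul ue2.
  rewrite /e -[A1]submxK mulmx_block mul0mx add0r !mul1mx scale1r.
  have -> : (ord0 : 'I_(1 + n)) = lshift n ord0 by exact/val_inj.
  rewrite block_mxEul mxE -rowE !mxE.
  rewrite (_ : lshift n ord0 = ord0 :> 'I_(1 + n)) ?A00 ?add0r; last exact/val_inj.
  by rewrite rshift1.
exists (1 * c)%R; first by rewrite mul1r.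
rewrite -[A]/A1 -[A1]mul1mx -eK -mulmxA; apply: lebint_scaledM => //; first exact: ltW.
exact: lebint_scaled_upper.
Qed.

End linear_maps.

(** * The surface measure of the sphere *)

Section sphere_measure.
Variable R : realType.
Local Open Scope ereal_scope.
Local Notation mu := (@lebesgue_measure R).

Lemma measurable_inv d (T : measurableType d) (f : T -> R) :
  mfT f -> mfT (fun x => (f x)^-1)%R.
Proof.
suff mi : mfT (fun x : R => x^-1)%R by exact: measurableT_comp.
have -> : [set: R] = [set 0%R] `|` ~` [set 0%R] by rewrite setUv.
apply/measurable_funU => //; first exact: measurableC.
split; first exact: measurable_fun_set1.
apply: open_continuous_measurable_fun; first exact/closed_openC/closed_eq.
by move=> x; rewrite inE => /= /eqP x0; exact: inv_continuous.
Qed.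

Lemma measurable_sqrt d (T : measurableType d) (f : T -> R) :
  mfT f -> mfT (fun x => Num.sqrt (f x)).
Proof.
by move=> mf; apply: (measurableT_comp (continuous_measurable_fun (@sqrt_continuous R))).
Qed.

Definition unitv n (y : 'rV[R]_n) : 'rV[R]_n := (Num.sqrt (dotv y y))^-1 *: y.

Definition pball n : set 'rV[R]_n := [set y | (0 < dotv y y <= 1)%R].

Lemma dotv_ge0 n (y : 'rV[R]_n) : (0 <= dotv y y)%R.
Proof. by apply: sumr_ge0 => i _; exact: sqr_ge0. Qed.

Lemma dotv_vext n t s (x y : 'rV[R]_n) :
  dotv (vext t x) (vext s y) = (t * s + dotv x y)%R.
Proof.
rewrite /dotv big_ord_recl !vext0; congr (_ + _)%R.
by apply: eq_bigr => i _; rewrite !vextS.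
Qed.

Lemma measurable_unitv n : mfT (@unitv n).
Proof.
by apply: measurable_rVZ => //; apply/measurable_inv/measurable_sqrt/measurable_dotv.
Qed.

Lemma measurable_pballb n : mfT (fun y : 'rV[R]_n => 0 < dotv y y <= 1)%R.
Proof.
have md := @measurable_dotv _ _ R n id id (@measurable_id _ _ setT) (@measurable_id _ _ setT).
by apply: measurable_and; [exact: measurable_fun_ltr|exact: measurable_fun_ler].
Qed.

Lemma measurable_pball n : measurable (@pball n).
Proof.
by have := @measurable_pballb n measurableT [set true]; rewrite setTI; exact.
Qed.

Lemma le_lebint n (f g : 'rV[R]_n -> \bar R) :
  mfT f -> mfT g -> (forall x, 0 <= f x) ->
  (forall x, f x <= g x) -> lebint f <= lebint g.
Proof.
move=> mf mg f0 fg; have g0 x : 0 <= g x by exact: le_trans (fg x).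
by rewrite !lebintE//; apply: ge0_le_integral.
Qed.

(** The ball lies in the cube of side 2: each slice of the ball is contained in the ball of one
    dimension less, and is empty unless the first coordinate is in [[-1, 1]]. *)
Lemma lebint_ball_fin n : lebint (fun y : 'rV[R]_n => (\1_(@pball n) y)%:E) < +oo.
Proof.
apply: (@le_lt_trans _ _ ((2 : R) ^+ n)%:E); last by rewrite ltry.
pose B n := [set y : 'rV[R]_n | (dotv y y <= 1)%R].
have mB m : measurable (B m).
  have md := @measurable_dotv _ _ R m id id (@measurable_id _ _ setT) (@measurable_id _ _ setT).
  have mb : mfT (fun y : 'rV[R]_m => dotv y y <= 1)%R.
    exact: measurable_fun_ler.
  by have := mb measurableT [set true]; rewrite setTI; exact.
have mi m : mfT (fun y : 'rV[R]_m => (\1_(B m) y)%:E : \bar R).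
  by apply/measurable_EFinP; exact: measurable_indic.
apply: (@le_trans _ _ (lebint (fun y => (\1_(B n) y)%:E))).
  apply: le_lebint => //; first by apply/measurable_EFinP; apply: measurable_indic; exact: measurable_pball.
  move=> y; rewrite lee_fin !indicE ler_nat /B.
  have [|//] := boolP (y \in pball (n:=n)); rewrite inE => /andP[_ y1].
  by rewrite mem_set.
elim: n => [|n IH]; first by rewrite /= expr0 lee_fin indicE; case: (_ \in _).
rewrite lebintS.
have m1 t : mfT (fun y : 'rV[R]_n => (\1_(B n.+1) (vext t y))%:E : \bar R).
  by apply: (measurableT_comp (mi n.+1)); exact: measurable_vext.
pose I11 := `[(-1)%R, 1%R]%classic : set R. have mI : measurable I11 by exact: measurable_itv.
apply: (@le_trans _ _ (\int[mu]_t ((\1_I11 t)%:E * (2 ^+ n)%:E))).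
  apply: ge0_le_integral => //.
  - by move=> t _; exact: lebint_ge0.
  - apply: measurable_lebint => //.
    by apply: (measurableT_comp (mi n.+1)); exact: measurable_vext.
  - apply: emeasurable_funM; last exact: measurable_cst.
    by apply/measurable_EFinP; exact: measurable_indic.
  move=> t _; apply: le_trans (_ : lebint (fun y : 'rV[R]_n =>
      (\1_I11 t)%:E * (\1_(B n) y)%:E) <= _).
    apply: le_lebint => //; first exact: measurable_funeM.
    move=> y; rewrite -EFinM lee_fin !indicE -natrM ler_nat.
    have [|//] := boolP (vext t y \in _); rewrite inE /B/= dotv_vext => ty.
    rewrite !mem_set//=.
      by have := sqr_ge0 t; rewrite expr2; lra.
    rewrite /I11/= in_itv/= -ler_norml -(@ler_pXn2r _ 2) ?nnegrE// expr1n real_normK ?num_real//.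
    by have := dotv_ge0 y; rewrite expr2; lra.
  rewrite lebintZl//; apply: lee_wpmul2l => //.
rewrite ge0_integralZr//; last exact/measurable_EFinP/measurable_indic.
rewrite integral_indic//= setIT lebesgue_measure_itv/= lte_fin ifT; last lra.
by rewrite -EFinM lee_fin exprS; lra.
Qed.

Lemma integral_mrestr d (T : measurableType d) (m : {measure set T -> \bar R}) D
    (mD : measurable D) (f : T -> \bar R) :
  mfT f -> (forall x, 0 <= f x) ->
  \int[mrestr m mD]_x f x = \int[m]_(x in D) f x.
Proof.
move=> mf f0.
rewrite (@ge0_negligible_integral _ _ _ _ setT (~` D))//.
- rewrite setTD setCK; apply: eq_measure_integral => A mA AD.
  by rewrite /= /mrestr setIidl.
- exact: measurableC.
- by rewrite /= /mrestr setICl measure0.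
Qed.

(** The cone formula read as a measure: [n] times Lebesgue measure on the punctured ball, carried to
    the sphere by [unitv]. Its finiteness is recorded here because [sig] hides the construction. *)
Lemma sphint_measure n : exists m : {sigma_finite_measure set 'rV[R]_n -> \bar R},
  m setT < +oo /\
  forall f, mfT f -> (forall x, 0 <= f x) -> sphint f = \int[m]_x f x.
Proof.
pose m0 : {measure set 'rV[R]_n -> \bar R} := mrestr (lebn R n) (@measurable_pball n).
pose m1 : {measure set 'rV[R]_n -> \bar R} := mscale (NngNum (ler0n R n)) m0.
have m1T : m1 setT < +oo.
  have -> : m1 setT = (n%:R)%:E * lebn R n (setT `&` @pball n) by [].
  rewrite setTI lte_mul_pinfty ?lee_fin ?ler0n//.
  have := lebint_ball_fin n; rewrite lebintE.
  - by rewrite integral_indic ?setIT//; exact: measurable_pball.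
  - by apply/measurable_EFinP; apply: measurable_indic; exact: measurable_pball.
  - by move=> x; rewrite lee_fin.
have sf : sigma_finite setT (pushforward m1 (@unitv n)).
  apply: fin_num_fun_sigma_finite; first by rewrite /pushforward preimage_set0 measure0.
  move=> A mA; rewrite /pushforward; apply: lty_fin_num_fun => //.
  by rewrite -[X in measurable X]setTI; exact: measurable_unitv.
have [P PE] := image_measure (@measurable_unitv n) sf.
exists P; split.
  have := PE (fun _ => 1) (@measurable_cst _ _ _ _ _ _) (fun _ => lee01).
  by rewrite !integral_cst//= !mul1e => ->.
move=> f mf f0; rewrite PE//.
have mfu : mfT (fun y => f (unitv y)).
  by apply: measurableT_comp => //; exact: measurable_unitv.
rewrite ge0_integral_mscale//= integral_mrestr// /sphint; congr (_ * _).
rewrite integral_mkcond lebintE.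
- apply: eq_integral => y _; rewrite patchE.
  have [|] := boolP (y \in _); first by rewrite inE /pball/= => ->.
  by rewrite notin_setE /pball/= => /negP/negbTE ->.
- by apply: measurable_fun_ifT => //; exact: measurable_pballb.
- by move=> y; case: ifP.
Qed.

Definition sig n := sval (cid (sphint_measure n)).

Lemma sphintE n (f : 'rV[R]_n -> \bar R) : mfT f ->
  (forall x, 0 <= f x) -> sphint f = \int[sig n]_x f x.
Proof. by rewrite /sig; case: cid => m /= [_]; apply. Qed.

Lemma sig_fin n : sig n setT < +oo.
Proof. by rewrite /sig; case: cid => m /= []. Qed.

End sphere_measure.

(** * Rotation invariance of the surface measure *)

Section sphere_invariance.
Variable R : realType.
Local Open Scope ereal_scope.
Local Notation mu := (@lebesgue_measure R).

Lemma dotvE n (x y : 'rV[R]_n) : dotv x y = (x *m y^T) ord0 ord0.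
Proof. by rewrite mxE; apply: eq_bigr => i _; rewrite mxE. Qed.

Lemma dotv_orth n m (O : 'M[R]_(n, m)) (x y : 'rV[R]_n) : O *m O^T = 1%:M ->
  dotv (x *m O) (y *m O) = dotv x y.
Proof. by move=> OO; rewrite !dotvE trmx_mul mulmxA -(mulmxA x) OO mulmx1. Qed.

Lemma dotvZ n (a b : R) (x y : 'rV[R]_n) : dotv (a *: x) (b *: y) = (a * b * dotv x y)%R.
Proof.
rewrite /dotv mulr_sumr; apply: eq_bigr => i _; rewrite !mxE; ring.
Qed.

Lemma unitv_orth n m (O : 'M[R]_(n, m)) (x : 'rV[R]_n) : O *m O^T = 1%:M ->
  unitv (x *m O) = unitv x *m O.
Proof. by move=> OO; rewrite /unitv dotv_orth// scalemxAl. Qed.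

Definition pballb n (y : 'rV[R]_n) := (0 < dotv y y <= 1)%R.

Lemma measurable_sphint_integrand n (f : 'rV[R]_n -> \bar R) :
  mfT f ->
  mfT (fun y => if pballb y then f (unitv y) else 0).
Proof.
move=> mf; apply: measurable_fun_ifT => //; first exact: measurable_pballb.
by apply: measurableT_comp => //; exact: measurable_unitv.
Qed.

(** An orthogonal map commutes with [unitv] and preserves the ball, so it multiplies [sphint] by the
    same constant [c] as [lebint]. The test function [1], which it leaves unchanged, shows
    [c = 1]. *)
Lemma sphint_orth n (O : 'M[R]_n) (f : 'rV[R]_n -> \bar R) : O *m O^T = 1%:M ->
  mfT f -> (forall x, 0 <= f x) ->
  sphint (fun v => f (v *m O)) = sphint f.
Proof.
move=> OO mf f0; have [uO _] := mulmx1_unit OO.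
have [c c0 Oc] := lebint_linear uO.
have key (g : 'rV[R]_n -> \bar R) : mfT g -> (forall x, 0 <= g x) ->
    sphint (fun v => g (v *m O)) = c%:E * sphint g.
  move=> mg g0; rewrite /sphint muleCA; congr (_ * _).
  rewrite -(Oc _ (measurable_sphint_integrand mg)); last by move=> x; case: ifP.
  by apply: eq_lebint => y; rewrite /pballb dotv_orth// unitv_orth.
have mfO : mfT (fun v => f (v *m O)).
  by apply: measurableT_comp => //; exact: measurable_mulmxr.
(* A vanishing total mass, as for [n = 0], says nothing about [c], but then every integral is
   zero. *)
have [w0|w0] := eqVneq (sig R n setT) 0.
  have z (g : 'rV[R]_n -> \bar R) : mfT g -> (forall x, 0 <= g x) -> sphint g = 0.
    by move=> mg g0; rewrite sphintE// null_set_integral.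
  by rewrite !z.
rewrite key// -[RHS]mul1e; congr (_ * _).
have m1 : mfT (fun _ : 'rV[R]_n => 1 : \bar R) by exact: measurable_cst.
have p1 (x : 'rV[R]_n) : (0 : \bar R) <= 1 by exact: lee01.
have := key _ m1 p1.
have wf : sig R n setT \is a fin_num by rewrite ge0_fin_numE ?sig_fin.
rewrite sphintE// integral_cst//= mul1e -(fineK wf) -EFinM => -[].
rewrite -{1}[fine _]mul1r => /mulIf -> //.
by apply: contra w0 => /eqP w0; rewrite -(fineK wf) w0.
Qed.

Lemma measurable_sphint d (T : measurableType d) n (F : T -> 'rV[R]_n -> \bar R) :
  mfT (fun z : T * 'rV[R]_n => F z.1 z.2) ->
  (forall x y, 0 <= F x y) -> mfT (fun w => sphint (F w)).
Proof.
move=> mF F0.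
under eq_fun do rewrite (sphintE (measurable_section _ mF))//.
exact: measurable_integral_snd.
Qed.

Lemma sphint_ge0 n (f : 'rV[R]_n -> \bar R) : (forall x, 0 <= f x) -> 0 <= sphint f.
Proof.
by move=> f0; rewrite mule_ge0// ?lee_fin// lebint_ge0// => y; case: ifP.
Qed.

Lemma sphintZl n (c : R) (f : 'rV[R]_n -> \bar R) : (0 <= c)%R ->
  mfT f -> (forall x, 0 <= f x) ->
  sphint (fun y => c%:E * f y) = c%:E * sphint f.
Proof.
move=> c0 mf f0; rewrite !sphintE//; first by rewrite ge0_integralZl_EFin.
- exact: measurable_funeM.
- by move=> y; rewrite mule_ge0.
Qed.

Lemma sphint_leb_swap n (F : R -> 'rV[R]_n -> \bar R) :
  mfT (fun z : R * 'rV[R]_n => F z.1 z.2) ->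
  (forall x y, 0 <= F x y) ->
  \int[mu]_t sphint (F t) = sphint (fun y => \int[mu]_t F t y).
Proof.
move=> mF F0.
under eq_integral do rewrite (sphintE (measurable_section _ mF))//.
have mF' := measurable_uncurry_swap mF.
rewrite sphintE; last 2 first.
- exact: (@measurable_integral_leb _ _ _ (fun y t => F t y)).
- by move=> y; exact: integral_ge0.
by rewrite (@tonelli_leb _ _ _ (fun y t => F t y)).
Qed.

Lemma sphint_sphint_swap n m (F : 'rV[R]_m -> 'rV[R]_n -> \bar R) :
  mfT (fun z : 'rV[R]_m * 'rV[R]_n => F z.1 z.2) ->
  (forall x y, 0 <= F x y) ->
  sphint (fun x => sphint (F x)) = sphint (fun y => sphint (fun x => F x y)).
Proof.
move=> mF F0; have mF' := measurable_uncurry_swap mF.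
rewrite !sphintE.
- under eq_integral do rewrite (sphintE (measurable_section _ mF))//.
  under [RHS]eq_integral do rewrite (sphintE (measurable_section2 _ mF))//.
  exact: tonelli.
- exact: (@measurable_sphint _ _ _ (fun y x => F x y)).
- by move=> y; apply: sphint_ge0.
- exact: measurable_sphint.
- by move=> y; apply: sphint_ge0.
Qed.

Lemma vextZ n (r t : R) (y : 'rV[R]_n) : r *: vext t y = vext (r * t) (r *: y).
Proof.
apply/rowP => i; have [j ->|->] := unliftP ord0 i.
  by rewrite [in LHS]mxE !vextS !mxE.
by rewrite [in LHS]mxE !vext0.
Qed.

Lemma lebint_scale n (r : R) (f : 'rV[R]_n -> \bar R) : (0 < r)%R ->
  mfT f -> (forall x, 0 <= f x) ->
  lebint (fun y => f (r *: y)) = (r^-1 ^+ n)%:E * lebint f.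
Proof.
move=> r0; elim: n f => [|n IH] f mf f0.
  by rewrite expr0 mul1e /=; congr f; exact: thinmx0.
rewrite !lebintS.
have mft t : mfT (fun y => f (vext t y)).
  by apply: measurableT_comp => //; exact: measurable_vext.
have mlf : mfT (fun t => lebint (fun y => f (vext t y))).
  apply: measurable_lebint => //.
  by apply: measurableT_comp => //; exact: measurable_vext.
have lf0 t : 0 <= lebint (fun y => f (vext t y)) by exact: lebint_ge0.
have rn0 : (0 <= r^-1 ^+ n)%R by rewrite exprn_ge0// invr_ge0 ltW.
transitivity (\int[mu]_t ((r^-1 ^+ n)%:E * lebint (fun y => f (vext (r * t)%R y)))).
  apply: eq_integral => t _; rewrite -IH//; apply: eq_lebint => y; congr f.
  by rewrite vextZ.
rewrite (@integral_leb_scale _ r (fun t => (r^-1 ^+ n)%:E * lebint (fun y => f (vext t y)))).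
- by rewrite ge0_integralZl_EFin// muleA -EFinM gtr0_norm// exprS.
- by rewrite gt_eqF.
- exact: measurable_funeM.
- by move=> t; rewrite mule_ge0.
Qed.

Lemma lebintD n (f g : 'rV[R]_n -> \bar R) :
  mfT f -> (forall x, 0 <= f x) ->
  mfT g -> (forall x, 0 <= g x) ->
  lebint (fun y => f y + g y) = lebint f + lebint g.
Proof.
move=> mf f0 mg g0; rewrite !lebintE//; first by rewrite ge0_integralD.
- exact: emeasurable_funD.
- by move=> y; rewrite adde_ge0.
Qed.

(** The origin lies in the hyperplane of vanishing first coordinate, which is a single point of the
    outer integral. *)
Lemma eq_lebint_off0 n (f g : 'rV[R]_n.+1 -> \bar R) :
  mfT f -> (forall x, 0 <= f x) ->
  mfT g -> (forall x, 0 <= g x) ->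
  (forall y, y != 0%R -> f y = g y) -> lebint f = lebint g.
Proof.
move=> mf f0 mg g0 fg; rewrite !lebintS.
have mE (h : 'rV[R]_n.+1 -> \bar R) : mfT h -> (forall x, 0 <= h x) ->
    mfT (fun t => lebint (fun y => h (vext t y))).
  move=> mh h0; apply: measurable_lebint => //.
  by apply: measurableT_comp => //; exact: measurable_vext.
have mD : measurable ([set: R] `\ 0%R) by exact: measurableD.
rewrite -[LHS](@integral_setD1 R _ 0%R setT mD (measurable_funTS (mE f mf f0))).
rewrite -[RHS](@integral_setD1 R _ 0%R setT mD (measurable_funTS (mE g mg g0))).
apply: eq_integral => t; rewrite inE => -[_ /eqP t0]; apply: eq_lebint => y.
by apply: fg; apply: contra t0 => /eqP/rowP/(_ ord0); rewrite vext0 mxE => ->.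
Qed.

End sphere_invariance.

(** * Polar coordinates *)

Arguments lebint : simpl never.

Section radial.
Variable R : realType.
Local Open Scope ereal_scope.
Local Notation mu := (@lebesgue_measure R).

Lemma measurable_enorm d (T : measurableType d) n (x : T -> 'rV[R]_n) :
  mfT x -> mfT (fun w => enorm (x w)).
Proof. by move=> mx; apply/measurable_sqrt/measurable_dotv. Qed.

Lemma enorm_ge0 n (x : 'rV[R]_n) : (0 <= enorm x)%R.
Proof. exact: sqrtr_ge0. Qed.

Lemma sqr_enorm n (x : 'rV[R]_n) : (enorm x ^+ 2 = dotv x x)%R.
Proof. by rewrite sqr_sqrtr// dotv_ge0. Qed.

Lemma pballbE n (x : 'rV[R]_n) : pballb x = (0 < enorm x <= 1)%R.
Proof.
rewrite /pballb -sqr_enorm exprn_even_gt0//= expr_le1 ?enorm_ge0//.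
by rewrite lt0r enorm_ge0 andbT.
Qed.

Lemma enormZ n (a : R) (x : 'rV[R]_n) : (0 <= a)%R -> (enorm (a *: x) = a * enorm x)%R.
Proof. by move=> a0; rewrite /enorm dotvZ sqrtrM ?mulr_ge0// -expr2 sqrtr_sqr ger0_norm. Qed.

Lemma unitvZ n (a : R) (x : 'rV[R]_n) : (0 < a)%R -> unitv (a *: x) = unitv x.
Proof.
move=> a0; rewrite /unitv -/(enorm _) enormZ ?ltW// scalerA invfM mulrAC.
by rewrite -/(enorm x) mulVf ?mul1r// gt_eqF.
Qed.

Lemma integral_onemXn n :
  \int[mu]_(x in `[0%R, 1%R]) ((1 - x) ^+ n)%:E = (n.+1%:R^-1)%:E :> \bar R.
Proof.
rewrite (@continuous_FTC2 _ _ (fun x => onem x ^+ n.+1 / - n.+1%:R)%R)//=.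
- rewrite onem1 expr0n/= mul0r onem0 expr1n mul1r -EFinB sub0r.
  by rewrite -invrN opprK.
- by apply: continuous_in_subspaceT => x x01; exact: continuous_onemXn.
- exact: derivable_oo_LRcontinuous_onemXnMr.
- move=> x x01; rewrite derive1Mr//; last exact: onemXn_derivable.
  by rewrite derive_onemXn mulrAC divff// mul1r.
Qed.

(** Layer cake: [1 - enorm y] is the length of the set of [r >= 0] with [enorm y <= 1 - r]. So the
    integral of [(1 - enorm y) * h] is that of the ball integrals of radius [1 - r], each of which
    is [(1 - r) ^+ n.+1] times [B]; this gives [B / n.+2], and finiteness allows subtracting it from
    [B]. *)
Lemma radial_moment_fin n (h : 'rV[R]_n.+1 -> \bar R) :
  mfT h -> (forall x, 0 <= h x) ->
  lebint (fun y => if pballb y then h (unitv y) else 0) < +oo ->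
  lebint (fun y => if pballb y then (enorm y)%:E * h (unitv y) else 0) =
  (n.+1%:R / n.+2%:R)%:E * lebint (fun y => if pballb y then h (unitv y) else 0).
Proof.
move=> mh h0; set B := lebint (fun y => if pballb y then h (unitv y) else 0) => Boo.
have mhu : mfT (fun y => h (unitv y)).
  by apply: measurableT_comp => //; exact: measurable_unitv.
have me : mfT (@enorm R n.+1) by exact: measurable_enorm.
pose K (r : R) (y : 'rV[R]_n.+1) : \bar R :=
  if (0 < enorm y <= 1 - r)%R && (0 <= r)%R then h (unitv y) else 0.
have mK : mfT (fun z : R * 'rV[R]_n.+1 => K z.1 z.2).
  apply: measurable_fun_ifT => //.
    apply: measurable_and; last exact: measurable_fun_ler.
    apply: measurable_and.
      by apply: measurable_fun_ltr => //; exact: measurable_enorm.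
    by apply: measurable_fun_ler; [exact: measurable_enorm|exact: measurable_funB].
  exact: (measurableT_comp mhu (@measurable_snd _ _ R 'rV[R]_n.+1)).
have K0 r y : 0 <= K r y by rewrite /K; case: ifP.
have BE : B = lebint (fun y => if pballb y then (enorm y)%:E * h (unitv y) else 0) +
    lebint (fun y => \int[mu]_r K r y).
  rewrite -lebintD.
  - apply: eq_lebint => y.
    have -> : \int[mu]_r K r y = if pballb y then (1 - enorm y)%:E * h (unitv y) else 0.
      rewrite pballbE; have [/andP[y0 y1]|ny] := ifPn.
        transitivity (\int[mu]_(r in `[0%R, (1 - enorm y)%R]) h (unitv y)).
          rewrite [RHS]integral_mkcond; apply: eq_integral => r _.
          rewrite patchE /K y0/= mem_setE/= in_itv/= andbC.
          by rewrite (_ : (enorm y <= 1 - r)%R = (r <= 1 - enorm y)%R)// lerBrDr addrC -lerBrDr.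
        rewrite integral_cst//= muleC; congr (_ * _).
        rewrite lebesgue_measure_itv/= lte_fin.
        by case: ifPn => [_|]; [rewrite oppr0 adde0|rewrite -leNgt => w1; congr EFin; move: y1 w1; clear; lra].
      apply: integral0_eq => r _; rewrite /K; case: ifPn => // /andP[/andP[y0 y1] r0].
      by move: ny; rewrite y0/= -ltNge => w; exfalso; move: w y1 r0; clear; lra.
    rewrite pballbE; case: ifPn => [/andP[y0 y1]|_]; last by rewrite adde0.
    rewrite -ge0_muleDl ?lee_fin ?enorm_ge0 ?subr_ge0// -EFinD addrC subrK.
    by rewrite mul1e.
  - apply: measurable_fun_ifT => //; first exact: measurable_pballb.
    by apply: emeasurable_funM => //; exact/measurable_EFinP.
  - by move=> y; case: ifP => // _; rewrite mule_ge0// lee_fin enorm_ge0.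
  - exact: (@measurable_integral_leb _ _ _ (fun y r => K r y) (measurable_uncurry_swap mK)).
  - by move=> y; exact: integral_ge0.
have KE : lebint (fun y => \int[mu]_r K r y) = (n.+2%:R^-1)%:E * B.
  rewrite -lebint_leb_swap// -integral_onemXn muleC.
  rewrite -ge0_integralZl//=; last first.
  - by rewrite /B lebint_ge0// => y; case: ifP.
  - by move=> x; rewrite in_itv/= => /andP[x0 x1]; rewrite lee_fin exprn_ge0// subr_ge0.
  - apply/measurable_EFinP; apply: measurable_funX; exact: measurable_funB.
  rewrite [RHS]integral_mkcond; apply: eq_integral => r _.
  rewrite patchE mem_setE/= in_itv/=.
  have [/andP[r0 r1]|nr] := ifPn; last first.
    rewrite (_ : point = 0 :> \bar R)//  lebintE//; last exact: measurable_section mK.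
    apply: integral0_eq => y _; rewrite /K; case: ifPn => // /andP[/andP[y0 y1] r0].
    by move: nr; rewrite r0/= -ltNge => w; exfalso; move: w y0 y1; clear; lra.
  (* At [r = 1] the ball is empty and the rescaling by [(1 - r)^-1] below would make no sense. *)
  move: r1; rewrite le_eqVlt => /predU1P[->|r1].
    rewrite /onem subrr expr0n/= mule0 lebintE//; last exact: measurable_section mK.
    apply: integral0_eq => y _; rewrite /K; case: ifPn => // /andP[/andP[y0 y1] _].
    by exfalso; move: y0 y1; clear; lra.
  have r1' : (0 < 1 - r)%R by rewrite subr_gt0.
  have i0 : (0 < (1 - r)^-1)%R by rewrite invr_gt0.
  transitivity (lebint (fun y : 'rV[R]_n.+1 =>
    (fun y => if pballb y then h (unitv y) else 0) ((1 - r)^-1 *: y)%R)).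
    apply: eq_lebint => y; rewrite /K pballbE (enormZ _ (ltW i0)) r0 andbT.
    rewrite unitvZ ?invr_gt0//; congr (if _ then _ else _).
    by rewrite pmulr_rgt0 ?invr_gt0// mulrC ler_pdivrMr// mul1r.
  rewrite (@lebint_scale _ _ _ (fun y => if pballb y then h (unitv y) else 0) i0).
  - by rewrite invrK muleC.
  - by apply: measurable_fun_ifT => //; exact: measurable_pballb.
  - by move=> y; case: ifP.
have Bf : B \is a fin_num by rewrite ge0_fin_numE// /B lebint_ge0// => y; case: ifP.
move: BE; rewrite KE; set M := lebint _ => BE.
have /eqP : B - (n.+2%:R^-1)%:E * B = M by rewrite [in X in X - _]BE addeK// fin_numM.
rewrite -(fineK Bf) -!EFinM -EFinB => /eqP <-; congr EFin.
have n2 : (n.+2%:R != 0 :> R)%R by rewrite pnatr_eq0.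
have -> : (n.+1%:R = n.+2%:R - 1 :> R)%R by rewrite -[n.+2%:R]natr1 addrK.
by rewrite mulrBl divff// mul1r mulrBl mul1r.
Qed.

End radial.

(** * Slicing the sphere by cones *)

Section cone.
Variable R : realType.
Local Open Scope ereal_scope.
Local Notation mu := (@lebesgue_measure R).

Lemma cvg_mine_natr (a : \bar R) : 0 <= a -> mine a (k%:R)%:E @[k --> \oo] --> a.
Proof.
case: a => [r r0|_|//].
- apply: cvg_near_cst; near=> k; rewrite /mine; case: ifPn => //.
  rewrite -leNgt lee_fin => kr.
  have : (r < k%:R)%R by near: k; exact: nbhs_infty_gtr.
  by rewrite ltNge kr.
- under eq_fun do rewrite /mine ltNge leey/=.
  by apply/cvgeryP; exact: cvgr_idn.
Unshelve. all: by end_near. Qed.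

Lemma lebint_mct n (f : nat -> 'rV[R]_n -> \bar R) (g : 'rV[R]_n -> \bar R) :
  (forall k, mfT (f k)) -> (forall k y, 0 <= f k y) ->
  (forall y, {homo f^~ y : k l / (k <= l)%N >-> k <= l}) ->
  (forall y, f k y @[k --> \oo] --> g y) ->
  lebint (f k) @[k --> \oo] --> lebint g.
Proof.
move=> mf f0 fnd fg.
have gE y : g y = limn (f^~ y) by apply/esym/cvg_lim => //; exact: fg.
have mg : mfT g.
  by apply: (emeasurable_fun_cvg f) => // y _; exact: fg.
have g0 y : 0 <= g y.
  by rewrite gE; apply: lime_ge; [apply/cvg_ex; exists (g y); exact: fg|exact: nearW].
under eq_fun do rewrite lebintE//.
rewrite lebintE// (_ : g = fun y => limn (f^~ y)); last exact/funext.
by apply: cvg_monotone_convergence => // y _ k l; exact: fnd.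
Qed.

(** Truncating [h] at [k] makes the ball integral finite; monotone convergence removes the
    truncation. *)
Lemma radial_moment n (h : 'rV[R]_n.+1 -> \bar R) :
  mfT h -> (forall x, 0 <= h x) ->
  lebint (fun y => if pballb y then (enorm y)%:E * h (unitv y) else 0) =
  (n.+1%:R / n.+2%:R)%:E * lebint (fun y => if pballb y then h (unitv y) else 0).
Proof.
move=> mh h0.
pose hk k x := mine (h x) (k%:R)%:E.
have mhk k : mfT (hk k) by exact: measurable_mine.
have hk0 k x : 0 <= hk k x by rewrite /hk /mine; case: ifP => // _; rewrite lee_fin.
have hknd x : {homo hk^~ x : k l / (k <= l)%N >-> k <= l}.
  by move=> k l kl; rewrite /hk le_min !ge_min lexx/= lee_fin ler_nat kl orbT.
have mu1 : mfT (@unitv R n.+1) by exact: measurable_unitv.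
have me : mfT (fun y : 'rV[R]_n.+1 => (enorm y)%:E).
  by apply/measurable_EFinP; exact: measurable_enorm.
have L1 := @lebint_mct n.+1
  (fun k y => if pballb y then (enorm y)%:E * hk k (unitv y) else 0)
  (fun y => if pballb y then (enorm y)%:E * h (unitv y) else 0).
have L2 := @lebint_mct n.+1
  (fun k y => if pballb y then hk k (unitv y) else 0)
  (fun y => if pballb y then h (unitv y) else 0).
have c1 : lebint (fun y => if pballb y then (enorm y)%:E * hk k (unitv y) else 0) @[k --> \oo]
    --> lebint (fun y => if pballb y then (enorm y)%:E * h (unitv y) else 0).
  apply: L1.
  - move=> k; apply: measurable_fun_ifT => //; first exact: measurable_pballb.
    by apply: emeasurable_funM => //; exact: measurableT_comp.
  - by move=> k y; case: ifP => // _; rewrite mule_ge0// lee_fin enorm_ge0.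
  - by move=> y k l kl; case: ifP => // _; rewrite lee_wpmul2l ?lee_fin ?enorm_ge0// hknd.
  - move=> y; case: ifP => _; last exact: cvg_cst.
    by apply: cvgeZl => //; exact: cvg_mine_natr.
have c2 : lebint (fun y => if pballb y then hk k (unitv y) else 0) @[k --> \oo]
    --> lebint (fun y => if pballb y then h (unitv y) else 0).
  apply: L2.
  - move=> k; apply: measurable_fun_ifT => //; first exact: measurable_pballb.
    exact: measurableT_comp.
  - by move=> k y; case: ifP.
  - by move=> y k l kl; case: ifP => // _; rewrite hknd.
  - by move=> y; case: ifP => _; [exact: cvg_mine_natr|exact: cvg_cst].
have c3 : (n.+1%:R / n.+2%:R)%:E * lebint (fun y => if pballb y then hk k (unitv y) else 0)
    @[k --> \oo] --> (n.+1%:R / n.+2%:R)%:E *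
       lebint (fun y => if pballb y then h (unitv y) else 0).
  exact: cvgeZl.
rewrite -(cvg_lim (@ereal_hausdorff R) c1) -(cvg_lim (@ereal_hausdorff R) c3).
congr (limn _); apply/funext => k.
rewrite radial_moment_fin//.
have fin1 : lebint (fun y : 'rV[R]_n.+1 => k%:R%:E * (\1_(@pball R n.+1) y)%:E) < +oo.
  rewrite lebintZl ?lte_mul_pinfty//.
  - exact: lebint_ball_fin.
  - by apply/measurable_EFinP; apply: measurable_indic; exact: measurable_pball.
apply: le_lt_trans fin1; apply: le_lebint.
- apply: measurable_fun_ifT => //; first exact: measurable_pballb.
  exact: measurableT_comp.
- apply: measurable_funeM; apply/measurable_EFinP; apply: measurable_indic; exact: measurable_pball.
- by move=> y; case: ifP.
- move=> y; case: ifPn => yb; last by rewrite mule_ge0 ?lee_fin.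
  by rewrite indicE mem_set//= mule1 /hk ge_min lexx orbT.
Qed.

(** The norm of [vext s v] for a unit vector [v]; with [s = tan t] its inverse is [cos t]. *)
Definition kappa (s : R) : R := Num.sqrt (1 + s ^+ 2).

Lemma kappa_gt0 s : (0 < kappa s)%R.
Proof. by rewrite sqrtr_gt0 ltr_wpDr ?sqr_ge0. Qed.

Lemma kappa2 s : (kappa s ^+ 2 = 1 + s ^+ 2)%R.
Proof. by rewrite sqr_sqrtr// addr_ge0 ?sqr_ge0. Qed.

Lemma measurable_kappa : mfT kappa.
Proof. by apply: measurable_sqrt; apply: measurable_funD => //; exact: measurable_funX. Qed.

Lemma enorm_gt0 n (y : 'rV[R]_n) : y != 0%R -> (0 < enorm y)%R.
Proof.
move=> y0; rewrite lt0r enorm_ge0 andbT -sqrf_eq0 sqr_enorm; apply: contra y0.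
rewrite psumr_eq0; last by move=> i _; exact: sqr_ge0.
move=> /allP h; apply/eqP/rowP => i; rewrite mxE; apply/eqP.
by have := h i (mem_index_enum _); rewrite mulf_eq0 orbb.
Qed.

Lemma enorm_vext n (s : R) (y : 'rV[R]_n) :
  enorm (vext (enorm y * s) y) = (kappa s * enorm y)%R.
Proof.
rewrite {1}/enorm dotv_vext -sqr_enorm.
rewrite (_ : _ + _ = (kappa s * enorm y) ^+ 2)%R; last first.
  by rewrite exprMn kappa2; ring.
by rewrite sqrtr_sqr ger0_norm// mulr_ge0 ?enorm_ge0// ltW// kappa_gt0.
Qed.

Lemma unitv_vext n (s : R) (y : 'rV[R]_n) : y != 0%R ->
  unitv (vext (enorm y * s) y) = (kappa s)^-1 *: vext s (unitv y).
Proof.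
move=> y0; have e0 := enorm_gt0 y0.
rewrite /unitv -/(enorm _) enorm_vext -/(enorm y) invfM -scalerA; congr (_ *: _).
by rewrite vextZ mulrA mulVf ?mul1r// gt_eqF.
Qed.

(* Writing the first coordinate as [enorm y * s] slices the ball into cones of
   constant s; the Jacobian [enorm y] is absorbed by [radial_moment]. *)
Lemma sphint_cone n (f : 'rV[R]_n.+2 -> \bar R) :
  mfT f -> (forall x, 0 <= f x) ->
  sphint f = \int[mu]_s (((kappa s)^-1 ^+ n.+2)%:E *
     sphint (fun v : 'rV[R]_n.+1 => f ((kappa s)^-1 *: vext s v))).
Proof.
move=> mf f0.
pose g (y : 'rV[R]_n.+2) := if pballb y then f (unitv y) else 0.
have mg : mfT g by exact: measurable_sphint_integrand.
have g0 y : 0 <= g y by rewrite /g; case: ifP.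
pose F s (v : 'rV[R]_n.+1) := f ((kappa s)^-1 *: vext s v).
have mF : mfT (fun z : R * 'rV[R]_n.+1 => F z.1 z.2).
  apply: measurableT_comp => //; apply: measurable_rVZ; last exact: measurable_vext.
  by apply: measurable_inv; apply: (measurableT_comp measurable_kappa).
have F0 s v : 0 <= F s v by rewrite /F.
have mFs s : mfT (F s) by exact: measurable_section mF.
pose Psi s (z : 'rV[R]_n.+1) := if pballb z then (enorm z)%:E * F s (unitv z) else 0.
have mgv : mfT (fun z : R * 'rV[R]_n.+1 => g (vext z.1 z.2)).
  by apply: (measurableT_comp mg); exact: measurable_vext.
have mG : mfT (fun z : R * 'rV[R]_n.+1 =>
    (enorm z.2)%:E * g (vext (enorm z.2 * z.1) z.2)).
  apply: emeasurable_funM.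
    by apply/measurable_EFinP; apply: measurable_enorm.
  apply: (measurableT_comp mg); apply: measurable_vext => //.
  by apply: measurable_funM => //; exact: measurable_enorm.
have G0 (s : R) (y : 'rV[R]_n.+1) : 0 <= (enorm y)%:E * g (vext (enorm y * s) y).
  by rewrite mule_ge0// lee_fin enorm_ge0.
rewrite {1}/sphint -/g lebintS.
rewrite (@lebint_leb_swap _ _ (fun t y => g (vext t y)))//.
(* The substitution [t = enorm y * s] is impossible at [y = 0], a point that does not affect the
   integral. *)
rewrite (@eq_lebint_off0 _ _ _ (fun y => \int[mu]_s ((enorm y)%:E * g (vext (enorm y * s) y)))); first last.
- move=> y y0; have e0 := enorm_gt0 y0.
  have mgy : mfT (fun t => g (vext t y)).
    exact: (measurable_section2 (f := fun t y => g (vext t y)) y mgv).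
  rewrite ge0_integralZl_EFin ?ltW//; last first.
    apply: (measurableT_comp mgy); exact: measurable_funM.
  rewrite (@integral_leb_scale _ _ (fun t => g (vext t y))) ?gt_eqF//.
  by rewrite muleA -EFinM gtr0_norm// mulfV ?gt_eqF// mul1e.
- by move=> y; apply: integral_ge0 => s _; first [exact: G0|exact: g0].
- exact: (@measurable_integral_leb _ _ _
    (fun y s => (enorm y)%:E * g (vext (enorm y * s) y)) (measurable_uncurry_swap (f := fun s y => (enorm y)%:E * g (vext (enorm y * s) y)) mG)).
- by move=> y; apply: integral_ge0 => s _; first [exact: G0|exact: g0].
- exact: (@measurable_integral_leb _ _ _ (fun y s => g (vext s y)) (measurable_uncurry_swap (f := fun s y => g (vext s y)) mgv)).
rewrite -(@lebint_leb_swap _ _ (fun s y => (enorm y)%:E * g (vext (enorm y * s) y)))//.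
have mSF : mfT (fun s => sphint (F s)) by exact: measurable_sphint.
rewrite -ge0_integralZl_EFin//; first last.
- exact: (@measurable_lebint _ _ _ _ (fun s y => (enorm y)%:E * g (vext (enorm y * s) y)) mG).
- by move=> s _; exact: lebint_ge0.
apply: eq_integral => s _.
have k0 := kappa_gt0 s.
have mPsi : mfT (Psi s).
  apply: measurable_fun_ifT => //; first exact: measurable_pballb.
  apply: emeasurable_funM; first by apply/measurable_EFinP; exact: measurable_enorm.
  by apply: measurableT_comp => //; exact: measurable_unitv.
have Psi0 y : 0 <= Psi s y.
  by rewrite /Psi; case: ifP => // _; rewrite mule_ge0// lee_fin enorm_ge0.
(* By [enorm_vext], the point lies in the unit ball exactly when [kappa s *: y] does, so the slice
   is a rescaled ball. The factor [(kappa s)^-1] compensates for rescaling the Jacobian [enorm y] as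
   well. *)
transitivity ((n.+2)%:R%:E * lebint (fun y => ((kappa s)^-1)%:E * Psi s (kappa s *: y))).
  congr (_ * _); apply: eq_lebint => y; rewrite /Psi /g !pballbE enorm_vext (enormZ _ (ltW k0)).
  case: ifPn => [/andP[ky _]|_]; last by rewrite !mule0.
  have y0 : y != 0%R by apply: contraTneq ky => ->; rewrite /enorm /dotv big1 ?sqrtr0 ?mulr0 ?ltxx// => i _; rewrite mxE mul0r.
  rewrite unitv_vext// unitvZ// muleA -EFinM mulrA mulVf ?gt_eqF// mul1r.
  by [].
rewrite (@lebintZl _ _ _ (fun y => Psi s (kappa s *: y)%R)) ?invr_ge0 ?ltW//; last first.
  by apply: (measurableT_comp mPsi); apply: measurable_rVZ.
rewrite lebint_scale// /Psi radial_moment// /sphint -/(F s).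
(* The factor [n.+2] of the cone formula cancels the denominator of the radial moment and leaves
   [n.+1], the factor of the sphere one dimension below. *)
set B := lebint _; rewrite !muleA -!EFinM; congr (_%:E * _).
rewrite [in RHS]exprS; field.
by rewrite gt_eqF//= pnatr_eq0.
Qed.

End cone.

(** * From cones to angles *)

Section polar.
Variable R : realType.
Local Open Scope ereal_scope.
Local Notation mu := (@lebesgue_measure R).

(** The measure with density [w] is the projection of planar Lebesgue measure restricted to the
    region under the graph of [w]. *)
Lemma density_measure (w : R -> R) : mfT w -> (forall s, 0 <= w s)%R ->
  exists m : {measure set (measurableTypeR R) -> \bar R},
  forall f : R -> \bar R, mfT f -> (forall s, 0 <= f s) ->
  \int[m]_s f s = \int[mu]_s ((w s)%:E * f s).
Proof.
move=> mw w0.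
pose M : {measure set (measurableTypeR R * measurableTypeR R)%type -> \bar R} := (mu \x mu).
pose D : set (measurableTypeR R * measurableTypeR R)%type := [set z | (0 <= z.2 <= w z.1)%R].
have mD : measurable D.
  have mb : @measurable_fun _ _ (measurableTypeR R * measurableTypeR R)%type _ setT
      (fun z => 0 <= z.2 <= w z.1)%R.
    apply: measurable_and; first by apply: measurable_fun_ler => //; exact: measurable_snd.
    apply: measurable_fun_ler; first exact: measurable_snd.
    by apply: measurableT_comp => //; exact: measurable_fst.
  by have := mb measurableT [set true]; rewrite setTI; exact.
have mfst : mfT (@fst (measurableTypeR R) (measurableTypeR R)).
  exact: measurable_fst.
exists (@measure_function_pushforward__canonical__measure_function_Measure
  _ _ _ _ R (mrestr M mD) _ mfst) => f mf f0.
rewrite (ge0_integral_pushforward mfst)//= preimage_setT.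
have mff : @measurable_fun _ _ (measurableTypeR R * measurableTypeR R)%type _ setT (f \o fst).
  exact: (measurableT_comp (g := fst) mf mfst).
transitivity (\int[M]_(x in D) (f \o fst) x); first by apply: integral_mrestr => // z; exact: f0.
rewrite integral_mkcond.
rewrite fubini_tonelli1/=; last 2 first.
- exact/(measurable_restrictT _ _).1/measurable_funTS.
- by move=> z; apply: erestrict_ge0 => x _; exact: f0.
apply: eq_integral => s _; rewrite /fubini_F/=.
transitivity (\int[mu]_(u in `[0%R, w s]) f s).
  rewrite [RHS]integral_mkcond; apply: eq_integral => u _.
  by rewrite !patchE !mem_setE /= in_itv.
rewrite integral_cst//= muleC lebesgue_measure_itv/= lte_fin.
by case: ltP => [_|ws]; rewrite ?oppr0 ?adde0//; congr (_%:E * _); apply/eqP; rewrite eq_le ws w0.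
Qed.

Lemma measurable_sin d (T : measurableType d) (f : T -> R) :
  mfT f -> mfT (fun x => sin (f x)).
Proof.
by move=> mf; apply: (measurableT_comp (continuous_measurable_fun (@continuous_sin R))).
Qed.

Lemma measurable_cos d (T : measurableType d) (f : T -> R) :
  mfT f -> mfT (fun x => cos (f x)).
Proof.
by move=> mf; apply: (measurableT_comp (continuous_measurable_fun (@continuous_cos R))).
Qed.

Lemma measurable_tan : mfT (@tan R).
Proof.
apply: measurable_funM; first exact: measurable_sin.
by apply: measurable_inv; exact: measurable_cos.
Qed.

Lemma integral_cauchy (a b : R) : (a < b)%R ->
  \int[mu]_(s in `]a, b]) ((1 + s ^+ 2)^-1)%:E = (atan b - atan a)%:E.
Proof.
move=> ab.
have cw : continuous (fun s : R => (1 + s ^+ 2)^-1)%R.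
  move=> s; apply: (@continuousV _ _ (fun s : R => 1 + s ^+ 2)%R).
    by rewrite gt_eqF// ltr_wpDr ?sqr_ge0.
  by apply: continuousD; [exact: cst_continuous|exact: exprn_continuous].
rewrite integral_itv_obnd_cbnd; last first.
  by apply/measurable_funTS/measurable_EFinP; exact: continuous_measurable_fun.
rewrite (@continuous_FTC2 _ _ (@atan R))//.
- exact: continuous_subspaceT.
- split.
  + by move=> x _; exact: derivable_atan.
  + by apply/cvg_at_right_filter; exact: continuous_atan.
  + by apply/cvg_at_left_filter; exact: continuous_atan.
- by move=> x _; rewrite derive1_atan.
Qed.

(** An equality of measures: [(1 + s ^+ 2)^-1 ds] and the image under [tan] of Lebesgue measure on
    [](- (pi / 2)), pi / 2[] both give []a, b]] the mass [atan b - atan a]. *)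
Lemma integral_tan (f : R -> \bar R) : mfT f -> (forall s, 0 <= f s) ->
  \int[mu]_s (((1 + s ^+ 2)^-1)%:E * f s) =
  \int[mu]_(t in `](- (pi / 2))%R, (pi / 2)%R[) f (tan t).
Proof.
move=> mf f0.
have mw : mfT (fun s : R => (1 + s ^+ 2)^-1)%R.
  by apply: measurable_inv; apply: measurable_funD => //; exact: measurable_funX.
have w0 (s : R) : (0 <= (1 + s ^+ 2)^-1)%R by rewrite invr_ge0 addr_ge0 ?sqr_ge0.
have [m1 m1E] := density_measure mw w0.
pose D : set (measurableTypeR R) := `](- (pi / 2))%R, (pi / 2)%R[%classic.
have mD : measurable D by exact: measurable_itv.
have mt : @measurable_fun _ _ (measurableTypeR R) (measurableTypeR R) setT (@tan R).
  exact: measurable_tan.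
pose m2 := @measure_function_pushforward__canonical__measure_function_Measure
  _ _ _ _ R (mrestr mu mD) _ mt.
have m1itv (a b : R) : (a < b)%R -> m1 `]a, b]%classic = (atan b - atan a)%:E.
  move=> ab; rewrite -integral_cauchy//.
  have mI : measurable (`]a, b]%classic : set (measurableTypeR R)) by exact: measurable_itv.
  have := m1E (fun x => (\1_(`]a, b]%classic) x)%:E).
  rewrite integral_indic// setIT => ->//; last first.
    by apply/measurable_EFinP; exact: measurable_indic.
  rewrite [RHS]integral_mkcond; apply: eq_integral => s _.
  by rewrite patchE indicE; case: ifP => _; rewrite ?mule1 ?mule0.
rewrite -m1E// (_ : \int[m1]_s f s = \int[m2]_s f s).
  by rewrite (ge0_integral_pushforward mt)//= preimage_setT integral_mrestr//; exact: measurableT_comp.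
apply: eq_measure_integral => A mA _.
apply: (@measure_unique _ R (measurableTypeR R) (@ocitv R) (fun k : nat => `](- k%:R)%R, k%:R]%classic) _ _ _ _ m1 m2) => //.
- exact: ocitvI.
- by move=> k; exact: is_ocitv.
- apply/seteqP; split => // x _ /=.
  have [k kx] : exists k : nat, (`|x| < k%:R)%R.
    by exists (Num.truncn `|x|).+1; exact: truncnS_gt.
  exists k => //=; rewrite in_itv/=; move: kx; rewrite ltr_norml => /andP[-> /ltW].
  exact.
- move=> X /ocitvP[->|[[a b]/= ab ->]]; first by rewrite !measure0.
  rewrite m1itv// -[RHS]/(mu ((@tan R @^-1` `]a, b]%classic) `&` D)).
  rewrite (_ : _ `&` _ = `]atan a, atan b]%classic).
    by rewrite lebesgue_measure_itv/= lte_fin lt_atan.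
  apply/seteqP; split => t; rewrite /D /=.
    rewrite !in_itv/= => -[/andP[ua ub] tI].
    have tK : atan (tan t) = t by rewrite tanK// in_itv.
    by rewrite -tK lt_atan//= le_atan.
  rewrite !in_itv/= => /andP[ua ub].
  have tI : (- (pi / 2) < t < pi / 2)%R.
    by rewrite (lt_trans (atan_gtNpi2 a))// (le_lt_trans ub)// atan_ltpi2.
  split => //.
  have tK : atan (tan t) = t by rewrite tanK// in_itv.
  have aI : atan a \in `](- (pi / 2))%R, (pi / 2)%R[%R by rewrite in_itv/= atan_gtNpi2 atan_ltpi2.
  have bI : atan b \in `](- (pi / 2))%R, (pi / 2)%R[%R by rewrite in_itv/= atan_gtNpi2 atan_ltpi2.
  have tI' : t \in `](- (pi / 2))%R, (pi / 2)%R[%R by rewrite in_itv.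
  rewrite -{1}[a]atanK ltr_tan// ua/= leNgt -[b]atanK ltr_tan// -leNgt.
  by [].
- move=> k; have [->|k0] := posnP k.
    by rewrite oppr0 set_itvoc0 measure0.
  by rewrite m1itv ?ltry// (@lt_trans _ _ 0%R)// ?oppr_lt0 ltr0n.
Qed.

(** With [s = tan t], two of the factors [(kappa s)^-1] are absorbed by the substitution and the
    other [n] become [cos t ^+ n]. Replacing [t] by [pi / 2 - t] then measures the angle from the
    pole. *)
Lemma sphint_polar n (f : 'rV[R]_n.+2 -> \bar R) :
  mfT f -> (forall x, 0 <= f x) ->
  sphint f = \int[mu]_(t in `]0%R, pi[) ((sin t ^+ n)%:E *
     sphint (fun v : 'rV[R]_n.+1 => f (vext (cos t) (sin t *: v)))).
Proof.
move=> mf f0; rewrite (sphint_cone mf f0).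
pose G (s : R) := (((kappa s)^-1 ^+ n)%:E *
  sphint (fun v : 'rV[R]_n.+1 => f ((kappa s)^-1 *: vext s v))).
have G0 s : 0 <= G s.
  by rewrite mule_ge0 ?sphint_ge0// lee_fin exprn_ge0// invr_ge0 ltW// kappa_gt0.
have mk : mfT (fun s : R => (kappa s)^-1)%R.
  by apply: measurable_inv; exact: measurable_kappa.
have mG : mfT G.
  apply: emeasurable_funM; first by apply/measurable_EFinP; exact: measurable_funX.
  apply: (@measurable_sphint _ _ _ _ (fun s v => f ((kappa s)^-1 *: vext s v))) => //.
  apply: measurableT_comp => //; apply: measurable_rVZ; last exact: measurable_vext.
  exact: (measurableT_comp mk).
transitivity (\int[mu]_s (((1 + s ^+ 2)^-1)%:E * G s)).
  apply: eq_integral => s _; rewrite /G [RHS]muleA -EFinM; congr (_%:E * _).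
  by rewrite -kappa2 -addn2 exprD mulrC !exprVn.
rewrite (integral_tan mG G0) integral_mkcond [RHS]integral_mkcond.
set h1 := _ \_ _; set h2 := _ \_ _.
have h20 t : 0 <= h2 t.
  rewrite /h2 patchE mem_setE in_itv/=; case: ifPn => // tpi.
  by apply: mule_ge0; [rewrite lee_fin exprn_ge0 ?ltW ?sin_gt0_pi|apply: sphint_ge0].
have mh2 : mfT h2.
  apply/(measurable_restrictT _ _).1 => //; apply/measurable_funTS.
  apply: emeasurable_funM.
    by apply/measurable_EFinP; apply: measurable_funX; exact: measurable_sin.
  apply: (@measurable_sphint _ _ _ _ (fun t v => f (vext (cos t) (sin t *: v)))) => //.
  apply: measurableT_comp => //; apply: measurable_vext.
    exact: measurable_cos.
  by apply: measurable_rVZ => //; exact: measurable_sin.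
transitivity (\int[mu]_t h2 (t + pi / 2)%R); last exact: integral_leb_shift.
transitivity (\int[mu]_t h2 (- t + pi / 2)%R); last first.
  apply: (@integral_lebN _ (fun t => h2 (t + pi / 2)%R)) => //.
  by apply: (measurableT_comp mh2); exact: measurable_funD.
apply: eq_integral => t _; rewrite /h1 /h2 !patchE !mem_setE !in_itv/=.
have -> : (0 < - t + pi / 2 < pi)%R = (- (pi / 2) < t < pi / 2)%R.
  by apply/idP/idP => /andP[u1 u2]; apply/andP; split; move: u1 u2; clear; lra.
case: ifPn => // tI.
have ct : (0 < cos t)%R by exact: cos_gt0_pihalf.
have kt : ((kappa (tan t))^-1 = cos t)%R.
  rewrite /kappa -cos2_tan2 ?gt_eqF// sqrtrV ?sqr_ge0// sqrtr_sqr gtr0_norm//.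
  by rewrite invrK.
rewrite /G kt sinDpihalf cosDpihalf cosN sinN opprK.
congr (_ * _); congr sphint; apply/funext => v; rewrite vextZ; congr (f (vext _ _)).
by rewrite /tan mulrCA mulfV ?gt_eqF// mulr1.
Qed.

End polar.

(** * Shrinkage on a bracket and on a circle *)

Section redraw.
Variable R : realType.
Local Open Scope ereal_scope.
Local Notation mu := (@lebesgue_measure R).
Implicit Types (acc : R -> bool) (f g : R -> \bar R).

Lemma integral_itvE (a b : R) f :
  \int[mu]_(s in `[a, b]) f s = \int[mu]_s (if (a <= s <= b)%R then f s else 0).
Proof.
rewrite integral_mkcond; apply: eq_integral => s _.
by rewrite patchE mem_setE in_itv.
Qed.

Lemma integral_itv_ooE (u v : R) (h : R -> \bar R) :
  \int[mu]_(t in `]u, v[) h t = \int[mu]_t (if (u < t < v)%R then h t else 0).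
Proof.
rewrite integral_mkcond; apply: eq_integral => s _.
by rewrite patchE mem_setE in_itv.
Qed.

(** The loop of [shrink_step] after a rejection, with [k] draws left. The point deciding which end
    of the bracket moves is a parameter [z] instead of [0], since reversibility exchanges it with
    the accepted point. *)
Fixpoint redraw acc g (z : R) (k : nat) (a b : R) : \bar R :=
  if k is k'.+1 then
    ((b - a)^-1)%:E * \int[mu]_(s in `[a, b])
      (if acc s then g s else
       if (s < z)%R then redraw acc g z k' s b else redraw acc g z k' a s)
  else 0.

Lemma redrawS acc g z k a b : redraw acc g z k.+1 a b =
  ((b - a)^-1)%:E * \int[mu]_s (if (a <= s <= b)%R then
      (if acc s then g s else
       if (s < z)%R then redraw acc g z k s b else redraw acc g z k a s) else 0).
Proof. by rewrite -integral_itvE. Qed.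

Lemma integral_empty_itv (a b : R) f : (b < a)%R ->
  \int[mu]_s (if (a <= s <= b)%R then f s else 0) = 0.
Proof.
move=> ba; apply: integral0_eq => s _; case: ifP => // /andP[as_ sb].
by move: ba; rewrite ltNge (le_trans as_ sb).
Qed.

(** For [b < a] the factor is negative, but the integral is then over an empty interval. *)
Lemma mean_ge0 (a b : R) f : (forall s, 0 <= f s) ->
  0 <= ((b - a)^-1)%:E * \int[mu]_s (if (a <= s <= b)%R then f s else 0).
Proof.
move=> f0; have [ab|ba] := leP a b.
  rewrite mule_ge0 ?lee_fin ?invr_ge0 ?subr_ge0//.
  by apply: integral_ge0 => s _; case: ifP.
by rewrite integral_empty_itv ?mule0.
Qed.

Lemma redraw_ge0 acc g z k a b : (forall s, 0 <= g s) -> 0 <= redraw acc g z k a b.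
Proof.
move=> g0; elim: k a b => [//|k IH] a b; rewrite redrawS.
by apply: mean_ge0 => s; case: ifP => // _; case: ifP.
Qed.

Lemma measurable_itv_cond d (T : measurableType d) (a s b : T -> R) :
  mfT a -> mfT s -> mfT b ->
  mfT (fun w => a w <= s w <= b w)%R.
Proof. by move=> ma ms mb; apply: measurable_and; exact: measurable_fun_ler. Qed.

(** Everything depends on a parameter [w], because the induction adds the current draw to the
    parameter: the hypothesis is applied on [T * R]. *)
Lemma measurable_redraw k d (T : measurableType d) (acc : T -> R -> bool)
    (g : T -> R -> \bar R) (z a b : T -> R) :
  mfT (fun w : T * R => acc w.1 w.2) ->
  mfT (fun w : T * R => g w.1 w.2) -> (forall w s, 0 <= g w s) ->
  mfT z -> mfT a -> mfT b -> mfT (fun w => redraw (acc w) (g w) (z w) k (a w) (b w)).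
Proof.
elim: k d T acc g z a b => [|k IH] d T acc g z a b macc mg g0 mz ma mb.
  exact: measurable_cst.
under eq_fun do rewrite redrawS.
have m1 : mfT (@fst T R) by exact: measurable_fst.
have m2 : mfT (@snd T R) by exact: measurable_snd.
have lift h : mfT h -> mfT (fun w : T * R => h w.1 : R).
  by move=> mh; exact: (measurableT_comp mh m1).
have m11 : mfT (fun w : (T * R) * R => (w.1.1, w.2)).
  apply: measurable_fun_pair => //; exact: (measurableT_comp m1 (@measurable_fst _ _ _ R)).
apply: emeasurable_funM.
  by apply/measurable_EFinP/measurable_inv; exact: measurable_funB.
apply: (@measurable_integral_leb _ _ _ (fun w s => if (a w <= s <= b w)%R then
  (if acc w s then g w s else if (s < z w)%R then redraw (acc w) (g w) (z w) k s (b w)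
     else redraw (acc w) (g w) (z w) k (a w) s) else 0)); last first.
  by move=> w s; case: ifP => // _; case: ifP => // _; case: ifP => // _; exact: redraw_ge0.
apply: measurable_fun_ifT => //; first by apply: measurable_itv_cond => //; exact: lift.
apply: measurable_fun_ifT => //; apply: measurable_fun_ifT.
- by apply: measurable_fun_ltr => //; exact: lift.
- apply: (IH _ _ (fun w : T * R => acc w.1) (fun w : T * R => g w.1)
     (fun w => z w.1) snd (fun w => b w.1)) => //; try exact: lift.
  + exact: (measurableT_comp macc m11).
  + exact: (measurableT_comp mg m11).
- apply: (IH _ _ (fun w : T * R => acc w.1) (fun w : T * R => g w.1)
     (fun w => z w.1) (fun w => a w.1) snd) => //; try exact: lift.
  + exact: (measurableT_comp macc m11).
  + exact: (measurableT_comp mg m11).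
Qed.

Definition redraw_body acc g z k a b s : \bar R :=
  if acc s then g s else
  if (s < z)%R then redraw acc g z k s b else redraw acc g z k a s.

Lemma redraw_body_ge0 acc g z k a b s : (forall s, 0 <= g s) ->
  0 <= redraw_body acc g z k a b s.
Proof.
by move=> g0; rewrite /redraw_body; case: ifP => // _; case: ifP => _; exact: redraw_ge0.
Qed.

Lemma measurable_redraw_body k d (T : measurableType d) (acc : T -> R -> bool)
    (g : T -> R -> \bar R) (z a b s : T -> R) :
  mfT (fun w : T * R => acc w.1 w.2) ->
  mfT (fun w : T * R => g w.1 w.2) -> (forall w s, 0 <= g w s) ->
  mfT z -> mfT a -> mfT b ->
  mfT s ->
  mfT (fun w => redraw_body (acc w) (g w) (z w) k (a w) (b w) (s w)).
Proof.
move=> macc mg g0 mz ma mb ms.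
have mp : mfT (fun w : T => (w, s w)) by exact: measurable_fun_pair.
apply: measurable_fun_ifT; [exact: (measurableT_comp macc mp)|exact: (measurableT_comp mg mp)|].
apply: measurable_fun_ifT; first exact: measurable_fun_ltr.
  exact: measurable_redraw.
exact: measurable_redraw.
Qed.

Section fixed.
Variable acc : R -> bool.
Hypothesis macc : mfT acc.

Let macc2 d (T : measurableType d) : mfT (fun w : T * R => acc w.2).
Proof. exact: (measurableT_comp macc (@measurable_snd _ _ T R)). Qed.

Let mg2 g d (T : measurableType d) : mfT g ->
  mfT (fun w : T * R => g w.2).
Proof. by move=> mg; exact: (measurableT_comp mg (@measurable_snd _ _ T R)). Qed.

Lemma measurable_body g z k a b : mfT g -> (forall s, 0 <= g s) ->
  mfT (redraw_body acc g z k a b).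
Proof.
move=> mg g0.
apply: (@measurable_redraw_body k _ _ (fun _ => acc) (fun _ => g) (fun _ => z)
  (fun _ => a) (fun _ => b) id) => //; first [exact: macc2|exact: mg2].
Qed.

Lemma measurable_body_if g (z : R) k (a b a' b' : R) : mfT g -> (forall s, 0 <= g s) ->
  mfT
    (fun s : R => if (a' <= s <= b')%R then redraw_body acc g z k a b s else 0).
Proof.
move=> mg g0; apply: measurable_fun_ifT => //; first exact: measurable_itv_cond.
exact: measurable_body.
Qed.

(** The shape [c * f + g] treats sums and nonnegative multiples in one induction; it is kept up to
    [kernelH_lin]. *)
Lemma redraw_lin (c : R) f g z k a b : (0 <= c)%R ->
  mfT f -> (forall s, 0 <= f s) ->
  mfT g -> (forall s, 0 <= g s) ->
  redraw acc (fun s => c%:E * f s + g s) z k a b =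
  c%:E * redraw acc f z k a b + redraw acc g z k a b.
Proof.
move=> c0 mf f0 mg g0; elim: k a b => [|k IH] a b; first by rewrite mule0 adde0.
rewrite !redrawS.
under eq_integral => s _.
  rewrite (_ : (if _ then _ else _) =
    c%:E * (if (a <= s <= b)%R then redraw_body acc f z k a b s else 0) +
    (if (a <= s <= b)%R then redraw_body acc g z k a b s else 0)); last first.
    rewrite /redraw_body; case: ifP => _; last by rewrite mule0 adde0.
    by case: ifP => // _; case: ifP => _; rewrite IH.
  over.
have b0 h (s : R) : (forall s, 0 <= h s) ->
    0 <= (if (a <= s <= b)%R then redraw_body acc h z k a b s else 0).
  by move=> h0; case: ifP => // _; exact: redraw_body_ge0.
rewrite ge0_integralD//.
- rewrite ge0_integralZl_EFin//; last 2 first.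
  + by move=> s _; exact: b0.
  + exact: measurable_body_if.
  have [ab|ba] := leP a b.
    rewrite ge0_muleDr ?mule_ge0// ?integral_ge0//; first by rewrite muleCA.
    + by move=> s _; exact: b0.
    + by move=> s _; exact: b0.
  by rewrite !(integral_empty_itv _ ba) !(mule0, adde0).
- by move=> s _; rewrite mule_ge0// b0.
- by apply: measurable_funeM; exact: measurable_body_if.
- by move=> s _; exact: b0.
- exact: measurable_body_if.
Qed.

Lemma le_mean (a b : R) f g : mfT f -> (forall s, 0 <= f s) ->
  mfT g -> (forall s, (a <= s <= b)%R -> f s <= g s) ->
  ((b - a)^-1)%:E * \int[mu]_s (if (a <= s <= b)%R then f s else 0) <=
  ((b - a)^-1)%:E * \int[mu]_s (if (a <= s <= b)%R then g s else 0).
Proof.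
move=> mf f0 mg fg; have [ab|ba] := leP a b.
  apply: lee_wpmul2l; first by rewrite lee_fin invr_ge0 subr_ge0.
  apply: ge0_le_integral => //.
  - by move=> s _; case: ifP.
  - by apply: measurable_fun_ifT => //; exact: measurable_itv_cond.
  - by apply: measurable_fun_ifT => //; exact: measurable_itv_cond.
  - by move=> s _; case: ifP => // /fg.
by rewrite !(integral_empty_itv _ ba).
Qed.

Lemma redraw_nd g z a b : mfT g -> (forall s, 0 <= g s) ->
  {homo (fun k => redraw acc g z k a b) : k l / (k <= l)%N >-> k <= l}.
Proof.
move=> mg g0; apply/nondecreasing_seqP => k.
elim: k a b => [|k IH] a b; first exact: redraw_ge0.
rewrite [X in X <= _]redrawS [X in _ <= X]redrawS; apply: le_mean.
- exact: measurable_body.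
- by move=> s; exact: redraw_body_ge0.
- exact: measurable_body.
- by move=> s _; case: ifP => // _; case: ifP => _; exact: IH.
Qed.

Lemma mean_le1 (a b : R) f : mfT f -> (forall s, 0 <= f s) ->
  (forall s, f s <= 1) ->
  ((b - a)^-1)%:E * \int[mu]_s (if (a <= s <= b)%R then f s else 0) <= 1.
Proof.
move=> mf f0 f1; apply: le_trans (@le_mean a b f (fun=> 1) mf f0 _ _) _ => //.
rewrite -integral_itvE integral_cst//= mul1e lebesgue_measure_itv/= lte_fin.
case: ltP => ab; last by rewrite mule0.
by rewrite -EFinD -EFinM mulVf// subr_eq0 gt_eqF.
Qed.

Lemma redraw_le1 z k a b : redraw acc (fun=> 1) z k a b <= 1.
Proof.
elim: k a b => [|k IH] a b; first exact: lee01.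
rewrite redrawS; apply: mean_le1.
- by apply: measurable_body => //; exact: lee01.
- by move=> s; apply: redraw_body_ge0 => _; exact: lee01.
- by move=> s; case: ifP => // _; case: ifP.
Qed.

End fixed.
End redraw.

(** * Acceptance probability and reversibility on a bracket *)

Section shrinkage.
Variable R : realType.
Local Open Scope ereal_scope.
Local Notation mu := (@lebesgue_measure R).
Implicit Types (acc : R -> bool) (f g : R -> \bar R).

Lemma tonelli_leb2 (f : R -> R -> \bar R) :
  mfT (fun z : R * R => f z.1 z.2) -> (forall x y, 0 <= f x y) ->
  \int[mu]_x \int[mu]_y f x y = \int[mu]_y \int[mu]_x f x y.
Proof.
by move=> mf f0; exact: (@tonelli_leb _ (measurableTypeR R) R f mf f0 mu).
Qed.

(* An interval of length [2 e] around [z] is never cut away, so that each redraw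
   from a bracket shorter than [L] is accepted with probability [2 e / L]. *)
Lemma redraw_mass acc (z e L : R) k a b : mfT acc -> (0 < e)%R ->
  (forall s, (z - e < s < z + e)%R -> acc s) ->
  (a <= z - e)%R -> (z + e <= b)%R -> (b - a <= L)%R ->
  (1 - (1 - (2 * e) / L) ^+ k)%:E <= redraw acc (fun=> 1) z k a b.
Proof.
move=> macc e0 near_z; elim: k a b => [|k IH] a b aze zeb baL; first by rewrite expr0 subrr.
have ab : (0 < b - a)%R by move: e0 aze zeb; clear; lra.
have L0 : (0 < L)%R by exact: lt_le_trans baL.
set q := ((2 * e) / L)%R.
have q0 : (0 <= q)%R by rewrite divr_ge0 ?mulr_ge0 ?ltW.
have q1 : (q <= 1)%R by rewrite ler_pdivrMr// mul1r (le_trans _ baL)//; move: aze zeb; clear; lra.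
have r01 : (0 <= (1 - q) ^+ k <= 1)%R.
  by rewrite exprn_ge0 ?subr_ge0//= exprn_ile1 ?subr_ge0// lerBlDr lerDl.
(* A lower bound for one step: acceptance is certain within [e] of [z], and elsewhere a rejection
   leaves a bracket to which the induction hypothesis applies. *)
pose h (s : R) : \bar R := (1 - (1 - q) ^+ k)%:E +
  ((1 - q) ^+ k)%:E * (\1_(`]z - e, z + e[%classic) s)%:E.
have mI : measurable (`](z - e)%R, (z + e)%R[%classic : set (measurableTypeR R)).
  exact: measurable_itv.
have mi : mfT (fun s : R => ((1 - q) ^+ k)%:E *
    (\1_(`]z - e, z + e[%classic) s)%:E).
  by apply: measurable_funeM; apply/measurable_EFinP; exact: measurable_indic.
have mh : mfT h by exact: emeasurable_funD.
have h0 s : 0 <= h s.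
  move: r01 => /andP[u1 u2]; rewrite adde_ge0 ?mule_ge0 ?lee_fin//.
  by move: u2; clear; lra.
have one0 (s : R) : (0 : \bar R) <= 1 by exact: lee01.
have m1 : mfT (fun _ : R => 1 : \bar R) by exact: measurable_cst.
rewrite redrawS; apply: (@le_trans _ _ (((b - a)^-1)%:E * \int[mu]_s
    (if (a <= s <= b)%R then h s else 0))); last first.
  apply: le_mean => //; first exact: (measurable_body macc z k a b m1 one0).
  move=> s /andP[as_ sb]; rewrite /h indicE.
  have [sI|sI] := boolP (s \in _).
    move: sI; rewrite inE/= in_itv/= => /near_z ->.
    by rewrite mule1 -EFinD subrK.
  rewrite mule0 adde0; case: ifP => [_|nacc].
    by move: r01 => /andP[u1 u2]; rewrite lee_fin lerBlDr lerDl.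
  have [sz|zs] := ltP s z.
    apply: IH => //; last by move: baL as_; clear; lra.
    rewrite leNgt; apply: contra sI => zes; rewrite inE/= in_itv/= zes/=.
    by move: sz e0; clear; lra.
  apply: IH => //; last by move: baL sb; clear; lra.
  rewrite leNgt; apply: contra sI => zes; rewrite inE/= in_itv/= zes andbT.
  by move: zs e0; clear; lra.
rewrite -integral_itvE ge0_integralD//; last 3 first.
- by move=> s _; move: r01 => /andP[_ u2]; rewrite lee_fin subr_ge0.
- by move=> s _; move: r01 => /andP[u1 _]; rewrite mule_ge0// lee_fin.
- exact: measurable_funTS.
rewrite integral_cst//= ge0_integralZl_EFin//; last 2 first.
- by apply/measurable_funTS/measurable_EFinP; exact: measurable_indic.
- by case/andP: r01.
rewrite integral_indic//= (setIidl _); last first.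
  by move=> s /=; rewrite !in_itv/= => /andP[u1 u2]; apply/andP; split;
    move: aze zeb u1 u2; clear; lra.
have ab' : (a < b)%R by rewrite -subr_gt0.
have ze : (z - e < z + e)%R by move: e0; clear; lra.
rewrite !lebesgue_measure_itv/= !lte_fin ab' ze -!EFinB -!EFinM lee_fin exprS.
have qc : (q <= 2 * e * (b - a)^-1)%R.
  by rewrite /q ler_wpM2l ?mulr_ge0 ?lef_pV2 ?posrE// ltW.
rewrite -subr_ge0.
rewrite [X in (0 <= X)%R](_ : _ = (1 - q) ^+ k * (2 * e * (b - a)^-1 - q))%R; last first.
  by field; rewrite gt_eqF.
by rewrite mulr_ge0 ?subr_ge0//; case/andP: r01.
Qed.

Section fixed.
Variable acc : R -> bool.
Hypothesis macc : mfT acc.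

Lemma redraw_shift (c : R) g z k a b : mfT g -> (forall s, 0 <= g s) ->
  redraw (fun s => acc (c + s)%R) (fun s => g (c + s)%R) z k a b =
  redraw acc g (c + z)%R k (c + a)%R (c + b)%R.
Proof.
move=> mg g0; elim: k a b => [//|k IH] a b; rewrite !redrawS.
congr (_%:E * _); first by rewrite opprD addrACA subrr add0r.
pose h (s : R) := if (c + a <= s <= c + b)%R then
  redraw_body acc g (c + z)%R k (c + a)%R (c + b)%R s else 0.
transitivity (\int[mu]_s h (s + c)%R).
  apply: eq_integral => s _; rewrite /h (addrC s) !lerD2l /redraw_body ltrD2l.
  by case: ifP => // _; case: ifP => // _; case: ifP => _; rewrite IH.
rewrite integral_leb_shift//; first exact: measurable_body_if.
by move=> s; rewrite /h; case: ifP => // _; exact: redraw_body_ge0.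
Qed.

(** Pairs [f] at an accepted starting point of the bracket with [g] at the output of the loop. Its
    symmetry in [f] and [g] is reversibility for a given bracket. *)
Definition bracket_form f g k a b : \bar R :=
  \int[mu]_z (if (a <= z <= b)%R && acc z then f z * redraw acc g z k a b else 0).

Lemma measurable_acc2 d (T : measurableType d) (h : T -> R) :
  mfT h -> mfT (fun w => acc (h w)).
Proof. by move=> mh; exact: (measurableT_comp macc). Qed.

Lemma measurable_comp2 d (T : measurableType d) g (h : T -> R) :
  mfT g -> mfT h -> mfT (fun w => g (h w)).
Proof. by move=> mg mh; exact: (measurableT_comp mg). Qed.

Lemma measurable_bracket_integrand d (T : measurableType d) f g k (z a b : T -> R) :
  mfT f -> (forall s, 0 <= f s) ->
  mfT g -> (forall s, 0 <= g s) ->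
  mfT z -> mfT a -> mfT b ->
  mfT (fun w => if (a w <= z w <= b w)%R && acc (z w)
    then f (z w) * redraw acc g (z w) k (a w) (b w) else 0).
Proof.
move=> mf f0 mg g0 mz ma mb; apply: measurable_fun_ifT => //.
  by apply: measurable_and; [exact: measurable_itv_cond|exact: measurable_acc2].
apply: emeasurable_funM; first exact: measurable_comp2.
apply: (@measurable_redraw _ k _ _ (fun _ => acc) (fun _ => g)) => //.
  by apply: measurable_acc2; exact: measurable_snd.
by apply: measurable_comp2 => //; exact: measurable_snd.
Qed.

Lemma bracket_integrand_ge0 f g k (z a b : R) :
  (forall s, 0 <= f s) -> (forall s, 0 <= g s) ->
  0 <= (if (a <= z <= b)%R && acc z then f z * redraw acc g z k a b else 0).
Proof. by move=> f0 g0; case: ifP => // _; rewrite mule_ge0// redraw_ge0. Qed.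

Definition two_points f g a b : \bar R :=
  \int[mu]_z \int[mu]_s (if [&& (a <= z <= b)%R, acc z, (a <= s <= b)%R & acc s]
    then f z * g s else 0).

Lemma two_points_sym f g a b :
  mfT f -> (forall s, 0 <= f s) ->
  mfT g -> (forall s, 0 <= g s) ->
  two_points f g a b = two_points g f a b.
Proof.
move=> mf f0 mg g0.
rewrite /two_points (@tonelli_leb2 (fun z s => if [&& (a <= z <= b)%R, acc z, (a <= s <= b)%R & acc s]
    then f z * g s else 0)).
- apply: eq_integral => s _; apply: eq_integral => z _.
  by rewrite muleC andbA [in LHS]andbC -!andbA.
- have m1 : mfT (@fst R R) by exact: measurable_fst.
  have m2 : mfT (@snd R R) by exact: measurable_snd.
  apply: measurable_fun_ifT => //.
    apply: measurable_and; first exact: measurable_itv_cond.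
    apply: measurable_and; first exact: measurable_acc2.
    by apply: measurable_and; [exact: measurable_itv_cond|exact: measurable_acc2].
  by apply: emeasurable_funM; exact: measurable_comp2.
- by move=> z s; case: ifP => // _; rewrite mule_ge0.
Qed.

(* The brackets containing the starting point are cut at the same rejected
   points when the roles of starting point and accepted point are exchanged. *)
Lemma bracket_formS f g k a b :
  mfT f -> (forall s, 0 <= f s) ->
  mfT g -> (forall s, 0 <= g s) ->
  bracket_form f g k.+1 a b = ((b - a)^-1)%:E * (two_points f g a b +
    \int[mu]_s (if (a <= s <= b)%R && ~~ acc s then
       bracket_form f g k s b + bracket_form f g k a s else 0)).
Proof.
move=> mf f0 mg g0.
have [ba|ab] := ltP b a.
  rewrite /bracket_form integral0_eq; last first.
    by move=> z _; case: ifP => // /andP[/andP[az zb]]; move: ba; rewrite ltNge (le_trans az zb).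
  rewrite /two_points integral0_eq; last first.
    move=> z _; apply: integral0_eq => s _; case: ifP => // /and4P[/andP[az zb]].
    by move: ba; rewrite ltNge (le_trans az zb).
  rewrite add0e integral0_eq ?mule0// => s _; case: ifP => // /andP[/andP[as_ sb]].
  by move: ba; rewrite ltNge (le_trans as_ sb).
have c0 : (0 <= (b - a)^-1)%R by rewrite invr_ge0 subr_ge0.
(* [A] collects the draws accepted at once, [B] the rejected ones followed by the remaining loop. *)
pose A (z s : R) : \bar R := if [&& (a <= z <= b)%R, acc z, (a <= s <= b)%R & acc s]
    then f z * g s else 0.
pose B (z s : R) : \bar R := if [&& (a <= z <= b)%R, acc z, (a <= s <= b)%R & ~~ acc s]
    then f z * (if (s < z)%R then redraw acc g z k s b else redraw acc g z k a s) else 0.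
have m1 : mfT (@fst R R) by exact: measurable_fst.
have m2 : mfT (@snd R R) by exact: measurable_snd.
have mA : mfT (fun w : R * R => A w.1 w.2).
  apply: measurable_fun_ifT => //.
    apply: measurable_and; first exact: measurable_itv_cond.
    apply: measurable_and; first exact: measurable_acc2.
    by apply: measurable_and; [exact: measurable_itv_cond|exact: measurable_acc2].
  by apply: emeasurable_funM; exact: measurable_comp2.
have A0 z s : 0 <= A z s by rewrite /A; case: ifP => // _; rewrite mule_ge0.
have mB : mfT (fun w : R * R => B w.1 w.2).
  apply: measurable_fun_ifT => //.
    apply: measurable_and; first exact: measurable_itv_cond.
    apply: measurable_and; first exact: measurable_acc2.
    apply: measurable_and; first exact: measurable_itv_cond.
    by apply: measurable_neg; exact: measurable_acc2.
  apply: emeasurable_funM; first exact: measurable_comp2.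
  apply: measurable_fun_ifT; first exact: measurable_fun_ltr.
    apply: (@measurable_redraw _ k _ _ (fun _ => acc) (fun _ => g)) => //.
      by apply: measurable_acc2; exact: measurable_snd.
    by apply: measurable_comp2 => //; exact: measurable_snd.
  apply: (@measurable_redraw _ k _ _ (fun _ => acc) (fun _ => g)) => //.
    by apply: measurable_acc2; exact: measurable_snd.
  by apply: measurable_comp2 => //; exact: measurable_snd.
have B0 z s : 0 <= B z s.
  by rewrite /B; case: ifP => // _; rewrite mule_ge0//; case: ifP => _; exact: redraw_ge0.
have msA z : mfT (A z) by exact: measurable_section mA.
have msB z : mfT (B z) by exact: measurable_section mB.
have mbody z : mfT
    (fun s => if (a <= s <= b)%R then redraw_body acc g z k a b s else 0).
  exact: measurable_body_if.
have body0 z s : 0 <= (if (a <= s <= b)%R then redraw_body acc g z k a b s else 0).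
  by case: ifP => // _; exact: redraw_body_ge0.
transitivity (((b - a)^-1)%:E * \int[mu]_z (\int[mu]_s A z s + \int[mu]_s B z s)).
  rewrite -ge0_integralZl_EFin//; last 2 first.
  - by move=> z _; rewrite adde_ge0 ?integral_ge0.
  - by apply: emeasurable_funD; exact: measurable_integral_leb.
  apply: eq_integral => z _; rewrite -ge0_integralD//; last 2 first.
  - exact: msA.
  - exact: msB.
  case: ifP => [/andP[zI accz]|nz]; last first.
    rewrite integral0_eq ?mule0// => s _; by rewrite /A /B !andbA nz/= adde0.
  rewrite redrawS muleCA; congr (_ * _).
  rewrite -ge0_integralZl//; last 2 first.
  - exact: mbody.
  - by move=> s _; exact: body0.
  apply: eq_integral => s _; rewrite /A /B zI accz/=.
  case: ifP => sI/=; last by rewrite mule0 adde0.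
  by case: ifP => saccz /=; rewrite ?adde0 ?add0e.
congr (_ * _); rewrite ge0_integralD//; last 4 first.
- by move=> z _; exact: integral_ge0.
- exact: measurable_integral_leb.
- by move=> z _; exact: integral_ge0.
- exact: measurable_integral_leb.
congr (_ + _); rewrite tonelli_leb2//.
apply: eq_integral => s _.
case: ifPn => [/andP[/andP[as_ sb] naccs]|ns]; last first.
  rewrite integral0_eq// => z _; rewrite /B; case: ifP => // /and4P[_ _ sI nacc].
  by move: ns; rewrite sI nacc.
rewrite -ge0_integralD//; last 4 first.
- by move=> z _; exact: bracket_integrand_ge0.
- exact: (@measurable_bracket_integrand _ _ f g k id (fun _ => s) (fun _ => b)).
- by move=> z _; exact: bracket_integrand_ge0.
- exact: (@measurable_bracket_integrand _ _ f g k id (fun _ => a) (fun _ => s)).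
apply: eq_integral => z _; rewrite /B as_ sb naccs andbT.
have [accz|] := boolP (acc z); last by rewrite !andbF adde0.
rewrite !andbT.
(* A starting point lies in exactly one of the brackets [[s, b]] and [[a, s]]: it is accepted and
   [s] is not, so [z = s] cannot occur. *)
have [sz|zs] := ltP s z.
  by rewrite (le_trans as_ (ltW sz)) (ltW sz)/= adde0.
have zs' : (z < s)%R.
  by rewrite lt_neqAle zs andbT; apply: contraNneq naccs => <-.
by rewrite (le_trans zs sb) [(s <= z)%R]leNgt zs' /= !andbT add0e.
Qed.

Lemma bracket_form_sym f g k a b :
  mfT f -> (forall s, 0 <= f s) ->
  mfT g -> (forall s, 0 <= g s) ->
  bracket_form f g k a b = bracket_form g f k a b.
Proof.
move=> mf f0 mg g0; elim: k a b => [|k IH] a b.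
  by rewrite /bracket_form; apply: eq_integral => z _; case: ifP => //=; rewrite !mule0.
rewrite (@bracket_formS f g k a b mf f0 mg g0) (@bracket_formS g f k a b mg g0 mf f0).
apply: (congr2 (fun u v => ((b - a)^-1)%:E * (u + v)) (two_points_sym a b mf f0 mg g0)).
by apply: eq_integral => s _; case: ifP => // _; rewrite (IH s) (IH a).
Qed.

End fixed.
End shrinkage.

(** * Reversibility on the circle *)

Section circle.
Variable R : realType.
Local Open Scope ereal_scope.
Local Notation mu := (@lebesgue_measure R).
Implicit Types (acc : R -> bool) (f g : R -> \bar R).

Lemma integral_itv_coE (a b : R) f : mfT f ->
  \int[mu]_(s in `[a, b]) f s = \int[mu]_s (if (a <= s < b)%R then f s else 0).
Proof.
move=> mf; rewrite -integral_itv_bndo_bndc; last exact: measurable_funTS.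
rewrite integral_mkcond; apply: eq_integral => s _.
by rewrite patchE mem_setE in_itv.
Qed.

(** The two windows share [[l, a + tau]], and what remains of one is the translate by [tau] of what
    remains of the other. *)
Lemma integral_periodic (tau l a : R) f : (0 < tau)%R ->
  mfT f -> (forall s, 0 <= f s) ->
  (forall s, f (s + tau)%R = f s) -> (l - tau <= a <= l)%R ->
  \int[mu]_(s in `[a, (a + tau)%R]) f s = \int[mu]_(s in `[l, (l + tau)%R]) f s.
Proof.
move=> tau0 mf f0 per /andP[la al]; rewrite !integral_itv_coE//.
pose I (u v : R) s := if (u <= s < v)%R then f s else 0.
have mI u v : mfT (I u v).
  apply: measurable_fun_ifT => //.
  by apply: measurable_and; [exact: measurable_fun_ler|exact: measurable_fun_ltr].
have I0 u v s : 0 <= I u v s by rewrite /I; case: ifP.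
have split3 u v w : (u <= v)%R -> (v <= w)%R ->
    \int[mu]_s I u w s = \int[mu]_s I u v s + \int[mu]_s I v w s.
  move=> uv vw; rewrite -ge0_integralD//; [|exact: mI|exact: mI].
  apply: eq_integral => s _; rewrite /I.
  have [sv|vs] := ltP s v.
    by rewrite (lt_le_trans sv vw)/= adde0.
  by rewrite (le_trans uv vs)/= add0e.
rewrite -/(I _ _) (split3 a l) ?(split3 l (a + tau)%R (l + tau)%R)//.
- rewrite addeC; congr (_ + _).
  rewrite -[RHS](integral_leb_shift tau)//; apply: eq_integral => s _.
  by rewrite /I lerD2r ltrD2r per.
- by move: la; rewrite lerBlDr.
- by rewrite lerD2r.
- by move: la; rewrite lerBlDr.
Qed.

Section transition.
Variables (acc : R -> bool) (tau l : R).
Hypothesis macc : mfT acc.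
Hypothesis tau0 : (0 < tau)%R.
Hypothesis per_acc : forall s, acc (s + tau)%R = acc s.

(* The first bracket is the circle cut at the first draw. *)
Definition circle_run acc tau g z k : \bar R :=
  (tau^-1)%:E * \int[mu]_(s in `[0%R, tau])
    (if acc (z + s)%R then g (z + s)%R
     else redraw acc g z k (z + s - tau)%R (z + s)%R).

Let cut f g k (z c : R) : \bar R :=
  if acc z then f z * (if acc c then g c else redraw acc g z k (c - tau)%R c) else 0.

Let cut_ge0 f g k z c : (forall s, 0 <= f s) -> (forall s, 0 <= g s) -> 0 <= cut f g k z c.
Proof.
move=> f0 g0; rewrite /cut; case: ifP => // _; rewrite mule_ge0//.
by case: ifP => // _; exact: redraw_ge0.
Qed.

Let measurable_run d (T : measurableType d) g k (z c : T -> R) :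
  mfT g -> (forall s, 0 <= g s) ->
  mfT z -> mfT c ->
  mfT (fun w => if acc (c w) then g (c w) else
    redraw acc g (z w) k (c w - tau)%R (c w)).
Proof.
move=> mg g0 mz mc; apply: measurable_fun_ifT; [exact: measurable_acc2|exact: measurable_comp2|].
apply: (@measurable_redraw _ k _ _ (fun _ => acc) (fun _ => g)) => //.
- by apply: measurable_acc2 => //; exact: measurable_snd.
- by apply: measurable_comp2 => //; exact: measurable_snd.
- exact: measurable_funB.
Qed.

Let measurable_cut d (T : measurableType d) f g k (z c : T -> R) :
  mfT f -> mfT g -> (forall s, 0 <= g s) ->
  mfT z -> mfT c -> mfT (fun w => cut f g k (z w) (c w)).
Proof.
move=> mf mg g0 mz mc; apply: measurable_fun_ifT => //; first exact: measurable_acc2.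
by apply: emeasurable_funM; [exact: measurable_comp2|exact: measurable_run].
Qed.

Lemma circle_run_ge0 g z k : (forall s, 0 <= g s) -> 0 <= circle_run acc tau g z k.
Proof.
move=> g0; rewrite mule_ge0// ?lee_fin ?invr_ge0 ?(ltW tau0)//.
by apply: integral_ge0 => s _; case: ifP => // _; exact: redraw_ge0.
Qed.

Let cut_periodic f g k z c : mfT g -> (forall s, 0 <= g s) ->
  (forall s, f (s + tau)%R = f s) -> (forall s, g (s + tau)%R = g s) ->
  cut f g k (z + tau)%R (c + tau)%R = cut f g k z c.
Proof.
move=> mg g0 pf pg; rewrite /cut !per_acc pf pg; case: ifP => // _; congr (_ * _).
case: ifP => // _.
have := @redraw_shift _ _ macc tau g z k (c - tau)%R c mg g0.
rewrite (_ : (fun s => acc (tau + s)%R) = acc); last first.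
  by apply/funext => s; rewrite addrC per_acc.
rewrite (_ : (fun s => g (tau + s)%R) = g); last by apply/funext => s; rewrite addrC pg.
by move=> ->; rewrite (addrC z) (addrC c) addrA.
Qed.

Definition period_integral f : \bar R :=
  \int[mu]_(z in `[l, (l + tau)%R]) (if acc z then f z else 0).

Definition cut_integral f g k : \bar R :=
  \int[mu]_(c in `[l, (l + tau)%R]) (if acc c then 0 else bracket_form acc f g k (c - tau)%R c).

(** The cut point [c = z + s] replaces the offset [s] as variable. For fixed [c], the starting point
    runs over the bracket [[c - tau, c]], a full period: if [c] is accepted, the contribution
    factors into [g c] and the period integral of [f], otherwise it is a [bracket_form]. Both terms
    are symmetric in [f] and [g]. *)
Lemma circle_run_form f g k :
  mfT f -> (forall s, 0 <= f s) ->
  mfT g -> (forall s, 0 <= g s) ->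
  (forall s, f (s + tau)%R = f s) -> (forall s, g (s + tau)%R = g s) ->
  \int[mu]_(z in `[l, (l + tau)%R]) (if acc z then f z * circle_run acc tau g z k else 0) =
  (tau^-1)%:E * (period_integral g * period_integral f + cut_integral f g k).
Proof.
move=> mf f0 mg g0 pf pg.
have t0 : (0 <= tau^-1)%R by rewrite invr_ge0 ltW.
have m1 : mfT (@fst R R) by exact: measurable_fst.
have m2 : mfT (@snd R R) by exact: measurable_snd.
have c0 z c : 0 <= cut f g k z c by exact: cut_ge0.
pose D (z s : R) : \bar R :=
  if (l <= z <= l + tau)%R && (0 <= s <= tau)%R then cut f g k z (z + s)%R else 0.
have D0 z s : 0 <= D z s by rewrite /D; case: ifP.
have mD : mfT (fun w : R * R => D w.1 w.2).
  apply: measurable_fun_ifT => //.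
    by apply: measurable_and; exact: measurable_itv_cond.
  by apply: measurable_cut => //; exact: measurable_funD.
transitivity ((tau^-1)%:E * \int[mu]_z \int[mu]_s D z s).
  rewrite -ge0_integralZl_EFin//; last 2 first.
  - by move=> z _; exact: integral_ge0.
  - exact: measurable_integral_leb.
  rewrite integral_itvE; apply: eq_integral => z _; rewrite /D.
  case: ifP => zI; last by rewrite integral0_eq ?mule0.
  rewrite /cut; case: ifP => accz; last first.
    by rewrite integral0_eq ?mule0// => s _; case: ifP.
  rewrite /circle_run muleCA; congr (_ * _); rewrite integral_itvE.
  rewrite -ge0_integralZl//; last 2 first.
  - apply: measurable_fun_ifT => //; first exact: measurable_itv_cond.
    by apply: measurable_run => //; exact: measurable_funD.
  - by move=> s _; case: ifP => // _; case: ifP => // _; exact: redraw_ge0.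
  by apply: eq_integral => s _; rewrite /=; case: ifP => //; rewrite mule0.
congr (_ * _); rewrite tonelli_leb2//.
pose D' (s c : R) : \bar R :=
  if (l <= c <= l + tau)%R && (0 <= s <= tau)%R then cut f g k (c - s)%R c else 0.
have D'0 z s : 0 <= D' z s by rewrite /D'; case: ifP.
have mD' : mfT (fun w : R * R => D' w.1 w.2).
  apply: measurable_fun_ifT => //.
    by apply: measurable_and; exact: measurable_itv_cond.
  by apply: measurable_cut => //; exact: measurable_funB.
transitivity (\int[mu]_s \int[mu]_c D' s c).
  suff DD' (s : R) : \int[mu]_z D z s = \int[mu]_c D' s c.
    by apply: eq_integral => s _; exact: DD'.
  rewrite /D /D'.
  have [/andP[s0 st]|ns] := boolP (0 <= s <= tau)%R; last first.
    by rewrite !integral0_eq// => z _; rewrite andbF.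
  under eq_integral do rewrite andbT.
  under [RHS]eq_integral do rewrite andbT.
  rewrite -integral_itvE.
  have mcut : mfT (fun z : R => cut f g k z (z + s)%R).
    by apply: measurable_cut => //; exact: measurable_funD.
  (* Since [0 <= s <= tau], translating by [s] moves the window by at most one period. *)
  rewrite -(@integral_periodic tau l (l - s)%R)//; last 2 first.
  - by move=> z; rewrite addrAC cut_periodic.
  - by rewrite lerD2l lerN2 st/= lerBlDr lerDl.
  rewrite integral_itvE.
  rewrite -[RHS](integral_leb_shift s).
  - apply: eq_integral => z _; rewrite addrK.
    by rewrite lerBlDr -[in RHS](lerBrDr z) addrAC.
  - apply: measurable_fun_ifT => //; first exact: measurable_itv_cond.
    by apply: measurable_cut => //; exact: measurable_funB.
  - by move=> z; case: ifP.
rewrite tonelli_leb2//.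
have mpI : mfT (fun z => if acc z then f z else 0).
  by apply: measurable_fun_ifT.
have mJ : mfT (fun c : R => bracket_form acc f g k (c - tau)%R c).
  apply: (@measurable_integral_leb _ _ _ (fun c z : R =>
    if (c - tau <= z <= c)%R && acc z then f z * redraw acc g z k (c - tau)%R c else 0)).
    by apply: measurable_bracket_integrand => //; exact: measurable_funB.
  by move=> c z; exact: bracket_integrand_ge0.
have J0 c : 0 <= bracket_form acc f g k (c - tau)%R c.
  by apply: integral_ge0 => z _; exact: bracket_integrand_ge0.
have Pf0 : 0 <= period_integral f by apply: integral_ge0 => z _; case: ifP.
transitivity (\int[mu]_(c in `[l, (l + tau)%R])
    ((if acc c then g c else 0) * period_integral f +
     (if acc c then 0 else bracket_form acc f g k (c - tau)%R c))); last first.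
  have mpg : mfT (fun z => if acc z then g z else 0) by apply: measurable_fun_ifT.
  have mbj : mfT
      (fun c : R => if acc c then 0 else bracket_form acc f g k (c - tau)%R c).
    by apply: measurable_fun_ifT.
  rewrite ge0_integralD//.
  - rewrite ge0_integralZr//; first exact: measurable_funTS.
    by move=> z _; case: ifP.
  - by move=> z _; rewrite mule_ge0//; case: ifP.
  - by apply: measurable_funTS; apply: emeasurable_funM => //.
  - by move=> z _; case: ifP.
  - exact: measurable_funTS.
rewrite integral_itvE.
suff D'E (c : R) : \int[mu]_s D' s c = if (l <= c <= l + tau)%R then
    (if acc c then g c else 0) * period_integral f +
    (if acc c then 0 else bracket_form acc f g k (c - tau)%R c) else 0.
  by apply: eq_integral => c _; exact: D'E.
rewrite /D'; case: ifP => cI; last by rewrite integral0_eq.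
transitivity (\int[mu]_z (if (c - tau <= z <= c)%R then cut f g k z c else 0)).
  have mh : mfT (fun z : R => if (c - tau <= z <= c)%R then cut f g k z c else 0).
    apply: measurable_fun_ifT => //; first exact: measurable_itv_cond.
    exact: measurable_cut.
  have h0 z : 0 <= (if (c - tau <= z <= c)%R then cut f g k z c else 0) by case: ifP.
  rewrite -[RHS](integral_leb_shift c)//.
  rewrite -[RHS]integral_lebN//; last first.
    by apply: (measurableT_comp mh); exact: measurable_funD.
  apply: eq_integral => s _; rewrite (addrC (- s)%R) lerD2l lerN2 gerDl oppr_le0.
  by rewrite /= andbC.
rewrite /cut; case: ifP => accc; last first.
  rewrite mul0e add0e; apply: eq_integral => z _.
  by case: (acc z); rewrite ?andbT ?andbF//; case: ifP.
(* For an accepted cut the integrand depends on [z] only through a periodic function, so the bracket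
   may be moved back to [[l, l + tau]]. *)
rewrite adde0 /period_integral -(@integral_periodic tau l (c - tau)%R)//; last 3 first.
- by move=> s; case: ifP.
- by move=> s; rewrite per_acc pf.
- by move: cI => /andP[lc cl]; rewrite lerD2r lc/= lerBlDr.
rewrite subrK integral_itvE -ge0_integralZl//; last 2 first.
- by apply: measurable_fun_ifT => //; exact: measurable_itv_cond.
- by move=> z _; case: ifP => // _; case: ifP.
apply: eq_integral => z _; case: ifP => _; last by rewrite mule0.
by case: ifP => _; rewrite ?mule0// muleC.
Qed.

Lemma circle_run_sym f g k :
  mfT f -> (forall s, 0 <= f s) ->
  mfT g -> (forall s, 0 <= g s) ->
  (forall s, f (s + tau)%R = f s) -> (forall s, g (s + tau)%R = g s) ->
  \int[mu]_(z in `[l, (l + tau)%R]) (if acc z then f z * circle_run acc tau g z k else 0) =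
  \int[mu]_(z in `[l, (l + tau)%R]) (if acc z then g z * circle_run acc tau f z k else 0).
Proof.
move=> mf f0 mg g0 pf pg.
rewrite (circle_run_form k mf f0 mg g0 pf pg) (circle_run_form k mg g0 mf f0 pg pf).
apply: (congr2 (fun u v => (tau^-1)%:E * (u + v))); first by rewrite muleC.
by apply: eq_integral => c _; case: ifP => // _; exact: bracket_form_sym.
Qed.

End transition.
End circle.

(** * Unit tangent vectors and the geodesic flow *)

Section tangent.
Variable R : realType.
Local Notation mu := (@lebesgue_measure R).

Lemma eq_sphint n (f g : 'rV[R]_n -> \bar R) :
  (forall x, sphere n x -> f x = g x) -> sphint f = sphint g.
Proof.
move=> fg; rewrite /sphint; congr (_ * _)%E; apply: eq_lebint => y.
case: ifPn => // /andP[y0 _]; apply: fg; rewrite /sphere/= dotvZ.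
by rewrite -invfM -expr2 sqr_sqrtr ?ltW// mulVf// gt_eqF.
Qed.

Lemma dotvC n (x y : 'rV[R]_n) : dotv x y = dotv y x.
Proof. by apply: eq_bigr => i _; rewrite mulrC. Qed.

Lemma dotvDl n (x y z : 'rV[R]_n) : (dotv (x + y) z = dotv x z + dotv y z)%R.
Proof. by rewrite /dotv -big_split; apply: eq_bigr => i _; rewrite mxE mulrDl. Qed.

Lemma dotvZl n a (x y : 'rV[R]_n) : (dotv (a *: x) y = a * dotv x y)%R.
Proof. by rewrite -[y]scale1r dotvZ mulr1 scale1r. Qed.

Lemma dotvDr n (x y z : 'rV[R]_n) : (dotv z (x + y) = dotv z x + dotv z y)%R.
Proof. by rewrite dotvC dotvDl !(dotvC _ z). Qed.

Lemma dotvZr n a (x y : 'rV[R]_n) : (dotv x (a *: y) = a * dotv x y)%R.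
Proof. by rewrite dotvC dotvZl dotvC. Qed.

Lemma dotvv_eq0 n (x : 'rV[R]_n) : dotv x x = 0%R -> x = 0%R.
Proof.
move=> x0; apply/eqP; rewrite -[_ == _]negbK; apply/negP => /enorm_gt0.
by rewrite /enorm x0 sqrtr0 ltxx.
Qed.

Definition pole n : 'rV[R]_n.+1 := vext 1 0.

(* Householder reflection; the identity when x = e_0, as then [2 / 0 = 0]. *)
Definition mirror n (x : 'rV[R]_n.+1) : 'M[R]_n.+1 :=
  1%:M - (2 / dotv (x - pole n) (x - pole n)) *: ((x - pole n)^T *m (x - pole n)).

Lemma mirror_mulr n (x w : 'rV[R]_n.+1) : w *m mirror x =
  w - (2 / dotv (x - pole n) (x - pole n) * dotv w (x - pole n)) *: (x - pole n).
Proof.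
rewrite mulmxBr mulmx1 -scalemxAr mulmxA; congr (_ - _)%R.
rewrite (mx11_scalar (w *m _)) -dotvE mul_scalar_mx scalerA.
by [].
Qed.

Lemma mirrorT n (x : 'rV[R]_n.+1) : (mirror x)^T = mirror x.
Proof. by rewrite linearB/= linearZ/= trmx_mul trmxK trmx1. Qed.

Lemma mirror_orth n (x : 'rV[R]_n.+1) : mirror x *m (mirror x)^T = 1%:M.
Proof.
rewrite mirrorT; set u := (x - pole n)%R.
have K (w : 'rV[R]_n.+1) : w *m mirror x *m mirror x = w.
  rewrite !mirror_mulr -/u; set c := (2 / _)%R.
  (* This also holds for [u = 0], where [c] is [0]. *)
  have cc : (c * c * dotv u u = 2 * c)%R.
    have [u0|u0] := eqVneq (dotv u u) 0%R; first by rewrite /c u0 invr0 !mulr0.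
    by rewrite /c; field.
  rewrite -addrA -opprD -scalerDl dotvDl -(scaleNr (c * dotv w u)) dotvZl.
  set D := dotv w u.
  rewrite (_ : _ + _ = D * (2 * c - c * c * dotv u u))%R; last by ring.
  by rewrite cc subrr mulr0 scale0r subr0.
by apply/row_matrixP => i; rewrite !rowE mulmxA K mulmx1.
Qed.

Lemma pole_mirror n (x : 'rV[R]_n.+1) : sphere n.+1 x -> pole n *m mirror x = x.
Proof.
rewrite /sphere/= => x1; rewrite mirror_mulr; set u := (x - pole n)%R.
have p1 : dotv (pole n) (pole n) = 1%R.
  by rewrite dotv_vext mulr1 /dotv big1 ?addr0// => i _; rewrite mxE mul0r.
have xE : x = (u + pole n)%R by rewrite subrK.
have uu : (dotv u u = - 2 * dotv (pole n) u)%R.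
  move: x1; rewrite {1 2}xE dotvDl (dotvDr u (pole n) u) (dotvDr u (pole n) (pole n)) p1 (dotvC u (pole n)).
  by move: (dotv u u) (dotv (pole n) u) => A B; clear; move=> h; lra.
have [u0|u0] := eqVneq (dotv u u) 0%R.
  by rewrite [in RHS]xE (dotvv_eq0 u0) scaler0 subr0 add0r.
rewrite (_ : _ * _ = -1)%R ?scaleN1r ?opprK 1?addrC ?subrK//.
rewrite mulrAC -[(2 * _)%R]opprK -mulNr -uu mulNr divff//.
Qed.

(** A parametrisation of the vectors orthogonal to [x] that is jointly measurable in [x] and [v],
    whereas nothing is known about how the chosen isometry [Uperp x] varies with [x]. *)
Definition tangent n (x : 'rV[R]_n.+1) (v : 'rV[R]_n) : 'rV[R]_n.+1 := vext 0 v *m mirror x.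

Lemma dotv_tangent n (x : 'rV[R]_n.+1) v w : dotv (tangent x v) (tangent x w) = dotv v w.
Proof. by rewrite dotv_orth ?mirror_orth// dotv_vext mulr0 add0r. Qed.

Lemma dotv_x_tangent n (x : 'rV[R]_n.+1) v : sphere n.+1 x -> dotv x (tangent x v) = 0%R.
Proof.
move=> x1; rewrite -{1}(pole_mirror x1) dotv_orth ?mirror_orth// dotv_vext mulr0 add0r.
by rewrite /dotv big1// => i _; rewrite mxE mul0r.
Qed.

Lemma vext_add n (s t : R) (x y : 'rV[R]_n) : vext s x + vext t y = vext (s + t) (x + y).
Proof.
apply/rowP => i; have [j ->|->] := unliftP ord0 i.
  by rewrite mxE !vextS mxE.
by rewrite mxE !vext0.
Qed.

Lemma tangentN n (x : 'rV[R]_n.+1) v : tangent x (- v) = - tangent x v.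
Proof. by rewrite /tangent -mulNmx -[- vext 0 v]scaleN1r vextZ mulr0 scaleN1r. Qed.

Lemma geod_tangent n (x : 'rV[R]_n.+1) v (t : R) : sphere n.+1 x ->
  vext (cos t) (sin t *: v) *m mirror x = geod x (tangent x v) t.
Proof.
move=> x1; rewrite /geod /tangent -{2}(pole_mirror x1) !scalemxAl -mulmxDl !vextZ vext_add.
by rewrite scaler0 add0r mulr1 mulr0 addr0.
Qed.

Section measurability.
Context d (T : measurableType d).

Lemma measurable_mirror_coord n (x : T -> 'rV[R]_n.+1) i j : mfT x -> mfT (fun w => mirror (x w) i j).
Proof.
move=> mx.
have mu_ : mfT (fun w => x w - pole n)%R by exact: measurable_rVB.
have mui k := (measurable_rVP _).1 mu_ k.
rewrite (_ : (fun w => _) = (fun w => (1%:M : 'M[R]_n.+1) i j - (2 * (dotv (x w - pole n) (x w - pole n))^-1) *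
   ((x w - pole n) ord0 i * (x w - pole n) ord0 j)))%R; last first.
  apply/funext => w; rewrite /mirror [LHS]mxE; congr (_ + _)%R.
  rewrite [LHS]mxE; congr (- _)%R; rewrite [LHS]mxE; congr (_ * _)%R.
  by rewrite [LHS]mxE big_ord1 [in LHS]mxE.
apply: measurable_funB => //; apply: measurable_funM; last exact: measurable_funM.
by apply: measurable_funM => //; apply: measurable_inv; exact: measurable_dotv.
Qed.

Lemma measurable_tangent n (x : T -> 'rV[R]_n.+1) (v : T -> 'rV[R]_n) :
  mfT x -> mfT v -> mfT (fun w => tangent (x w) (v w)).
Proof.
move=> mx mv; apply: measurable_mulmx; first exact: measurable_vext.
by move=> i j; exact: measurable_mirror_coord.
Qed.

Lemma measurable_geod n (x v : T -> 'rV[R]_n) (t : T -> R) :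
  mfT x -> mfT v -> mfT t -> mfT (fun w => geod (x w) (v w) (t w)).
Proof.
move=> mx mv mt; apply: measurable_rVD; apply: measurable_rVZ => //.
  exact: measurable_cos.
exact: measurable_sin.
Qed.

(** The velocity of [geod x v] at time [t]; together, [geod] and [dgeod] are the geodesic flow. *)
Definition dgeod n (x v : 'rV[R]_n) (t : R) : 'rV[R]_n := - sin t *: x + cos t *: v.

Lemma measurable_dgeod n (x v : T -> 'rV[R]_n) (t : T -> R) :
  mfT x -> mfT v -> mfT t -> mfT (fun w => dgeod (x w) (v w) (t w)).
Proof.
move=> mx mv mt; apply: measurable_rVD; apply: measurable_rVZ => //.
  by apply: measurable_funN; exact: measurable_sin.
exact: measurable_cos.
Qed.

End measurability.

Local Open Scope ereal_scope.

(** Polar coordinates at the pole, carried to [x] by the reflection, which preserves [sphint]. *)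
Lemma sphint_polar_at n (x : 'rV[R]_n.+2) (f : 'rV[R]_n.+2 -> \bar R) : sphere n.+2 x ->
  mfT f -> (forall x, 0 <= f x) ->
  sphint f = \int[mu]_(t in `]0%R, pi[) ((sin t ^+ n)%:E *
     sphint (fun v : 'rV[R]_n.+1 => f (geod x (tangent x v) t))).
Proof.
move=> x1 mf f0.
have mfm : mfT (fun v => f (v *m mirror x)).
  by apply: measurableT_comp => //; exact: measurable_mulmxr.
rewrite -(sphint_orth (mirror_orth x) mf f0) (sphint_polar mfm (fun v => f0 _)).
apply: eq_integral => t _; congr (_ * _); congr sphint; apply/funext => v.
by rewrite geod_tangent.
Qed.

Lemma row_mirror n (v : 'rV[R]_n) (M : 'M[R]_n.+1) : v *m row' ord0 M = vext 0 v *m M.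
Proof.
apply/rowP => j; rewrite !mxE big_ord_recl vext0 mul0r add0r.
by apply: eq_bigr => i _; rewrite vextS mxE.
Qed.

End tangent.

(** * Invariance under the geodesic flow *)

Section flow.
Variable R : realType.
Local Notation mu := (@lebesgue_measure R).

Lemma mirror_row0 n (x : 'rV[R]_n.+1) j : sphere n.+1 x -> mirror x ord0 j = x 0 j.
Proof.
move=> /pole_mirror/rowP/(_ j); rewrite mxE big_ord_recl vext0 mul1r.
by rewrite big1 ?addr0// => i _; rewrite vextS mxE mul0r.
Qed.

Lemma perp_isom_mirror n (x : 'rV[R]_n.+1) : sphere n.+1 x ->
  perp_isom x (row' ord0 (mirror x)).
Proof.
move=> x1; split; apply/matrixP => i j.
  have /matrixP/(_ (lift ord0 i) (lift ord0 j)) := mirror_orth x.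
  rewrite !mxE (inj_eq (@lift_inj _ ord0)) => <-.
  by apply: eq_bigr => k _; rewrite !mxE.
have H2 : (mirror x *m (mirror x)^T) (lift ord0 i) ord0 = 0.
  by rewrite mirror_orth mxE eq_sym eq_liftF.
rewrite [RHS]mxE; transitivity ((mirror x *m (mirror x)^T) (lift ord0 i) ord0); last exact: H2.
rewrite [LHS]mxE [RHS]mxE; apply: eq_bigr => k _.
rewrite [row' _ _ _ _]mxE [x^T _ _]mxE [(mirror x)^T _ _]mxE (mirror_row0 _ x1).
by rewrite !ord1.
Qed.

(** Row [0] of the orthogonal matrix [mirror x] is [x], so the remaining rows resolve the identity
    on the complement of [x]. *)
Lemma mirror_proj n (x : 'rV[R]_n.+1) : sphere n.+1 x ->
  (row' ord0 (mirror x))^T *m row' ord0 (mirror x) = 1%:M - x^T *m x.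
Proof.
move=> x1; have /mulmx1C := mirror_orth x.
move=> /matrixP HH; apply/matrixP => i j.
have := HH i j; rewrite [X in X = _]mxE big_ord_recl => {}HH.
rewrite [RHS]mxE -HH [X in _ + X]mxE [(x^T *m x) _ _]mxE big_ord1.
rewrite [x^T _ _]mxE [(mirror x)^T _ _]mxE !(mirror_row0 _ x1) addrAC subrr add0r.
by rewrite [LHS]mxE; apply: eq_bigr => k _; rewrite !mxE.
Qed.

Local Open Scope ereal_scope.

(** Any two isometries onto the complement of [x] differ by an orthogonal matrix, here [Q], and
    [sphint] does not see it. So the choice in [Uperp] may be replaced by the reflection. *)
Lemma subsph_intE n (x : 'rV[R]_n.+1) (F : 'rV[R]_n.+1 -> \bar R) : sphere n.+1 x ->
  mfT F -> (forall v, 0 <= F v) ->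
  subsph_int x F = sphint (fun v => F (tangent x v)).
Proof.
move=> x1 mF F0; pose N := row' ord0 (mirror x).
have [NN Nx] := perp_isom_mirror x1.
have [UU Ux] : perp_isom x (Uperp x).
  by apply: (@xgetPex _ 0%R [set M | perp_isom x M]); exists N.
pose M : 'M[R]_(n, n.+1) := Uperp x.
have MM : M *m M^T = 1%:M by exact: UU.
have Mx : M *m x^T = 0%R by exact: Ux.
pose Q : 'M[R]_n := M *m N^T.
have QN : Q *m N = M.
  by rewrite -mulmxA mirror_proj// mulmxBr mulmx1 mulmxA Mx mul0mx subr0.
have QQ : Q *m Q^T = 1%:M.
  by rewrite trmx_mul trmxK mulmxA QN.
pose g (v : 'rV[R]_n) := F (v *m N).
have mg : mfT g by apply: measurableT_comp => //; exact: measurable_mulmxr.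
transitivity (sphint (fun v => g (v *m Q))).
  by congr sphint; apply/funext => v; rewrite /g -mulmxA QN.
rewrite (sphint_orth QQ mg (fun v => F0 _)).
by congr sphint; apply/funext => v; rewrite /g row_mirror.
Qed.

Lemma measurable_rVN n : mfT (fun v : 'rV[R]_n => (- v)%R).
Proof.
have -> : (fun v : 'rV[R]_n => (- v)%R) = (fun v => ((-1) *: v)%R).
  by apply/funext => v; rewrite scaleN1r.
exact: (measurable_rVZ (measurable_cst _) (@measurable_id _ _ setT)).
Qed.

Lemma sphintN n (F : 'rV[R]_n -> \bar R) : mfT F -> (forall v, 0 <= F v) ->
  sphint (fun v => F (- v)%R) = sphint F.
Proof.
move=> mF F0; rewrite -[RHS](@sphint_orth _ _ (- 1%:M) F)//.
  by congr sphint; apply/funext => v; rewrite mulmxN mulmx1.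
by rewrite linearN/= mulmxN mulNmx opprK trmx1 mulmx1.
Qed.

(** Integration against the unnormalised Liouville measure of the unit tangent bundle. *)
Definition bundle_int n (F : 'rV[R]_n.+1 -> 'rV[R]_n.+1 -> \bar R) : \bar R :=
  sphint (fun x => sphint (fun v => F x (tangent x v))).

Lemma measurable_fibre_int d (T : measurableType d) n (F : T -> 'rV[R]_n.+1 -> 'rV[R]_n.+1 -> \bar R)
    (x : T -> 'rV[R]_n.+1) :
  mfT (fun z : T * ('rV[R]_n.+1 * 'rV[R]_n.+1) => F z.1 z.2.1 z.2.2) ->
  (forall w x v, 0 <= F w x v) -> mfT x -> mfT (fun w => sphint (fun v => F w (x w) (tangent (x w) v))).
Proof.
move=> mF F0 mx; apply: (@measurable_sphint _ _ _ _ (fun w v => F w (x w) (tangent (x w) v))) => //.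
apply: (measurableT_comp (g := fun z : T * 'rV[R]_n => (z.1, (x z.1, tangent (x z.1) z.2))) mF).
have mx1 : mfT (fun z : T * 'rV[R]_n => x z.1).
  exact: (measurableT_comp mx (@measurable_fst _ _ T 'rV[R]_n)).
apply: measurable_fun_pair => //; apply: measurable_fun_pair => //.
by apply: measurable_tangent => //; exact: measurable_snd.
Qed.

Section invariance.
Variable n : nat.
Local Notation V := 'rV[R]_n.+2.
Variable (F : V -> V -> \bar R).
Hypothesis mF : mfT (fun z : V * V => F z.1 z.2).
Hypothesis F0 : forall x v, 0 <= F x v.

Lemma measurable_comp_F d (T : measurableType d) (x v : T -> V) :
  mfT x -> mfT v -> mfT (fun w => F (x w) (v w)).
Proof.
move=> mx mv; apply: (measurableT_comp (g := fun w => (x w, v w)) mF).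
exact: measurable_fun_pair.
Qed.

(** The velocity with which the geodesic from [x] arrives at [y], written in terms of the two points
    alone: for times in []0, pi[], [dotv x y] is [cos t] and the square root is [sin t]. *)
Let back (x y : V) : V :=
  (Num.sqrt (1 - dotv x y ^+ 2))^-1 *: (dotv x y *: y - x).
(** The power in front cancels the polar density [sin t ^+ n]. *)
Let G (x y : V) : \bar R :=
  (((Num.sqrt (1 - dotv x y ^+ 2))^-1) ^+ n)%:E * F y (back x y).

Let measurable_back d (T : measurableType d) (x y : T -> V) :
  mfT x -> mfT y -> mfT (fun w => back (x w) (y w)).
Proof.
move=> mx my; have md := measurable_dotv mx my.
apply: measurable_rVZ.
  apply/measurable_inv/measurable_sqrt; apply: measurable_funB => //; exact: measurable_funX.
by apply: measurable_rVB => //; exact: measurable_rVZ.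
Qed.

Let G0 x y : 0 <= G x y.
Proof. by rewrite mule_ge0// lee_fin exprn_ge0// invr_ge0 sqrtr_ge0. Qed.

Let measurable_G d (T : measurableType d) (x y : T -> V) :
  mfT x -> mfT y -> mfT (fun w => G (x w) (y w)).
Proof.
move=> mx my; have md := measurable_dotv mx my.
apply: emeasurable_funM.
  apply/measurable_EFinP; apply: measurable_funX.
  apply/measurable_inv/measurable_sqrt; apply: measurable_funB => //; exact: measurable_funX.
by apply: measurable_comp_F => //; exact: measurable_back.
Qed.

Let mGc : mfT (fun z : V * V => G z.1 z.2).
Proof. by apply: measurable_G; [exact: measurable_fst|exact: measurable_snd]. Qed.

Lemma dotv_geod (x w : V) t : sphere n.+2 x -> dotv x w = 0%R ->
  dotv x (geod x w t) = cos t.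
Proof. by move=> x1 xw; rewrite /geod dotvDr !dotvZr xw mulr0 addr0 x1 mulr1. Qed.

Let sqrt_sin (t : R) : (0 < t < pi)%R -> Num.sqrt (1 - cos t ^+ 2) = sin t.
Proof.
by move=> tI; rewrite -sin2cos2 sqrtr_sqr gtr0_norm// sin_gt0_pi.
Qed.

Let back_geod (x w : V) t : sphere n.+2 x -> dotv x w = 0%R -> (0 < t < pi)%R ->
  G x (geod x w t) = ((sin t)^-1 ^+ n)%:E * F (geod x w t) (dgeod x w t).
Proof.
move=> x1 xw tI; rewrite /G /back dotv_geod// sqrt_sin//; congr (_ * F _ _).
have s0 : sin t != 0%R by rewrite gt_eqF// sin_gt0_pi.
apply/rowP => i; rewrite !mxE.
rewrite (_ : (cos t * (cos t * x 0 i + sin t * w 0 i) - x 0 i =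
  sin t * (- sin t * x 0 i + cos t * w 0 i))%R) ?mulKf//.
have := sin2cos2 t; set s := sin t; set c := cos t => sc.
by transitivity ((- (1 - c ^+ 2)) * x 0 i + c * s * w 0 i)%R; [ring|rewrite -sc; ring].
Qed.

Let back_geod' (x w : V) t : sphere n.+2 x -> dotv x w = 0%R -> (0 < t < pi)%R ->
  G (geod x w t) x = ((sin t)^-1 ^+ n)%:E * F x (- w).
Proof.
move=> x1 xw tI; rewrite /G /back [dotv _ x]dotvC dotv_geod// sqrt_sin//; congr (_ * F _ _).
have s0 : sin t != 0%R by rewrite gt_eqF// sin_gt0_pi.
apply/rowP => i; rewrite !mxE.
by rewrite opprD addNKr mulrN mulKf.
Qed.

(* In polar coordinates around x both sides are integrals over pairs of points
   (x, y) of the sphere, y being the point reached at time t. Exchanging x and y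
   reverses the geodesic: the velocity at the new endpoint is -v. *)
Lemma half_flow : \int[mu]_(t in `]0%R, pi[)
    bundle_int (fun x v => F (geod x v t) (dgeod x v t)) = pi%:E * bundle_int F.
Proof.
have mgd d (T : measurableType d) (x v : T -> V) (t : T -> R) :
    mfT x -> mfT v -> mfT t ->
    mfT (fun w => F (geod (x w) (v w) (t w)) (dgeod (x w) (v w) (t w))).
  by move=> mx mv mt; apply: measurable_comp_F; [exact: measurable_geod|exact: measurable_dgeod].
pose E (t : R) x := if (0 < t < pi)%R then
  sphint (fun v => F (geod x (tangent x v) t) (dgeod x (tangent x v) t)) else 0.
have mE : mfT (fun z : R * V => E z.1 z.2).
  apply: measurable_fun_ifT => //.
    apply: measurable_and; apply: measurable_fun_ltr => //;
      exact: (@measurable_fst _ _ R V).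
  apply: (@measurable_fibre_int _ (R * V)%type _
    (fun z x w => F (geod x w z.1) (dgeod x w z.1)) snd) => //.
  apply: mgd.
  - exact: (measurableT_comp (@measurable_fst _ _ V V) (@measurable_snd _ _ _ _)).
  - exact: (measurableT_comp (@measurable_snd _ _ V V) (@measurable_snd _ _ _ _)).
  - exact: (measurableT_comp (@measurable_fst _ _ R V) (@measurable_fst _ _ _ _)).
have E0 t x : 0 <= E t x by rewrite /E; case: ifP => // _; exact: sphint_ge0.
transitivity (\int[mu]_t sphint (E t)).
  rewrite integral_mkcond; apply: eq_integral => t _; rewrite patchE mem_setE in_itv/=.
  rewrite /E; case: ifP => // _; by rewrite sphintE// integral0.
rewrite sphint_leb_swap//.
transitivity (sphint (fun x => sphint (G x))).
  apply: eq_sphint => x x1.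
  rewrite (sphint_polar_at x1 (measurable_section x mGc) (G0 x)) [RHS]integral_mkcond.
  apply: eq_integral => t _; rewrite patchE mem_setE in_itv/= /E; case: ifP => // tI.
  have s0 : (0 < sin t)%R by exact: sin_gt0_pi.
  rewrite [X in _ * X](_ : _ = sphint (fun v => ((sin t)^-1 ^+ n)%:E *
      F (geod x (tangent x v) t) (dgeod x (tangent x v) t))); last first.
    by congr sphint; apply/funext => v; rewrite back_geod// dotv_x_tangent.
  rewrite (sphintZl (f := fun v => F (geod x (tangent x v) t) (dgeod x (tangent x v) t))).
  - by rewrite muleA -EFinM -exprMn mulfV ?gt_eqF// expr1n mul1e.
  - by rewrite exprn_ge0// invr_ge0 ltW.
  - by apply: mgd => //; exact: measurable_tangent.
  - by move=> v.
rewrite (sphint_sphint_swap mGc G0).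
have mFN : mfT (fun x => sphint (fun v => F x (tangent x v))).
  apply: (@measurable_fibre_int _ _ _ (fun _ => F) id) => //.
  apply: measurable_comp_F.
  - exact: (measurableT_comp (@measurable_fst _ _ V V) (@measurable_snd _ _ _ _)).
  - exact: (measurableT_comp (@measurable_snd _ _ V V) (@measurable_snd _ _ _ _)).
rewrite /bundle_int -(sphintZl (pi_ge0 R) mFN); last by move=> x; exact: sphint_ge0.
apply: eq_sphint => x x1.
have mGx : mfT (fun y => G y x) by exact: measurable_section2 mGc.
rewrite (sphint_polar_at x1 mGx (fun y => G0 y x)).
have mFx : mfT (fun v => F x (tangent x v)).
  by apply: measurable_comp_F => //; exact: measurable_tangent.
transitivity (\int[mu]_(t in `]0%R, pi[) sphint (fun v => F x (tangent x v))).
  apply: eq_integral => t; rewrite inE/= in_itv/= => tI.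
  have s0 : (0 < sin t)%R by exact: sin_gt0_pi.
  rewrite [X in _ * X](_ : _ = sphint (fun v => ((sin t)^-1 ^+ n)%:E * F x (tangent x (- v)%R))); last first.
    by congr sphint; apply/funext => v; rewrite back_geod'// ?dotv_x_tangent// tangentN.
  rewrite (sphintZl (f := fun v => F x (tangent x (- v)%R))).
  - rewrite muleA -EFinM -exprMn mulfV ?gt_eqF// expr1n mul1e.
    exact: (sphintN (F := fun v => F x (tangent x v))).
  - by rewrite exprn_ge0// invr_ge0 ltW.
  - apply: measurable_comp_F => //; apply: measurable_tangent => //.
    exact: measurable_rVN.
  - by move=> v.
rewrite integral_cst//= muleC lebesgue_measure_itv/= lte_fin pi_gt0.
by rewrite oppr0 adde0.
Qed.

End invariance.
End flow.

(** * Unboundedly many redraws *)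

Section circle_limit.
Variable R : realType.
Local Open Scope ereal_scope.
Local Notation mu := (@lebesgue_measure R).
Implicit Types (acc : R -> bool) (f g : R -> \bar R).

Definition circle_lim acc tau g z := ereal_sup (range (circle_run acc tau g z)).

Lemma measurable_run d (T : measurableType d) (tau : R) (acc : T -> R -> bool) (g : T -> R -> \bar R)
    (z : T -> R) k :
  mfT (fun w : T * R => acc w.1 w.2) ->
  mfT (fun w : T * R => g w.1 w.2) -> (forall w s, 0 <= g w s) ->
  mfT z ->
  mfT (fun w : T * R => if acc w.1 (z w.1 + w.2)%R then g w.1 (z w.1 + w.2)%R
     else redraw (acc w.1) (g w.1) (z w.1) k (z w.1 + w.2 - tau)%R (z w.1 + w.2)%R).
Proof.
move=> macc mg g0 mz.
have m1 : mfT (@fst T R) by exact: measurable_fst.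
have m2 : mfT (@snd T R) by exact: measurable_snd.
have mz1 : mfT (fun w : T * R => z w.1) by exact: (measurableT_comp mz m1).
have mzs : mfT (fun w : T * R => z w.1 + w.2)%R by exact: measurable_funD.
have mp : mfT (fun w : T * R => (w.1, (z w.1 + w.2)%R)).
  exact: measurable_fun_pair.
have m11 : mfT (fun w : (T * R) * R => (w.1.1, w.2)).
  by apply: measurable_fun_pair; [exact: (measurableT_comp m1)|exact: measurable_snd].
apply: measurable_fun_ifT; [exact: (measurableT_comp macc mp)|exact: (measurableT_comp mg mp)|].
apply: (@measurable_redraw _ k _ _ (fun w => acc w.1) (fun w => g w.1)) => //.
- exact: (measurableT_comp macc m11).
- exact: (measurableT_comp mg m11).
- exact: measurable_funB.
Qed.

Lemma measurable_circle_run d (T : measurableType d) (tau : R) (acc : T -> R -> bool)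
    (g : T -> R -> \bar R) (z : T -> R) k : (0 < tau)%R ->
  mfT (fun w : T * R => acc w.1 w.2) ->
  mfT (fun w : T * R => g w.1 w.2) -> (forall w s, 0 <= g w s) ->
  mfT z -> mfT (fun w => circle_run (acc w) tau (g w) (z w) k).
Proof.
move=> tau0 macc mg g0 mz; rewrite /circle_run.
under eq_fun do rewrite integral_itvE.
apply: emeasurable_funM => //.
apply: (@measurable_integral_leb _ _ _ (fun (w : T) (s : R) => if (0 <= s <= tau)%R then
   if acc w (z w + s)%R then g w (z w + s)%R
     else redraw (acc w) (g w) (z w) k (z w + s - tau)%R (z w + s)%R else 0)).
  apply: measurable_fun_ifT => //.
    by apply: measurable_itv_cond => //; exact: measurable_snd.
  exact: measurable_run.
by move=> w s; case: ifP => // _; case: ifP => // _; exact: redraw_ge0.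
Qed.

Section fixed.
Variables (acc : R -> bool) (tau : R).
Hypothesis macc : mfT acc.
Hypothesis tau0 : (0 < tau)%R.

Let tauV0 : (0 <= tau^-1)%R. Proof. by rewrite invr_ge0 ltW. Qed.

Let measurable_run1 g z k : mfT g -> (forall s, 0 <= g s) ->
  mfT (fun s : R => if acc (z + s)%R then g (z + s)%R
     else redraw acc g z k (z + s - tau)%R (z + s)%R).
Proof.
move=> mg g0.
have mp : mfT (fun s : R => (tt, s)) by exact: measurable_fun_pair.
have H (U : Type) (h : R -> U) : (fun w : unit * R => h w.2) = h \o snd by [].
have ms : mfT (@snd unit R) by exact: measurable_snd.
apply: (measurableT_comp (@measurable_run _ unit tau (fun=> acc) (fun=> g) (fun=> z) k _ _ _ _) mp) => //.
- exact: (measurableT_comp macc ms).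
- exact: (measurableT_comp mg ms).
Qed.

Let run_ge0 g z k s : (forall s, 0 <= g s) ->
  0 <= (if acc (z + s)%R then g (z + s)%R else redraw acc g z k (z + s - tau)%R (z + s)%R).
Proof. by move=> g0; case: ifP => // _; exact: redraw_ge0. Qed.

Lemma circle_run_nd g z : mfT g -> (forall s, 0 <= g s) ->
  {homo circle_run acc tau g z : k l / (k <= l)%N >-> k <= l}.
Proof.
move=> mg g0 k l kl; apply: lee_wpmul2l; first by rewrite lee_fin.
apply: ge0_le_integral => //.
- by move=> s _; exact: run_ge0.
- by apply: measurable_funTS; exact: measurable_run1.
- by apply: measurable_funTS; exact: measurable_run1.
- by move=> s _; case: ifP => // _; exact: redraw_nd.
Qed.

Lemma circle_run_cvg g z : mfT g -> (forall s, 0 <= g s) ->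
  circle_run acc tau g z k @[k --> \oo] --> circle_lim acc tau g z.
Proof. by move=> mg g0; apply: ereal_nondecreasing_cvgn; exact: circle_run_nd. Qed.

Lemma circle_run_lin (c : R) f g z k : (0 <= c)%R ->
  mfT f -> (forall s, 0 <= f s) ->
  mfT g -> (forall s, 0 <= g s) ->
  circle_run acc tau (fun s => c%:E * f s + g s) z k =
  c%:E * circle_run acc tau f z k + circle_run acc tau g z k.
Proof.
move=> c0 mf f0 mg g0; rewrite /circle_run muleCA -muleDr; last 2 first.
- by [].
- by rewrite ge0_adde_def// inE ?mule_ge0 ?lee_fin//; apply: integral_ge0 => s _; exact: run_ge0.
congr (_ * _); rewrite -ge0_integralZl_EFin//; last 2 first.
- by move=> s _; exact: run_ge0.
- by apply: measurable_funTS; exact: measurable_run1.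
rewrite -ge0_integralD//; last 4 first.
- by move=> s _; rewrite mule_ge0 ?lee_fin//; exact: run_ge0.
- by apply: measurable_funTS; apply: emeasurable_funM => //; exact: measurable_run1.
- by move=> s _; exact: run_ge0.
- by apply: measurable_funTS; exact: measurable_run1.
by apply: eq_integral => s _; case: ifP => // _; rewrite (redraw_lin macc).
Qed.

Lemma circle_lim_ge0 g z : (forall s, 0 <= g s) -> 0 <= circle_lim acc tau g z.
Proof.
move=> g0; apply: le_trans (ereal_sup_ubound _); last by exists 0%N.
exact: circle_run_ge0.
Qed.

Lemma circle_lim_lin (c : R) f g z : (0 <= c)%R ->
  mfT f -> (forall s, 0 <= f s) ->
  mfT g -> (forall s, 0 <= g s) ->
  circle_lim acc tau (fun s => c%:E * f s + g s) z =
  c%:E * circle_lim acc tau f z + circle_lim acc tau g z.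
Proof.
move=> c0 mf f0 mg g0.
have mh : mfT (fun s => c%:E * f s + g s).
  by apply: emeasurable_funD => //; exact: emeasurable_funM.
have h0 s : 0 <= c%:E * f s + g s by rewrite adde_ge0// mule_ge0.
rewrite -(cvg_lim _ (@circle_run_cvg _ z mh h0))//; apply/cvg_lim => //.
under eq_fun do rewrite circle_run_lin//.
apply: cvgeD; [|apply: cvgeZl => //; exact: circle_run_cvg|exact: circle_run_cvg].
by rewrite ge0_adde_def// inE ?mule_ge0 ?lee_fin//; exact: circle_lim_ge0.
Qed.

Lemma le_circle_lim g z : (forall s, 0 <= g s) ->
  (tau^-1)%:E * \int[mu]_(s in `[0%R, tau]) (if acc (z + s)%R then g (z + s)%R else 0) <=
  circle_lim acc tau g z.
Proof.
move=> g0; apply: le_trans (ereal_sup_ubound _); last by exists 0%N.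
by [].
Qed.

Lemma circle_lim_le1 z : circle_lim acc tau (fun=> 1) z <= 1.
Proof.
apply: ge_ereal_sup => _ [k _ <-].
apply: (@le_trans _ _ ((tau^-1)%:E * \int[mu]_(s in `[0%R, tau]) 1)).
  apply: lee_wpmul2l; first by rewrite lee_fin.
  apply: ge0_le_integral => //.
  - by move=> s _; apply: run_ge0 => ?; exact: lee01.
  - by apply: measurable_funTS; apply: measurable_run1 => // ?; exact: lee01.
  - by move=> s _; case: ifP => // _; exact: redraw_le1.
by rewrite integral_cst//= mul1e lebesgue_measure_itv/= lte_fin tau0 oppr0 adde0 -EFinM mulVf// gt_eqF.
Qed.

Hypothesis per_acc : forall s, acc (s + tau)%R = acc s.

(** The probability of not having stopped decays geometrically in the number of redraws, as the
    accepted neighbourhood of [z] is never cut away. *)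
Lemma circle_lim1 z e : (0 < e)%R -> (forall s, (z - e < s < z + e)%R -> acc s) ->
  circle_lim acc tau (fun=> 1) z = 1.
Proof.
move=> e0 near_z; apply/eqP; rewrite eq_le circle_lim_le1/=.
(* Capped at half a turn, so that an interval of length [2 * e'] fits into the circle and [q] is
   nonnegative. *)
pose e' : R := (Num.min e (tau / 2))%R; have e'0 : (0 < e')%R by rewrite lt_min e0 divr_gt0.
have near' s : (z - e' < s < z + e')%R -> acc s.
  move=> /andP[s1 s2]; apply: near_z; rewrite (le_lt_trans _ s1) ?(lt_le_trans s2)//.
    by rewrite lerD2l ge_min lexx.
  by rewrite lerD2l lerN2 ge_min lexx.
pose q := (1 - 2 * e' / tau)%R.
have r1 : (2 * e' / tau <= 1)%R.
  by rewrite ler_pdivrMr// mul1r mulrC -ler_pdivlMr// ge_min lexx orbT.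
have r0 : (0 < 2 * e' / tau)%R by rewrite divr_gt0// mulr_gt0.
have q0 : (0 <= q)%R by rewrite subr_ge0.
have q1 : (q < 1)%R by rewrite gtrBl.
have bnd k : (1 - q ^+ k)%:E <= circle_lim acc tau (fun=> 1) z.
  apply: le_trans (ereal_sup_ubound _); last by exists k.
  rewrite /circle_run.
  apply: (@le_trans _ _ ((tau^-1)%:E * \int[mu]_(s in `[0%R, tau]) (1 - q ^+ k)%:E)).
    rewrite integral_cst//= lebesgue_measure_itv/= lte_fin tau0 oppr0 adde0 -!EFinM.
    by rewrite mulrCA mulVf ?gt_eqF// mulr1.
  have qk : (0 <= 1 - q ^+ k)%R.
    by rewrite subr_ge0 exprn_ile1// ltW.
  apply: lee_wpmul2l; first by rewrite lee_fin.
  apply: ge0_le_integral => //.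
  - by apply: measurable_funTS; apply: measurable_run1 => // ?; exact: lee01.
  - move=> s /=; rewrite in_itv/= => /andP[s0 st].
    case: ifPn => [_|nacc].
      by rewrite lee_fin gerBl exprn_ge0.
    (* A rejected first draw and its copy one turn earlier are the ends of the first bracket. By
       periodicity neither is near [z], so the bracket contains the whole interval around [z]. *)
    have nearper u : (z - e' < u < z + e')%R -> u != (z + s)%R /\ u != (z + s - tau)%R.
      move=> /near' au; split; apply/eqP => uE; move: nacc; rewrite -?uE ?au//.
      by rewrite -[(z + s)%R](subrK tau) per_acc -uE au.
    apply: redraw_mass => //.
    + rewrite leNgt; apply/negP => lt1.
      have [|_ /eqP] := nearper (z + s - tau)%R; last by [].
      by rewrite lt1/= -addrA ltrD2l (le_lt_trans _ e'0)// subr_le0.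
    + rewrite leNgt; apply/negP => lt1.
      have [|/eqP] := nearper (z + s)%R; last by [].
      by rewrite lt1 andbT ltrD2l (lt_le_trans _ s0)// oppr_lt0.
    + by rewrite opprB addrCA subrr addr0.
have : (1 - q ^+ k)%:E @[k --> \oo] --> (1 - 0)%:E.
  by apply: cvg_EFin; [exact: nearW|apply: cvgB; [exact: cvg_cst|apply: cvg_expr; rewrite ger0_norm]].
rewrite subr0 => hc; rewrite -[leLHS](cvg_lim _ hc)//; apply: lime_le.
  by apply/cvg_ex; exists 1.
exact: nearW.
Qed.

End fixed.
End circle_limit.

(** * Stationarity on a circle and the flow over a full turn *)

Section circle_stationary.
Variable R : realType.
Local Open Scope ereal_scope.
Local Notation mu := (@lebesgue_measure R).
Implicit Types (acc : R -> bool) (f g : R -> \bar R).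

Lemma measurable_circle_lim d (T : measurableType d) (tau : R) (acc : T -> R -> bool)
    (g : T -> R -> \bar R) (z : T -> R) : (0 < tau)%R ->
  mfT (fun w : T * R => acc w.1 w.2) ->
  mfT (fun w : T * R => g w.1 w.2) -> (forall w s, 0 <= g w s) ->
  mfT z -> mfT (fun w => circle_lim (acc w) tau (g w) (z w)).
Proof.
move=> tau0 macc mg g0 mz.
apply: (emeasurable_fun_cvg (fun k w => circle_run (acc w) tau (g w) (z w) k)).
  by move=> k; exact: measurable_circle_run.
move=> w _; apply: circle_run_cvg => //; first exact: measurable_section macc.
exact: measurable_section mg.
Qed.

Lemma circle_lim_shift acc tau g (c z : R) : mfT acc ->
  mfT g -> (forall s, 0 <= g s) ->
  circle_lim (fun s => acc (c + s)%R) tau (fun s => g (c + s)%R) z = circle_lim acc tau g (c + z)%R.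
Proof.
move=> macc mg g0; suff H : circle_run (fun s => acc (c + s)%R) tau (fun s => g (c + s)%R) z =
    circle_run acc tau g (c + z)%R by rewrite /circle_lim H.
apply/funext => k.
rewrite /circle_run; congr (_ * _); apply: eq_integral => s _.
rewrite addrA; case: ifP => // _.
by rewrite (redraw_shift macc)// !addrA.
Qed.

(** Reversibility against the test function [1] turns the integral of the run of [g] into that of
    [g] times the run of [1]. The latter increases to [1] at accepted points, and both sides pass to
    the monotone limit. *)
Lemma circle_lim_stationary acc (tau l : R) g :
  mfT acc -> (0 < tau)%R -> (forall s, acc (s + tau)%R = acc s) ->
  (forall z, acc z -> exists2 e, (0 < e)%R & forall s, (z - e < s < z + e)%R -> acc s) ->
  mfT g -> (forall s, 0 <= g s) -> (forall s, g s \is a fin_num) ->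
  (forall s, g (s + tau)%R = g s) ->
  \int[mu]_(z in `[l, (l + tau)%R]) (if acc z then circle_lim acc tau g z else 0) =
  \int[mu]_(z in `[l, (l + tau)%R]) (if acc z then g z else 0).
Proof.
move=> macc tau0 per oacc mg g0 gfin pg.
have m1 : mfT (fun _ : R => 1 : \bar R) by [].
have p1 (s : R) : 0 <= (1 : \bar R) by exact: lee01.
have macc2 : mfT (fun w : R * R => acc w.2).
  exact: (measurableT_comp macc (@measurable_snd _ _ R R)).
have mrun f h k : mfT f -> mfT h -> (forall s, 0 <= h s) ->
    mfT (fun z => if acc z then f z * circle_run acc tau h z k else 0).
  move=> mf mh h0; apply: measurable_fun_ifT => //; apply: emeasurable_funM => //.
  apply: (@measurable_circle_run _ _ R tau (fun=> acc) (fun=> h) id) => //.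
  exact: (measurableT_comp mh (@measurable_snd _ _ R R)).
have MCT f h H : mfT f -> (forall s, 0 <= f s) -> (forall s, f s \is a fin_num) ->
    mfT h -> (forall s, 0 <= h s) ->
    (forall z, acc z -> f z * circle_lim acc tau h z = H z) ->
    \int[mu]_(z in `[l, (l + tau)%R]) (if acc z then f z * circle_run acc tau h z k else 0)
      @[k --> \oo] --> \int[mu]_(z in `[l, (l + tau)%R]) (if acc z then H z else 0).
  move=> mf f0 ff mh h0 hE.
  rewrite (_ : \int[mu]_(z in _) (if _ then H z else 0) =
    \int[mu]_(z in `[l, (l + tau)%R]) limn
      ((fun k z => if acc z then f z * circle_run acc tau h z k else 0)^~ z)); last first.
    apply: eq_integral => z _; apply/esym/cvg_lim => //.
    case: ifP => [az|_]; last exact: cvg_cst.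
    by rewrite -hE//; apply: cvgeZl => //; exact: circle_run_cvg.
  apply: (@cvg_monotone_convergence _ _ _ mu `[l, (l + tau)%R] _
    (fun k z => if acc z then f z * circle_run acc tau h z k else 0)) => //.
  - by move=> k; apply: measurable_funTS; exact: mrun.
  - by move=> k z _; case: ifP => // _; rewrite mule_ge0// circle_run_ge0.
  - move=> z _ i j ij; case: ifP => // _; apply: lee_wpmul2l => //.
    exact: circle_run_nd.
have L1 := MCT (fun=> 1) g (circle_lim acc tau g) m1 p1 (fun=> isT) mg g0 (fun z _ => mul1e _).
have L2 := MCT g (fun=> 1) g mg g0 gfin m1 p1.
rewrite -(cvg_lim _ L1)//.
under eq_fun do rewrite (@circle_run_sym _ _ _ l macc tau0 per _ _ _ m1 p1 mg g0 (fun=> erefl) pg).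
apply/cvg_lim => //; apply: L2 => z az.
have [e e0 ae] := oacc z az.
by rewrite (@circle_lim1 _ _ _ macc tau0 per z e)// mule1.
Qed.

Lemma sphintD n (f g : 'rV[R]_n -> \bar R) :
  mfT f -> (forall x, 0 <= f x) ->
  mfT g -> (forall x, 0 <= g x) ->
  sphint (fun x => f x + g x) = sphint f + sphint g.
Proof.
move=> mf f0 mg g0.
rewrite (sphintE mf f0) (sphintE mg g0) -ge0_integralD//.
by apply: (sphintE (f := fun x => f x + g x)); [exact: emeasurable_funD|move=> x; exact: adde_ge0].
Qed.

Lemma bundle_leb_swap n (G : R -> 'rV[R]_n.+1 -> 'rV[R]_n.+1 -> \bar R) :
  mfT (fun z : R * ('rV[R]_n.+1 * 'rV[R]_n.+1) => G z.1 z.2.1 z.2.2) ->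
  (forall t x v, 0 <= G t x v) ->
  \int[mu]_t bundle_int (G t) = bundle_int (fun x v => \int[mu]_t G t x v).
Proof.
move=> mG G0; rewrite /bundle_int.
have m1 : mfT (fun w : R * 'rV[R]_n.+1 => w.2) by exact: measurable_snd.
rewrite (sphint_leb_swap (F := fun t x => sphint (fun v => G t x (tangent x v)))).
- congr sphint; apply/funext => x; rewrite (sphint_leb_swap (F := fun t v => G t x (tangent x v)))//.
  apply: (measurableT_comp (g := fun w : R * 'rV[R]_n => (w.1, (x, tangent x w.2))) mG).
  apply: measurable_fun_pair; first exact: measurable_fst.
  apply: measurable_fun_pair => //.
  by apply: measurable_tangent => //; exact: measurable_snd.
- apply: (@measurable_fibre_int _ _ (R * 'rV[R]_n.+1)%type _ (fun w => G w.1) snd) => //.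
  apply: (measurableT_comp (g := fun w : (R * 'rV[R]_n.+1) * ('rV[R]_n.+1 * 'rV[R]_n.+1) =>
    (w.1.1, w.2)) mG).
  apply: measurable_fun_pair; last exact: measurable_snd.
  exact: (measurableT_comp (@measurable_fst _ _ R 'rV[R]_n.+1) (@measurable_fst _ _ _ _)).
- by move=> t x; exact: sphint_ge0.
Qed.

Lemma integral_symmetric_itv (a : R) f : (0 < a)%R ->
  mfT f -> (forall s, 0 <= f s) ->
  \int[mu]_(t in `[(- a)%R, a]) f t =
  \int[mu]_(t in `]0%R, a[) f t + \int[mu]_(t in `]0%R, a[) f (- t)%R.
Proof.
move=> a0 mf f0.
have mI (u v : R) : mfT (fun s : R => if (u <= s < v)%R then f s else 0).
  apply: measurable_fun_ifT => //.
  by apply: measurable_and; [exact: measurable_fun_ler|exact: measurable_fun_ltr].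
have mI' (u v : R) : mfT (fun s : R => if (u < s < v)%R then f s else 0).
  by apply: measurable_fun_ifT => //; apply: measurable_and; exact: measurable_fun_ltr.
have I0 (u v s : R) : 0 <= (if (u <= s < v)%R then f s else 0) by case: ifP.
have pos : \int[mu]_(t in `]0%R, a[) f t = \int[mu]_t (if (0 <= t < a)%R then f t else 0).
  by rewrite -(integral_itv_coE 0 a mf) (@integral_itv_bndoo _ 0 a f true false)//; exact: measurable_funTS.
have neg : \int[mu]_(t in `]0%R, a[) f (- t)%R = \int[mu]_t (if (- a <= t < 0)%R then f t else 0).
  rewrite -(integral_itv_coE (- a) 0 mf) (@integral_itv_bndoo _ (- a) 0 f true false)//; last first.
    exact: measurable_funTS.
  rewrite (integral_itv_ooE 0 a (fun t : R => f (- t)%R)) (integral_itv_ooE (- a) 0 f).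
  rewrite -(integral_lebN (mI' _ _)); last by move=> s; case: ifP.
  by apply: eq_integral => t _; rewrite ltrN2 oppr_lt0 andbC.
rewrite pos neg -ge0_integralD//; [|exact: mI|exact: mI].
rewrite (integral_itv_coE (- a) a mf); apply: eq_integral => t _.
have [t0|t0] := leP 0%R t.
  by rewrite andbF adde0 (le_trans _ t0)// oppr_le0 ltW.
by rewrite andbT add0e (lt_trans t0 a0) andbT.
Qed.

Section full_flow.
Variable n : nat.
Local Notation V := 'rV[R]_n.+2.
Variable (F : V -> V -> \bar R).
Hypothesis mF : mfT (fun z : V * V => F z.1 z.2).
Hypothesis F0 : forall x v, 0 <= F x v.

Lemma geodN (x v : V) t : geod x v (- t) = geod x (- v) t.
Proof. by rewrite /geod cosN sinN scaleNr scalerN. Qed.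

Lemma dgeodN (x v : V) t : dgeod x v (- t) = (- dgeod x (- v) t)%R.
Proof. by rewrite /dgeod cosN sinN opprK opprD scalerN !scaleNr !opprK. Qed.

Lemma bundle_intN : bundle_int (fun x v => F x (- v)%R) = bundle_int F.
Proof.
rewrite /bundle_int; congr sphint; apply/funext => x.
under eq_fun do rewrite -tangentN.
apply: (sphintN (F := fun v => F x (tangent x v))) => //.
by apply: (measurable_comp_F mF) => //; exact: measurable_tangent.
Qed.

Lemma measurable_flow d (T : measurableType d) (x v : T -> V) (t : T -> R) :
  mfT x -> mfT v -> mfT t ->
  mfT (fun w => F (geod (x w) (v w) (t w)) (dgeod (x w) (v w) (t w))).
Proof.
by move=> mx mv mt; apply: (measurable_comp_F mF); [exact: measurable_geod|exact: measurable_dgeod].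
Qed.

(** Negative times are positive times with the velocity reversed, and reversal preserves
    [bundle_int], so each half of the turn contributes a factor [pi]. An average over a full turn
    suffices later; invariance at each single time is not asserted. *)
Lemma full_flow :
  bundle_int (fun x v => \int[mu]_(t in `[(- pi)%R, pi]) F (geod x v t) (dgeod x v t)) =
  (2 * pi)%:E * bundle_int F.
Proof.
pose E (t : R) (x v : V) := if (0 < t < pi)%R then F (geod x v t) (dgeod x v t) else 0.
pose E' (t : R) (x v : V) :=
  if (0 < t < pi)%R then F (geod x v (- t)) (dgeod x v (- t)) else 0.
have m1 : mfT (fun w : R * (V * V) => w.1) by exact: measurable_fst.
have m2 : mfT (fun w : R * (V * V) => w.2.1).
  exact: (measurableT_comp (@measurable_fst _ _ V V) (@measurable_snd _ _ _ _)).
have m3 : mfT (fun w : R * (V * V) => w.2.2).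
  exact: (measurableT_comp (@measurable_snd _ _ V V) (@measurable_snd _ _ _ _)).
have mI : mfT (fun w : R * (V * V) => (0 < w.1 < pi)%R).
  by apply: measurable_and; exact: measurable_fun_ltr.
have mE : mfT (fun w : R * (V * V) => E w.1 w.2.1 w.2.2).
  by apply: measurable_fun_ifT => //; exact: measurable_flow.
have mE' : mfT (fun w : R * (V * V) => E' w.1 w.2.1 w.2.2).
  by apply: measurable_fun_ifT => //; apply: measurable_flow => //; exact: measurableT_comp m1.
have E0 t x v : 0 <= E t x v by rewrite /E; case: ifP.
have E'0 t x v : 0 <= E' t x v by rewrite /E'; case: ifP.
have mfib G : (forall t x v, 0 <= G t x v) ->
    mfT (fun w : R * (V * V) => G w.1 w.2.1 w.2.2) ->
    mfT (fun z : V * V => \int[mu]_t G t z.1 z.2).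
  move=> G0 mG.
  apply: (@measurable_integral_leb _ _ _ (fun (z : V * V) (t : R) => G t z.1 z.2)) => //.
  exact: (measurable_uncurry_swap (f := fun t (z : V * V) => G t z.1 z.2)).
have mA := mfib _ E0 mE; have mB := mfib _ E'0 mE'.
pose A x v := \int[mu]_t E t x v; pose B x v := \int[mu]_t E' t x v.
have A0 x v : 0 <= A x v by exact: integral_ge0.
have B0 x v : 0 <= B x v by exact: integral_ge0.
transitivity (bundle_int A + bundle_int B).
  have mbun G : (forall x v, 0 <= G x v) ->
      mfT (fun z : V * V => G z.1 z.2) ->
      mfT (fun x => sphint (fun v => G x (tangent x v))).
    move=> G0 mG; apply: (@measurable_fibre_int _ _ _ _ (fun _ => G) id) => //.
    exact: (measurableT_comp mG (@measurable_snd _ _ _ _)).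
  have mtg G x : mfT (fun z : V * V => G z.1 z.2) ->
      mfT (fun v => G x (tangent x v) : \bar R).
    by move=> mG; apply: (measurable_comp_F mG) => //; exact: measurable_tangent.
  rewrite /bundle_int -(sphintD (mbun _ A0 mA) _ (mbun _ B0 mB)); last 2 first.
  - by move=> x; exact: sphint_ge0.
  - by move=> x; exact: sphint_ge0.
  congr sphint; apply/funext => x.
  rewrite -(sphintD (mtg _ x mA) _ (mtg _ x mB))//.
  congr sphint; apply/funext => v.
  rewrite (integral_symmetric_itv (pi_gt0 R) (f := fun t => F (geod x (tangent x v) t) (dgeod x (tangent x v) t)))//.
    by rewrite !integral_itv_ooE.
  exact: measurable_flow.
rewrite /A /B -(bundle_leb_swap mE E0) -(bundle_leb_swap mE' E'0).
have flow0 G : mfT (fun z : V * V => G z.1 z.2) ->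
    (forall x v, 0 <= G x v) ->
    \int[mu]_t bundle_int (fun x v => if (0 < t < pi)%R then G (geod x v t) (dgeod x v t) else 0) =
    pi%:E * bundle_int G.
  move=> mG G0; rewrite -(half_flow mG G0) integral_itv_ooE; apply: eq_integral => t _.
  case: ifP => // _; rewrite /bundle_int.
  have z0 k : sphint (fun _ : 'rV[R]_k => 0) = 0 by rewrite sphintE// integral0.
  by rewrite (_ : (fun x => _) = fun=> 0) ?z0//; apply/funext => x; rewrite z0.
transitivity (pi%:E * bundle_int F + pi%:E * bundle_int F); last first.
  by rewrite -ge0_muleDl ?lee_fin ?pi_ge0// -EFinD -mulr2n mulr_natl.
apply: (congr2 (fun a b : \bar R => a + b)); first exact: (flow0 F mF F0).
have mFN : mfT (fun z : V * V => F z.1 (- z.2)%R).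
  apply: (measurable_comp_F mF); first exact: measurable_fst.
  by apply: (measurableT_comp (@measurable_rVN _ _)); exact: measurable_snd.
transitivity (pi%:E * bundle_int (fun x v => F x (- v)%R)); last by rewrite bundle_intN.
rewrite -(flow0 _ mFN (fun x v => F0 x (- v)%R)).
apply: eq_integral => t _; rewrite /bundle_int; congr sphint; apply/funext => x.
have mK : mfT (fun v => if (0 < t < pi)%R then
    F (geod x (tangent x v) t) (- dgeod x (tangent x v) t)%R else 0).
  case: (0 < t < pi)%R => //; apply: (measurable_comp_F (F := fun x v => F x (- v)%R) mFN
    (x := fun v => geod x (tangent x v) t) (v := fun v => dgeod x (tangent x v) t)).
    by apply: measurable_geod => //; exact: measurable_tangent.
  by apply: measurable_dgeod => //; exact: measurable_tangent.
rewrite -(sphintN mK); last by move=> v; case: ifP.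
congr sphint; apply/funext => v; rewrite /E'; case: ifP => // _.
by rewrite geodN dgeodN tangentN.
Qed.

End full_flow.
End circle_stationary.

(** * The slice sampling kernel *)

Section geodesics.
Variable R : realType.

Lemma cosD2piz (a : R) (z : int) : cos (a + 2 * pi * z%:~R) = cos a.
Proof.
have E k : 2 * pi * k%:R = (pi *+ 2) *+ k :> R by rewrite -[pi *+ 2]mulr_natl mulr_natr.
case: z => k; first by rewrite -pmulrn E periodicn//; exact: cosD2pi.
rewrite NegzE mulrNz mulrN -pmulrn E -(periodicn (@cosD2pi R) k.+1 (a - _)).
by rewrite subrK.
Qed.

Lemma sinD2piz (a : R) (z : int) : sin (a + 2 * pi * z%:~R) = sin a.
Proof.
have E k : 2 * pi * k%:R = (pi *+ 2) *+ k :> R by rewrite -[pi *+ 2]mulr_natl mulr_natr.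
case: z => k; first by rewrite -pmulrn E periodicn//; exact: sinD2pi.
rewrite NegzE mulrNz mulrN -pmulrn E -(periodicn (@sinD2pi R) k.+1 (a - _)).
by rewrite subrK.
Qed.

Lemma geod_mod2pi n (x v : 'rV[R]_n) (t : R) : geod x v (mod2pi t) = geod x v t.
Proof. by rewrite /geod /mod2pi -mulrN -mulrNz cosD2piz sinD2piz. Qed.

Lemma geodD2pi n (x v : 'rV[R]_n) (t : R) : geod x v (t + 2 * pi) = geod x v t.
Proof. by have := cosD2piz t 1; have := sinD2piz t 1; rewrite mulr1 /geod => -> ->. Qed.

Lemma geod0 n (x v : 'rV[R]_n) : geod x v 0 = x.
Proof. by rewrite /geod cos0 sin0 scale1r scale0r addr0. Qed.

Lemma dotv_geodD n (x v : 'rV[R]_n) (s t : R) : sphere n x -> sphere n v -> dotv x v = 0 ->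
  dotv (geod x v s) (geod x v t) = cos (t - s).
Proof.
move=> x1 v1 xv; rewrite /geod dotvDl !dotvDr !dotvZl !dotvZr x1 v1 (dotvC v x) xv.
by rewrite cosB; ring.
Qed.

Lemma sphere_geod n (x v : 'rV[R]_n) (t : R) : sphere n x -> sphere n v -> dotv x v = 0 ->
  sphere n (geod x v t).
Proof. by move=> x1 v1 xv; rewrite /sphere/= dotv_geodD// subrr cos0. Qed.

Lemma geod_flow n (x v : 'rV[R]_n) (s t : R) :
  geod (geod x v s) (dgeod x v s) t = geod x v (s + t).
Proof.
rewrite /geod /dgeod cosD sinD; apply/rowP => i; rewrite !mxE.
by move: (cos s) (sin s) (cos t) (sin t) => a b c d; ring.
Qed.

Lemma geod_dist n (x v : 'rV[R]_n) (s t : R) : sphere n x -> sphere n v -> dotv x v = 0 ->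
  enorm (geod x v s - geod x v t) = Num.sqrt (2 - 2 * cos (t - s)).
Proof.
move=> x1 v1 xv; rewrite /enorm; congr Num.sqrt.
have : dotv (geod x v s) (geod x v s) = 1 by exact: sphere_geod.
have : dotv (geod x v t) (geod x v t) = 1 by exact: sphere_geod.
have := dotv_geodD s t x1 v1 xv.
move: (geod x v s) (geod x v t) (cos _) => a b c abc bb aa.
rewrite -scaleN1r dotvDl !dotvDr !dotvZl !dotvZr (dotvC b a) abc bb aa.
by ring.
Qed.

Lemma geod_continuous n (x v : 'rV[R]_n) (t e : R) : sphere n x -> sphere n v -> dotv x v = 0 ->
  0 < e -> exists2 d, 0 < d & forall s, t - d < s < t + d -> enorm (geod x v s - geod x v t) < e.
Proof.
move=> x1 v1 xv e0.
have e2 : 0 < e ^+ 2 / 2 by rewrite divr_gt0// exprn_gt0.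
have /cvgrPdist_lt /(_ _ e2) := @continuous_cos R 0.
rewrite cos0 => -[d /= d0 dP]; exists d => // s /andP[ds sd].
rewrite geod_dist// -[e in ltRHS]ger0_norm ?ltW// -sqrtr_sqr ltr_sqrt ?exprn_gt0//.
have {}dP : `|1 - cos (t - s)| < e ^+ 2 / 2.
  apply: dP; rewrite /= sub0r normrN ltr_norml.
  by apply/andP; split; [rewrite ltrBrDr addrC ltrBlDr|rewrite ltrBlDr -ltrBlDl].
have := ltr_normlW dP; rewrite ltr_pdivlMr// mulrBl mul1r.
by rewrite [in X in X -> _](mulrC (cos _)).
Qed.

End geodesics.

(** * A measurable form of the kernel *)

Section kernel.
Variables (R : realType) (n : nat) (p : 'rV[R]_n.+2 -> R).
Local Open Scope ereal_scope.
Local Notation mu := (@lebesgue_measure R).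
Local Notation V := ('rV[R]_n.+2).
Local Notation tau := (2 * pi : R)%R.

Lemma shrink_step_redraw (x v : V) t k a b th g :
  let acc s := (t < p (geod x v s))%R in
  let h s := g (mod2pi s) in
  shrink_step p x v t k a b th g =
  if acc th then h th else
  if (th < 0)%R then redraw acc h 0 k th b else redraw acc h 0 k a th.
Proof.
move=> acc h; elim: k a b th => [|k IH] a b th.
  by rewrite [LHS]/= -/(acc th); case: (acc th) => //; case: (th < 0)%R.
rewrite [LHS]/= -/(acc th); case: ifP => // _; case: ifP => _ /=; congr (_ * _).
  by apply: eq_integral => s _; exact: IH.
by apply: eq_integral => s _; exact: IH.
Qed.

Lemma tau_gt0 : (0 < tau)%R. Proof. by rewrite mulr_gt0// pi_gt0. Qed.

Lemma alpha_intE (x v : V) t (f : V -> \bar R) :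
  alpha_int p x v t (fun th => f (geod x v th)) =
  circle_lim (fun s => (t < p (geod x v s))%R) tau (fun s => f (geod x v s)) 0.
Proof.
rewrite /alpha_int /circle_lim.
suff -> : (fun k : nat => (tau^-1)%R%:E * \int[mu]_(s in `[0%R, tau])
      shrink_step p x v t k (s - tau)%R s s (fun th => f (geod x v th))) =
    circle_run (fun s => (t < p (geod x v s))%R) tau (fun s => f (geod x v s)) 0 by [].
apply/funext => k; rewrite /circle_run; congr (_ * _).
(* A first draw is nonnegative, so its rejection leaves the bracket [[s - tau, s]], as in
   [circle_run]. *)
apply: eq_integral => s; rewrite inE/= in_itv/= => /andP[s0 _].
rewrite shrink_step_redraw/= add0r (ltNge s) s0/=.
rewrite geod_mod2pi (_ : (fun s => f (geod x v (mod2pi s))) = (fun s => f (geod x v s)))//.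
by apply/funext => u; rewrite geod_mod2pi.
Qed.

(** The test for the sphere makes the level set measurable in the whole space, whatever [p] is
    elsewhere. *)
Definition in_level t (y : V) := (dotv y y == 1%R) && (t < p y)%R.

Definition shrink_int t (f : V -> \bar R) (x v : V) : \bar R :=
  circle_lim (fun s => in_level t (geod x v s)) tau (fun s => f (geod x v s)) 0.

Lemma alpha_int_shrink_int (x v : V) t (f g : V -> \bar R) :
  sphere n.+2 x -> sphere n.+2 v -> dotv x v = 0%R ->
  (forall y, sphere n.+2 y -> f y = g y) ->
  alpha_int p x v t (fun th => f (geod x v th)) = shrink_int t g x v.
Proof.
move=> x1 v1 xv fg; rewrite alpha_intE; apply: (congr2 (fun a h => circle_lim a tau h 0%R)); apply/funext => s.
  by have := sphere_geod s x1 v1 xv; rewrite /in_level /sphere/= => ->; rewrite eqxx.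
by apply: fg; exact: sphere_geod.
Qed.

Definition omega : R := sph_mass n.+1.

Definition kernelHt t (f : V -> \bar R) (x : V) : \bar R :=
  (omega^-1)%:E * sphint (fun v => shrink_int t f x (tangent x v)).

(** A copy of [H_op] with measurable ingredients: [tangent] for the chosen isometry, [in_level] for
    the acceptance test, and the value [0] off the sphere. *)
Definition kernelH (f : V -> \bar R) (x : V) : \bar R :=
  if dotv x x == 1%R then
    ((p x)^-1)%:E * \int[mu]_t (if (0 < t < p x)%R then kernelHt t f x else 0)
  else 0.

Lemma omega_ge0 : (0 <= omega)%R.
Proof. by apply: fine_ge0; apply: sphint_ge0 => _; exact: lee01. Qed.

Lemma sphere_tangent (x : V) (v : 'rV[R]_n.+1) : sphere n.+1 v -> sphere n.+2 (tangent x v).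
Proof. by rewrite /sphere/= dotv_tangent. Qed.

Lemma open_enorm_ball (x : V) (e : R) : open [set y | (enorm (y - x) < e)%R].
Proof.
have c (m : seq 'I_n.+2) : continuous (fun y : V => \sum_(i <- m) (y - x) 0 i * (y - x) 0 i)%R.
  elim: m => [|i m IH] y.
    rewrite (_ : (fun y : V => _) = cst 0%R); first exact: cst_continuous.
    by apply/funext => z; rewrite big_nil.
  rewrite (_ : (fun y : V => _) = fun z => (z 0 i - x 0 i) * (z 0 i - x 0 i) +
    \sum_(j <- m) (z - x) 0 j * (z - x) 0 j)%R; last first.
    by apply/funext => z; rewrite big_cons; congr (_ * _ + _)%R; rewrite !mxE.
  have ci : {for y, continuous (fun z : V => z ord0 i - x ord0 i)%R}.
    exact: (@continuousB _ R^o V _ _ _ (@coord_continuous R 1 n.+2 ord0 i y) (@cst_continuous _ _ _ _)).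
  exact: (@continuousD _ R^o V _ _ _ (@continuousM _ V _ _ _ ci ci) (IH y)).
apply: (@open_comp _ _ (fun y => enorm (y - x)) [set r | (r < e)%R]); last exact: open_lt.
move=> y _; apply: (@continuous_comp _ _ _ (fun y => dotv (y - x) (y - x)) Num.sqrt).
  exact: c.
exact: sqrt_continuous.
Qed.

Hypothesis plsc : lsc_sph p.
Hypothesis p_gt0 : forall x, sphere n.+2 x -> (0 < p x)%R.

(** Lower semi-continuity enters the shrinkage procedure here: acceptance is an open condition along
    a great circle. *)
Lemma in_level_near (x v : V) t s : sphere n.+2 x -> sphere n.+2 v -> dotv x v = 0%R ->
  in_level t (geod x v s) ->
  exists2 e, (0 < e)%R & forall u, (s - e < u < s + e)%R -> in_level t (geod x v u).
Proof.
move=> x1 v1 xv /andP[_ ts].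
have gs := sphere_geod _ x1 v1 xv.
have [e e0 eP] := plsc (gs s) ts.
have [d d0 dP] := geod_continuous s x1 v1 xv e0.
exists d => // u /dP uE; apply/andP; split; first exact/eqP/gs.
by apply: eP => //; exact: gs.
Qed.

Lemma measurable_sphere d (T : measurableType d) (y : T -> V) : mfT y -> mfT (fun w => dotv (y w) (y w) == 1%R).
Proof. by move=> my; apply: measurable_fun_eqr => //; exact: measurable_dotv. Qed.

(* [p] is only controlled on the sphere, so it is cut off outside before its
   measurability is stated. *)
Let pS (y : V) : R := if dotv y y == 1%R then p y else 0%R.

(** For [a >= 0] the superlevel set is the sphere intersected with a union of open balls, possibly
    uncountable but open. For [a < 0] it is everything. *)
Lemma measurable_lsc : mfT pS.
Proof.
apply: (measurability _ (RGenOInfty.measurableE R)).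
move=> _ [_ [a ->] <-]; rewrite setTI.
have [a0|a0] := ltP a 0%R.
  rewrite (_ : pS @^-1` _ = setT); first exact: measurableT.
  apply/seteqP; split => // y _ /=; rewrite in_itv/= andbT /pS.
  by case: eqP => // y1; rewrite (lt_trans a0)// p_gt0.
pose D := [set w : V * R | [/\ sphere n.+2 w.1, (0 < w.2)%R &
  forall y, sphere n.+2 y -> (enorm (y - w.1) < w.2)%R -> (a < p y)%R]].
rewrite (_ : pS @^-1` _ = [set y | dotv y y == 1%R] `&`
    \bigcup_(w in D) [set y | (enorm (y - w.1) < w.2)%R]).
  apply: measurableI.
    by have := measurable_sphere (@measurable_id _ V setT) measurableT (Y := [set true]) I; rewrite setTI.
  apply: sub_sigma_algebra; apply: bigcup_open => w _; exact: open_enorm_ball.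
apply/seteqP; split => y /=; rewrite in_itv/= andbT /pS.
  case: eqP => [y1 ay|_]; last by rewrite ltNge a0.
  have [e e0 eP] := plsc y1 ay; split=> //.
  exists (y, e); first by split.
  rewrite /= subrr /enorm (_ : dotv _ _ = 0%R) ?sqrtr0//.
  by rewrite /dotv big1// => i _; rewrite mxE mul0r.
by move=> [/[dup] y1 -> [w [_ _ wP] yw]]; apply: wP => //; exact/eqP.
Qed.

Lemma measurable_pV : mfT (fun y => (pS y)^-1)%R.
Proof. exact: measurable_inv measurable_lsc. Qed.

Lemma measurable_in_level d (T : measurableType d) (t : T -> R) (y : T -> V) :
  mfT t -> mfT y -> mfT (fun w => in_level (t w) (y w)).
Proof.
move=> mt my.
rewrite (_ : (fun w => _) = (fun w => (dotv (y w) (y w) == 1%R) && (t w < pS (y w))%R)).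
  apply: measurable_and; first exact: measurable_sphere.
  by apply: measurable_fun_ltr => //; exact: (measurableT_comp measurable_lsc).
by apply/funext => w; rewrite /in_level /pS; case: ifP.
Qed.

Section operator.
Variable f : V -> \bar R.
Hypothesis mf : mfT f.
Hypothesis f0 : forall x, 0 <= f x.

Lemma shrink_int_ge0 t x v : 0 <= shrink_int t f x v.
Proof. by apply: circle_lim_ge0; [exact: tau_gt0|]. Qed.

Lemma measurable_shrink_int d (T : measurableType d) (t : T -> R) (x v : T -> V) :
  mfT t -> mfT x -> mfT v -> mfT (fun w => shrink_int (t w) f (x w) (v w)).
Proof.
move=> mt mx mv.
have mg : mfT (fun w : T * R => geod (x w.1) (v w.1) w.2).
  apply: measurable_geod; last exact: measurable_snd.
    exact: (measurableT_comp mx (@measurable_fst _ _ T R)).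
  exact: (measurableT_comp mv (@measurable_fst _ _ T R)).
apply: (@measurable_circle_lim _ _ _ tau (fun w s => in_level (t w) (geod (x w) (v w) s))
  (fun w s => f (geod (x w) (v w) s)) (fun=> 0%R)) => //.
- exact: tau_gt0.
- apply: measurable_in_level => //; exact: (measurableT_comp mt (@measurable_fst _ _ T R)).
- exact: (measurableT_comp mf mg).
Qed.

Lemma kernelHt_ge0 t x : 0 <= kernelHt t f x.
Proof.
rewrite mule_ge0 ?lee_fin ?invr_ge0 ?omega_ge0//.
by apply: sphint_ge0 => v; exact: shrink_int_ge0.
Qed.

Lemma measurable_kernelHt d (T : measurableType d) (t : T -> R) (x : T -> V) :
  mfT t -> mfT x -> mfT (fun w => kernelHt (t w) f (x w)).
Proof.
move=> mt mx; apply: emeasurable_funM => //.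
apply: (@measurable_sphint _ _ _ _ (fun w v => shrink_int (t w) f (x w) (tangent (x w) v))) => [|w v]; last first.
  exact: shrink_int_ge0.
have mx1 : mfT (fun w : T * 'rV[R]_n.+1 => x w.1).
  exact: (measurableT_comp mx (@measurable_fst _ _ T 'rV[R]_n.+1)).
apply: measurable_shrink_int => //.
  exact: (measurableT_comp mt (@measurable_fst _ _ T 'rV[R]_n.+1)).
by apply: measurable_tangent => //; exact: measurable_snd.
Qed.

Lemma measurable_kernelH_integrand :
  mfT (fun w : V * R => if (0 < w.2 < pS w.1)%R then kernelHt w.2 f w.1 else 0).
Proof.
have m2 : mfT (@snd V R) by exact: measurable_snd.
apply: measurable_fun_ifT => //.
  apply: measurable_and; apply: measurable_fun_ltr => //.
  exact: (measurableT_comp measurable_lsc (@measurable_fst _ _ V R)).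
by apply: measurable_kernelHt => //; exact: measurable_fst.
Qed.

Lemma kernelH_ge0 x : 0 <= kernelH f x.
Proof.
rewrite /kernelH; case: eqP => // x1; apply: mule_ge0; first by rewrite lee_fin invr_ge0 ltW//; exact: p_gt0.
by apply: integral_ge0 => t _; case: ifP => // _; exact: kernelHt_ge0.
Qed.

Lemma measurable_kernelH : mfT (kernelH f).
Proof.
rewrite (_ : kernelH f = fun x => if dotv x x == 1%R then
    ((pS x)^-1)%:E * \int[mu]_t (if (0 < t < pS x)%R then kernelHt t f x else 0) else 0).
  apply: measurable_fun_ifT => //; first exact: measurable_sphere.
  apply: emeasurable_funM; first by apply/measurable_EFinP; exact: measurable_pV.
  apply: (@measurable_integral_leb _ _ _ (fun (x : V) (t : R) =>
    if (0 < t < pS x)%R then kernelHt t f x else 0)); first exact: measurable_kernelH_integrand.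
  by move=> x t; case: ifP => // _; exact: kernelHt_ge0.
by apply/funext => x; rewrite /kernelH /pS; case: ifP.
Qed.

Lemma Ht_intE (g : V -> \bar R) t x : sphere n.+2 x -> (forall y, sphere n.+2 y -> g y = f y) ->
  Ht_int p x t g = kernelHt t f x.
Proof.
move=> x1 gf; apply: (congr1 (fun z => (omega^-1)%:E * z)).
have [UU Ux] : perp_isom x (Uperp x).
  apply: (@xgetPex _ 0%R [set M | perp_isom x M]).
  by exists (row' ord0 (mirror x)); exact: perp_isom_mirror.
have mP : mfT (shrink_int t f x) by exact: measurable_shrink_int.
transitivity (subsph_int x (shrink_int t f x)); last exact: (subsph_intE x1 mP (shrink_int_ge0 t x)).
apply: eq_sphint => v v1; apply: alpha_int_shrink_int => //.
- by rewrite /sphere/= dotv_orth.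
- rewrite dotvC dotvE -mulmxA.
  by rewrite (_ : Uperp x *m x^T = 0%R) ?mulmx0 ?mxE//.
Qed.

(** Agreement on the sphere is enough, so that along the iteration an iterate of [H_op] can be
    replaced by a function measurable on the whole space. *)
Lemma H_opE (g : V -> \bar R) x : sphere n.+2 x -> (forall y, sphere n.+2 y -> g y = f y) ->
  H_op p g x = kernelH f x.
Proof.
move=> x1 gf; rewrite /H_op /kernelH (_ : dotv x x == 1%R)//; last exact/eqP.
congr (_ * _).
transitivity (\int[mu]_(t in `]0%R, p x[) kernelHt t f x).
  by apply: eq_integral => t _; exact: Ht_intE.
exact: integral_itv_ooE.
Qed.

End operator.
End kernel.

(** * Stationarity of the kernel *)

Section stationarity.
Variables (R : realType) (n : nat) (p : 'rV[R]_n.+2 -> R).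
Local Open Scope ereal_scope.
Local Notation mu := (@lebesgue_measure R).
Local Notation V := ('rV[R]_n.+2).
Local Notation tau := (2 * pi : R)%R.
Local Notation omega := (omega R n).
Hypothesis plsc : lsc_sph p.
Hypothesis p_gt0 : forall x, sphere n.+2 x -> (0 < p x)%R.
Hypothesis omega_gt0 : (0 < omega)%R.

Lemma pmule_inj (c : R) (a b : \bar R) : (0 < c)%R -> c%:E * a = c%:E * b -> a = b.
Proof.
move=> c0 E; have c1 : 1 = (c^-1)%:E * c%:E by rewrite -EFinM mulVf// gt_eqF.
by rewrite -[a]mul1e -[b]mul1e c1 -!muleA E.
Qed.

Lemma omegaE : sphint (fun _ : 'rV[R]_n.+1 => 1) = omega%:E.
Proof.
rewrite /omega /sph_mass fineK// fin_numE; apply/andP; split.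
  rewrite gt_eqF// (lt_le_trans ltNy0)//; apply: sphint_ge0 => _; exact: lee01.
have s1 : sphint (fun _ : 'rV[R]_n.+1 => 1) = sig R n.+1 setT.
  by rewrite (sphintE (f := fun=> 1))// integral_cst//= mul1e.
by rewrite lt_eqF// s1; exact: sig_fin.
Qed.

Lemma measurable_in_level1 t : mfT (fun y : V => in_level p t y).
Proof. exact: (measurable_in_level plsc p_gt0). Qed.

Lemma level_acc (x w : V) t : sphere n.+2 x -> sphere n.+2 w -> dotv x w = 0%R ->
  let acc s := in_level p t (geod x w s) in
  [/\ mfT acc, (forall s, acc (s + tau)%R = acc s) &
   forall z, acc z -> exists2 e, (0 < e)%R & forall s, (z - e < s < z + e)%R -> acc s].
Proof.
move=> x1 w1 xw acc; split.
- by apply: (measurable_in_level plsc p_gt0) => //; exact: measurable_geod.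
- by move=> s; rewrite /acc geodD2pi.
- by move=> z; exact: in_level_near.
Qed.

Section level.
Variables (t : R) (f : V -> \bar R).
Hypothesis mf : mfT f.
Hypothesis f0 : forall x, 0 <= f x.
Hypothesis ffin : forall x, f x \is a fin_num.

Let F1 (x v : V) : \bar R := if in_level p t x then shrink_int p t f x v else 0.
Let F2 (x v : V) : \bar R := if in_level p t x then f x else 0.

Let F1_ge0 x v : 0 <= F1 x v.
Proof. by rewrite /F1; case: ifP => // _; exact: shrink_int_ge0. Qed.

Let F2_ge0 x v : 0 <= F2 x v.
Proof. by rewrite /F2; case: ifP. Qed.

Let mlvl d (T : measurableType d) (y : T -> V) : mfT y -> mfT (fun w => in_level p t (y w)).
Proof. by move=> my; apply: (measurable_in_level plsc p_gt0). Qed.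

Let mF1 : mfT (fun z : V * V => F1 z.1 z.2).
Proof.
have m1 : mfT (@fst V V) by exact: measurable_fst.
apply: measurable_fun_ifT => //; first exact: mlvl.
by apply: (measurable_shrink_int plsc p_gt0 mf f0) => //; exact: measurable_snd.
Qed.

Let mF2 : mfT (fun z : V * V => F2 z.1 z.2).
Proof.
have m1 : mfT (@fst V V) by exact: measurable_fst.
by apply: measurable_fun_ifT => //; [exact: mlvl|exact: (measurableT_comp mf m1)].
Qed.

Let flow_shrink_int (x w : V) s : shrink_int p t f (geod x w s) (dgeod x w s) =
  circle_lim (fun u => in_level p t (geod x w u)) tau (fun u => f (geod x w u)) s.
Proof.
have macc : mfT (fun u => in_level p t (geod x w u)).
  by apply: mlvl; exact: measurable_geod.
have mg : mfT (fun u => f (geod x w u)).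
  by apply: (measurableT_comp mf); exact: measurable_geod.
have := @circle_lim_shift R _ tau _ s 0%R macc mg (fun u => f0 _).
rewrite addr0 => <-; rewrite /shrink_int.
by apply: (congr2 (fun a h => circle_lim a tau h 0%R)); apply/funext => u; rewrite geod_flow.
Qed.

(* The flow preserves the integral over unit tangent vectors, so that a function
   may be replaced by its average along geodesics, where [circle_lim_stationary]
   applies. *)
Lemma bundle_stationary : bundle_int F1 = bundle_int F2.
Proof.
have E1 := full_flow mF1 F1_ge0; have E2 := full_flow mF2 F2_ge0.
suff E : (2 * pi)%:E * bundle_int F1 = (2 * pi)%:E * bundle_int F2.
  exact: (pmule_inj (tau_gt0 R) E).
apply: (etrans (esym E1)); apply: (etrans _ E2).
apply: eq_sphint => x x1; apply: eq_sphint => v v1.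
have w1 := sphere_tangent x v1; have xw := dotv_x_tangent v x1.
have [macc per oacc] := level_acc t x1 w1 xw.
have piE : (- pi + tau = pi :> R)%R by ring.
have mg : mfT (fun u => f (geod x (tangent x v) u)).
  by apply: (measurableT_comp mf); exact: measurable_geod.
have := @circle_lim_stationary R _ tau (- pi)%R _ macc (tau_gt0 R) per oacc mg
  (fun u => f0 _) (fun u => ffin _).
rewrite piE => H; rewrite -[RHS]H; last by move=> s; rewrite geodD2pi.
by apply: eq_integral => s _; rewrite /F1 flow_shrink_int.
Qed.

Lemma level_stationary :
  sphint (fun x => if in_level p t x then kernelHt p t f x else 0) =
  sphint (fun x => if in_level p t x then f x else 0).
Proof.
have V0 : (0 <= omega^-1)%R by rewrite invr_ge0 ltW.
transitivity ((omega^-1)%:E * bundle_int F1).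
  have mB : mfT (fun x => sphint (fun v => F1 x (tangent x v))).
    apply: (@measurable_fibre_int _ _ _ _ (fun _ => F1) id) => //.
    exact: (measurableT_comp mF1 (@measurable_snd _ _ _ _)).
  rewrite /bundle_int -(sphintZl V0 mB); last by move=> x; exact: sphint_ge0.
  congr sphint; apply/funext => x; rewrite /F1; case: ifP => [_|_]; first by [].
  by rewrite (sphintE (f := fun=> 0))// integral0 mule0.
rewrite bundle_stationary.
have mG : mfT (fun x => if in_level p t x then f x else 0).
  by apply: measurable_fun_ifT => //; exact: mlvl.
have G0 x : 0 <= (if in_level p t x then f x else 0) by case: ifP.
(* [F2] does not depend on the direction, and the directions have total mass [omega]. *)
transitivity ((omega^-1)%:E * (omega%:E * sphint (fun x => if in_level p t x then f x else 0))).
  congr (_ * _); rewrite -(sphintZl (ltW omega_gt0) mG G0).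
  congr sphint; apply/funext => x; rewrite /F2 -omegaE.
  have x0 : 0 <= (if in_level p t x then f x else 0) by [].
  have xfin : (if in_level p t x then f x else 0) \is a fin_num by case: ifP.
  rewrite -(fineK xfin) muleC -(sphintZl (fine_ge0 x0) (f := fun=> 1))//.
  by congr sphint; apply/funext => v; rewrite mule1.
by rewrite muleA -EFinM mulVf ?gt_eqF// mul1e.
Qed.

End level.

Lemma integral_level (x : V) (c : \bar R) : sphere n.+2 x -> 0 <= c ->
  \int[mu]_t (if (0 < t < p x)%R then c else 0) = (p x)%:E * c.
Proof.
move=> x1 c0; rewrite -integral_itv_ooE integral_cst//= muleC lebesgue_measure_itv/= lte_fin p_gt0//.
by rewrite oppr0 adde0.
Qed.

(** The weight [p x] cancels the normalisation [(p x)^-1] of the level average. After Tonelli the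
    level [t] is outermost, and each level is stationary by itself. *)
Lemma kernelH_stationary (f : V -> \bar R) : mfT f -> (forall x, 0 <= f x) ->
  (forall x, f x \is a fin_num) ->
  sphint (fun x => (p x)%:E * kernelH p f x) = sphint (fun x => (p x)%:E * f x).
Proof.
move=> mf f0 ffin.
pose A (h : R -> V -> \bar R) t x := if (0 < t)%R && in_level p t x then h t x else 0.
have mA h : mfT (fun z : R * V => h z.1 z.2) ->
    mfT (fun z : R * V => A h z.1 z.2).
  move=> mh; apply: measurable_fun_ifT => //; apply: measurable_and.
    by apply: measurable_fun_ltr => //; exact: measurable_fst.
  by apply: (measurable_in_level plsc p_gt0); [exact: measurable_fst|exact: measurable_snd].
have A0 h : (forall t x, 0 <= h t x) -> forall t x, 0 <= A h t x.
  by move=> h0 t x; rewrite /A; case: ifP.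
have AE h x : sphere n.+2 x ->
    \int[mu]_t A h t x = \int[mu]_t (if (0 < t < p x)%R then h t x else 0).
  by rewrite /sphere/= => x1; apply: eq_integral => t _; rewrite /A /in_level x1 eqxx.
have mK : mfT (fun z : R * V => kernelHt p z.1 f z.2).
  by apply: (measurable_kernelHt plsc p_gt0 mf f0); [exact: measurable_fst|exact: measurable_snd].
have K0 t x : 0 <= kernelHt p t f x by exact: kernelHt_ge0.
have mf2 : mfT (fun z : R * V => f z.2).
  exact: (measurableT_comp mf (@measurable_snd _ _ R V)).
transitivity (sphint (fun x => \int[mu]_t A (fun t => kernelHt p t f) t x)).
  apply: eq_sphint => x x1; rewrite AE// /kernelH.
  rewrite (_ : dotv x x == 1%R); last exact/eqP.
  by rewrite muleA -EFinM mulfV ?gt_eqF ?p_gt0// mul1e.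
rewrite -(sphint_leb_swap (mA _ mK) (A0 _ K0)).
transitivity (\int[mu]_t sphint (A (fun _ => f) t)).
  apply: eq_integral => t _; rewrite /A.
  have [t0|t0] := ltP 0%R t; last by [].
  exact: level_stationary.
rewrite (sphint_leb_swap (mA (fun _ => f) mf2) (A0 (fun _ => f) (fun _ => f0))).
by apply: eq_sphint => x x1; rewrite AE// integral_level.
Qed.

End stationarity.

(** * Minorization and contraction *)

Section minorization.
Variables (R : realType) (n : nat) (p : 'rV[R]_n.+2 -> R).
Local Open Scope ereal_scope.
Local Notation mu := (@lebesgue_measure R).
Local Notation V := ('rV[R]_n.+2).
Local Notation tau := (2 * pi : R)%R.
Local Notation omega := (omega R n).
Hypothesis plsc : lsc_sph p.
Hypothesis p_gt0 : forall x, sphere n.+2 x -> (0 < p x)%R.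
Hypothesis omega_gt0 : (0 < omega)%R.

Lemma le_sphint m (f g : 'rV[R]_m -> \bar R) :
  mfT f -> (forall x, 0 <= f x) ->
  mfT g -> (forall x, f x <= g x) -> sphint f <= sphint g.
Proof.
move=> mf f0 mg fg; have g0 x : 0 <= g x by exact: le_trans (fg x).
by rewrite (sphintE mf f0) (sphintE mg g0); apply: ge0_le_integral.
Qed.

Section linear.
Variables (c : R) (f g : V -> \bar R).
Hypotheses (c0 : (0 <= c)%R).
Hypotheses (mf : mfT f) (f0 : forall x, 0 <= f x).
Hypotheses (mg : mfT g) (g0 : forall x, 0 <= g x).

Let mgeod h (x v : V) : mfT h -> mfT (fun s => h (geod x v s) : \bar R).
Proof. by move=> mh; apply: (measurableT_comp mh); exact: measurable_geod. Qed.

Lemma shrink_int_lin t x v :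
  shrink_int p t (fun y => c%:E * f y + g y) x v = c%:E * shrink_int p t f x v + shrink_int p t g x v.
Proof.
have macc : mfT (fun s => in_level p t (geod x v s)).
  by apply: (measurable_in_level plsc p_gt0) => //; exact: measurable_geod.
exact: (circle_lim_lin macc (tau_gt0 R) 0%R c0 (mgeod x v mf) (fun=> f0 _) (mgeod x v mg) (fun=> g0 _)).
Qed.

Let mPhi h t x : mfT h -> (forall x, 0 <= h x) ->
  mfT (fun v => shrink_int p t h x (tangent x v)).
Proof. by move=> mh h0; apply: (measurable_shrink_int plsc p_gt0 mh h0) => //; exact: measurable_tangent. Qed.

Lemma kernelHt_lin t x :
  kernelHt p t (fun y => c%:E * f y + g y) x = c%:E * kernelHt p t f x + kernelHt p t g x.
Proof.
have P0 h : (forall x, 0 <= h x) -> forall v, 0 <= shrink_int p t h x (tangent x v).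
  by move=> h0 v; exact: shrink_int_ge0.
have S0 h : (forall x, 0 <= h x) -> 0 <= sphint (fun v => shrink_int p t h x (tangent x v)).
  by move=> h0; apply: sphint_ge0; exact: P0.
transitivity ((omega^-1)%:E * (c%:E * sphint (fun v => shrink_int p t f x (tangent x v)) +
    sphint (fun v => shrink_int p t g x (tangent x v)))).
  apply: (congr1 (fun z => (omega^-1)%:E * z)).
  rewrite -(sphintZl c0 (mPhi t x mf f0) (P0 _ f0)).
  rewrite -(sphintD _ _ (mPhi t x mg g0) (P0 _ g0)).
  - by congr sphint; apply/funext => v; exact: shrink_int_lin.
  - by apply: emeasurable_funM => //; exact: mPhi.
  - by move=> v; rewrite mule_ge0// P0.
rewrite muleDr//; first by rewrite muleCA.
by apply: ge0_adde_def; rewrite inE; [apply: mule_ge0; [|exact: S0]|exact: S0].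
Qed.

Let mKt (h : V -> \bar R) (x : V) : mfT h -> (forall x, 0 <= h x) ->
  mfT (fun t : R => if (0 < t < p x)%R then kernelHt p t h x else 0).
Proof.
move=> mh h0; apply: measurable_fun_ifT => //.
  by apply: measurable_and; exact: measurable_fun_ltr.
exact: (measurable_kernelHt plsc p_gt0 mh h0).
Qed.

Lemma kernelH_lin x : kernelH p (fun y => c%:E * f y + g y) x = c%:E * kernelH p f x + kernelH p g x.
Proof.
rewrite /kernelH; case: eqP => [x1|_]; last by rewrite mule0 adde0.
have I0 (h : V -> \bar R) (t : R) : (forall x, 0 <= h x) -> 0 <= (if (0 < t < p x)%R then kernelHt p t h x else 0).
  by move=> h0; case: ifP => // _; exact: kernelHt_ge0.
rewrite muleCA -muleDr//; last first.
  by rewrite ge0_adde_def// inE ?mule_ge0//; apply: integral_ge0 => t _; exact: I0.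
apply: (congr1 (fun z => ((p x)^-1)%:E * z)).
rewrite -ge0_integralZl_EFin//; [|by move=> t _; exact: I0|exact: mKt].
rewrite -ge0_integralD//; first last.
- exact: mKt.
- by move=> t _; exact: I0.
- by apply: emeasurable_funM => //; exact: mKt.
- by move=> t _; rewrite mule_ge0// I0.
suff E (t : R) : (if (0 < t < p x)%R then kernelHt p t (fun y => c%:E * f y + g y) x else 0) =
    c%:E * (if (0 < t < p x)%R then kernelHt p t f x else 0) +
    (if (0 < t < p x)%R then kernelHt p t g x else 0).
  by apply: eq_integral => t _; exact: E.
case: (0 < t < p x)%R; first exact: kernelHt_lin.
by rewrite mule0 adde0.
Qed.

End linear.

(** The starting point lies above every level [t < p x], hence so does a neighbourhood of it on each
    great circle, and the procedure stops almost surely. *)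
Lemma kernelH_one x : sphere n.+2 x -> kernelH p (fun=> 1) x = 1.
Proof.
move=> x1; rewrite /kernelH (_ : dotv x x == 1%R)//; last exact/eqP.
rewrite (_ : (fun t : R => _) = (fun t : R => if (0 < t < p x)%R then 1 else 0)).
  rewrite (integral_level p_gt0 x1 lee01) mule1 -EFinM mulVf// gt_eqF//; exact: p_gt0.
apply/funext => t; case: ifP => // /andP[t0 tp].
rewrite /kernelHt (_ : sphint _ = omega%:E) -?EFinM ?mulVf ?gt_eqF//.
rewrite -omegaE//; apply: eq_sphint => v v1.
have w1 := sphere_tangent x v1; have xw := dotv_x_tangent v x1.
have [macc per oacc] := level_acc plsc p_gt0 t x1 w1 xw.
have acc0 : in_level p t (geod x (tangent x v) 0) by rewrite geod0 /in_level tp andbT; exact/eqP.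
have [e e0 near0] := oacc _ acc0.
exact: (circle_lim1 macc (tau_gt0 R) per e0 near0).
Qed.

(* Only the event that the first draw, an angle in ]0, pi[, is accepted is kept;
   the polar density [sin s ^+ n] is at most 1. *)
Lemma kernelHt_minor t (f : V -> \bar R) x : sphere n.+2 x ->
  mfT f -> (forall y, 0 <= f y) ->
  ((tau * omega)^-1)%:E * sphint (fun y => if in_level p t y then f y else 0) <= kernelHt p t f x.
Proof.
move=> x1 mf f0; pose G y := if in_level p t y then f y else 0.
have mG : mfT G.
  by apply: measurable_fun_ifT => //; exact: (measurable_in_level1 plsc p_gt0).
have G0 y : 0 <= G y by rewrite /G; case: ifP.
have t0 : (0 <= tau^-1)%R by rewrite invr_ge0 ltW// tau_gt0.
pose D (s : R) (v : 'rV[R]_n.+1) : \bar R :=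
  if (0 < s < pi)%R then (sin s ^+ n)%:E * G (geod x (tangent x v) s) else 0.
have D0 s v : 0 <= D s v.
  rewrite /D; case: ifP => // sI; rewrite mule_ge0// lee_fin exprn_ge0// ltW//.
  exact: sin_gt0_pi.
have mD : mfT (fun z : R * 'rV[R]_n.+1 => D z.1 z.2).
  have m1 : mfT (@fst R 'rV[R]_n.+1) by exact: measurable_fst.
  apply: measurable_fun_ifT => //.
    by apply: measurable_and; exact: measurable_fun_ltr.
  apply: emeasurable_funM.
    by apply/measurable_EFinP; apply: measurable_funX; exact: measurable_sin.
  apply: (measurableT_comp mG); apply: measurable_geod => //.
  by apply: measurable_tangent => //; exact: measurable_snd.
have polar : sphint G = sphint (fun v => \int[mu]_s D s v).
  rewrite (sphint_polar_at x1 mG G0) -(sphint_leb_swap mD D0) integral_itv_ooE.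
  apply: eq_integral => s _; rewrite /D; case: ifP => sI; last first.
    by rewrite (sphintE (f := fun=> 0))// integral0.
  rewrite (sphintZl (f := fun v => G (geod x (tangent x v) s)))//.
    by rewrite exprn_ge0// ltW// sin_gt0_pi.
  by apply: (measurableT_comp mG); apply: measurable_geod => //; exact: measurable_tangent.
rewrite -/G polar invfM mulrC EFinM -muleA.
apply: lee_wpmul2l; first by rewrite lee_fin invr_ge0 ltW.
have mID : mfT (fun v => \int[mu]_s D s v).
  apply: (@measurable_integral_leb _ _ _ (fun (v : 'rV[R]_n.+1) (s : R) => D s v)) => //.
  exact: (measurable_uncurry_swap (f := D)).
have ID0 v : 0 <= \int[mu]_s D s v by exact: integral_ge0.
rewrite -(sphintZl t0 mID ID0); apply: le_sphint.
- by apply: emeasurable_funM.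
- by move=> v; rewrite mule_ge0.
- by apply: (measurable_shrink_int plsc p_gt0 mf f0) => //; exact: measurable_tangent.
(* [le_circle_lim] discards everything after the first draw. *)
move=> v; apply: le_trans (le_circle_lim (fun s => in_level p t (geod x (tangent x v) s)) tau 0%R (fun s => f0 _)).
apply: lee_wpmul2l => //; rewrite integral_itvE.
apply: ge0_le_integral => //.
- exact: (measurable_section2 v mD).
- apply: measurable_fun_ifT => //; first exact: measurable_itv_cond.
  rewrite (_ : (fun s : R => _) = (fun s => G (geod x (tangent x v) s))).
    by apply: (measurableT_comp mG); exact: measurable_geod.
  by apply/funext => s; rewrite add0r.
move=> s _; rewrite /D; case: ifP => [/andP[s0 spi]|_]; last first.
  by case: ifP => // _; rewrite add0r; exact: G0.
rewrite (ltW s0) (le_trans (ltW spi))/=; last first.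
  by rewrite mulrDl mul1r lerDl pi_ge0.
rewrite add0r; apply: (@le_trans _ _ (1 * G (geod x (tangent x v) s))); last by rewrite mul1e.
apply: lee_wpmul2r => //; rewrite lee_fin exprn_ile1 ?sin_le1//.
by rewrite ltW// sin_gt0_pi// s0.
Qed.

Lemma kernelH_minor (C : set V) (b B : R) (f : V -> \bar R) x : sphere n.+2 x ->
  mfT f -> (forall y, 0 <= f y) ->
  mfT (\1_C : V -> R) ->
  (0 <= b)%R -> (b <= B)%R -> (0 < B)%R ->
  (forall y, C y -> (b <= p y)%R) -> (forall y, sphere n.+2 y -> (p y <= B)%R) ->
  (b / B / (tau * omega))%:E * sphint (fun y => (\1_C y)%:E * f y) <= kernelH p f x.
Proof.
move=> x1 mf f0 mC b0 bB B0 Cb pB.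
set S := sphint _; have px := p_gt0 x1.
have t0 : (0 <= (tau * omega)^-1)%R by rewrite invr_ge0 mulr_ge0 ?ltW ?tau_gt0.
have S0 : 0 <= S.
  by apply: sphint_ge0 => y; rewrite mule_ge0// lee_fin indicE.
have mS : mfT (fun y => (\1_C y)%:E * f y).
  by apply: emeasurable_funM => //; apply/measurable_EFinP.
have c0 : 0 <= ((tau * omega)^-1)%:E * S by rewrite mule_ge0.
(* As [p x <= B], [q] is at most [b], hence below [p] on [C]; and []0, q[] is the fraction [b / B]
   of []0, p x[], which becomes the constant. *)
pose q : R := (b / B * p x)%R.
have q0 : (0 <= q)%R by rewrite mulr_ge0 ?divr_ge0// ltW.
have qp : (q <= p x)%R by rewrite /q ler_piMl ?(ltW px)// ler_pdivrMr// mul1r.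
have qb : (q <= b)%R.
  rewrite (_ : q = b * p x / B)%R; last by rewrite /q mulrAC.
  rewrite ler_pdivrMr// ler_wpM2l//; exact: pB.
apply: (@le_trans _ _ (((p x)^-1)%:E *
    \int[mu]_(t in `]0%R, q[) (((tau * omega)^-1)%:E * S))).
  have [q00|qn0] := eqVneq q 0%R.
    have -> : (b / B = 0)%R.
      by move/eqP: q00; rewrite mulf_eq0 (gt_eqF px) orbF => /eqP.
    rewrite mul0r mul0e; apply: mule_ge0; first by rewrite lee_fin invr_ge0 ltW.
    by apply: integral_ge0 => *; exact: c0.
  rewrite integral_cst//= lebesgue_measure_itv/= lte_fin lt_neqAle eq_sym qn0 q0/=.
  rewrite oppr0 adde0 [in leRHS](muleC _ q%:E) !muleA -!EFinM.
  rewrite (_ : (p x)^-1 * q = b / B)%R ?lexx//.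
  by rewrite /q mulrCA mulVf ?gt_eqF// mulr1.
rewrite /kernelH (_ : dotv x x == 1%R); last exact/eqP.
apply: lee_wpmul2l; first by rewrite lee_fin invr_ge0 ltW.
rewrite integral_itv_ooE; apply: ge0_le_integral => //.
- by move=> t _; case: ifP.
- apply: measurable_fun_ifT => //.
  by apply: measurable_and; exact: measurable_fun_ltr.
- apply: measurable_fun_ifT => //.
    by apply: measurable_and; exact: measurable_fun_ltr.
  exact: (measurable_kernelHt plsc p_gt0 mf f0).
move=> t _; case: ifP => [/andP[t0' tq]|_]; last by case: ifP => // _; exact: kernelHt_ge0.
rewrite t0' (lt_le_trans tq qp)/=.
apply: le_trans (kernelHt_minor t x1 mf f0); apply: lee_wpmul2l; first by rewrite lee_fin.
pose S' y := if dotv y y == 1%R then (\1_C y)%:E * f y else 0.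
rewrite (_ : S = sphint S'); last first.
  by apply: eq_sphint => y y1; rewrite /S' (_ : dotv y y == 1%R)//; exact/eqP.
apply: le_sphint.
- by apply: measurable_fun_ifT => //; exact: measurable_sphere.
- by move=> y; rewrite /S'; case: ifP => // _; rewrite mule_ge0// lee_fin indicE.
- by apply: measurable_fun_ifT => //; exact: (measurable_in_level1 plsc p_gt0).
move=> y; rewrite /S' /in_level; case: eqP => [y1|_] //=.
rewrite indicE; have [yC|_] := boolP (y \in C); last by rewrite mul0e; case: ifP.
rewrite mul1e (lt_le_trans tq)// (le_trans qb)// Cb//.
by rewrite inE in yC.
Qed.

End minorization.

(** * Contraction and convergence *)

Section contraction.
Variables (R : realType) (n : nat) (p : 'rV[R]_n.+2 -> R).
Local Open Scope ereal_scope.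
Local Notation V := ('rV[R]_n.+2).
Local Notation tau := (2 * pi : R)%R.
Local Notation omega := (omega R n).
Hypothesis plsc : lsc_sph p.
Hypothesis p_gt0 : forall x, sphere n.+2 x -> (0 < p x)%R.
Hypothesis omega_gt0 : (0 < omega)%R.
Variables (C : set V) (b B : R).
Hypothesis mC : mfT (\1_C : V -> R).
Hypothesis b_ge0 : (0 <= b)%R.
Hypothesis bB : (b <= B)%R.
Hypothesis B_gt0 : (0 < B)%R.
Hypothesis pC : forall y, C y -> (b <= p y)%R.
Hypothesis pB : forall y, sphere n.+2 y -> (p y <= B)%R.
Variables (eps sC rho : R).
Hypothesis epsE : (eps = b / B / (tau * omega))%R.
Hypothesis sCE : sC = fine (sph_meas C).
Hypothesis rhoE : (rho = 1 - eps * sC)%R.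

Lemma sphere_pole m : sphere m.+1 (pole R m).
Proof.
rewrite /sphere/= dotv_vext mulr1 /dotv big1 ?addr0// => i _.
by rewrite mxE mul0r.
Qed.

Lemma sphint_bounded_fin m (f : 'rV[R]_m -> \bar R) (w : R) :
  mfT f -> (forall y, 0 <= f y) -> (forall y, f y <= w%:E) ->
  sphint f \is a fin_num.
Proof.
move=> mf f0 fw; rewrite ge0_fin_numE; last exact: sphint_ge0.
have w0 : (0 <= w)%R by rewrite -lee_fin (le_trans (f0 0%R)).
apply: (@le_lt_trans _ _ (sphint (fun _ : 'rV[R]_m => w%:E))); first exact: le_sphint.
rewrite (sphintE (f := fun=> w%:E))// integral_cst//=.
by rewrite lte_mul_pinfty// sig_fin.
Qed.

Lemma adde_one_inj (a c : \bar R) (w : R) : 0 <= a -> 0 <= c ->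
  w%:E + 1 = 1%:E * a + (1%:E * c + 1) -> a + c = w%:E.
Proof.
rewrite !mul1e addeA; case: a => [a| |]; case: c => [c| |] //= _ _ [] /addIr ->.
by [].
Qed.

Lemma adde_fin (a c : \bar R) (w : R) : 0 <= a -> 0 <= c -> a + c = w%:E ->
  exists a' c' : R, [/\ a = a'%:E, c = c'%:E & (a' + c' = w)%R].
Proof. by case: a => [a| |]; case: c => [c| |] //= _ _ [] acw; exists a, c. Qed.

Lemma fine_sum (a c s : \bar R) (w : R) : a \is a fin_num -> c \is a fin_num ->
  s \is a fin_num -> a + c = w%:E * s -> (fine a + fine c = w * fine s)%R.
Proof. by case: a => [a| |]; case: c => [c| |]; case: s => [s| |] // _ _ _ []. Qed.

Let eps_ge0 : (0 <= eps)%R.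
Proof. by rewrite epsE divr_ge0 ?divr_ge0 ?mulr_ge0 ?pi_ge0 ?(ltW B_gt0) ?(ltW omega_gt0). Qed.

Let ind_ge0 y : (0 <= \1_C y :> R)%R. Proof. by rewrite indicE. Qed.
Let ind_le1 y : (\1_C y <= 1 :> R)%R. Proof. by rewrite indicE lern1 leq_b1. Qed.

(** The distances [g] and [h] of [phi] to its two bounds are nonnegative with sum [w], and so are
    their images under the kernel. The minorization bounds these below by [eps * G] and [eps * H]
    with [G + H = w * sC], which leaves the image of [g] an interval of length
    [w - eps * (G + H) = rho * w]. *)
Lemma oscillation_step (m w : R) (phi : V -> R) :
  mfT phi -> (0 <= m)%R -> (forall x, m <= phi x <= m + w)%R ->
  exists (m' : R) (phi' : V -> R), [/\ mfT phi', (0 <= m')%R,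
    (forall x, m' <= phi' x <= m' + rho * w)%R &
    forall x, sphere n.+2 x -> kernelH p (EFin \o phi) x = (phi' x)%:E].
Proof.
move=> mphi m0 phiI.
have w0 : (0 <= w)%R.
  by have /andP[h1 h2] := phiI 0%R; have := le_trans h1 h2; rewrite lerDl.
pose g (y : V) : \bar R := (phi y - m)%:E.
pose h (y : V) : \bar R := (m + w - phi y)%:E.
have mg : mfT g.
  by apply/measurable_EFinP; apply: measurable_funB.
have mh : mfT h.
  by apply/measurable_EFinP; apply: measurable_funB.
have g0 y : 0 <= g y by rewrite lee_fin subr_ge0; case/andP: (phiI y).
have h0 y : 0 <= h y by rewrite lee_fin subr_ge0; case/andP: (phiI y).
have gw y : g y <= w%:E by rewrite lee_fin lerBlDl; case/andP: (phiI y).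
have hw y : h y <= w%:E by rewrite lee_fin lerBlDr addrC lerD2l; case/andP: (phiI y).
have m1 : mfT (fun _ : V => 1 : \bar R) by [].
have p1 (y : V) : 0 <= (1 : \bar R) by exact: lee01.
have KD c f1 f2 := @kernelH_lin R n p plsc p_gt0 c f1 f2.
have Kphi x : sphere n.+2 x -> kernelH p (EFin \o phi) x = m%:E + kernelH p g x.
  move=> x1; have K1 := kernelH_one plsc p_gt0 omega_gt0 x1.
  transitivity (m%:E * kernelH p (fun=> 1) x + kernelH p g x); last by rewrite K1 mule1.
  rewrite -(KD m _ g m0 m1 p1 mg g0); apply: (congr1 (fun F => kernelH p F x)).
  by apply/funext => y; rewrite /g mule1 -EFinD addrC subrK.
have Ksum x : sphere n.+2 x -> kernelH p g x + kernelH p h x = w%:E.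
  move=> x1.
  have mh1 : mfT (fun y => 1%:E * h y + 1) by apply: emeasurable_funD => //; apply: emeasurable_funM.
  have h10 y : 0 <= 1%:E * h y + 1 by rewrite adde_ge0// mule_ge0.
  (* The constant [w + 1] is written both as [w * 1 + 1] and as [g + (h + 1)], to which the law for
     [c * f + g] applies. *)
  have E : w%:E + 1 = 1%:E * kernelH p g x + (1%:E * kernelH p h x + 1).
    have K1 := kernelH_one plsc p_gt0 omega_gt0 x1.
    transitivity (w%:E * kernelH p (fun=> 1) x + kernelH p (fun=> 1) x); first by rewrite K1 mule1.
    transitivity (1%:E * kernelH p g x + (1%:E * kernelH p h x + kernelH p (fun=> 1) x)); last by rewrite K1.
    apply: (etrans _ (congr1 (fun u => 1%:E * kernelH p g x + u) (KD 1%R h _ ler01 mh h0 m1 p1 x))).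
    apply: (etrans _ (KD 1%R g _ ler01 mg g0 mh1 h10 x)).
    apply: (etrans (esym (KD w _ _ w0 m1 p1 m1 p1 x))); apply: (congr1 (fun F => kernelH p F x)).
    apply/funext => y; rewrite /g /h !mul1e mule1 addeA -!EFinD.
    by congr (_%:E); ring.
  exact: (adde_one_inj (kernelH_ge0 p_gt0 g0 x) (kernelH_ge0 p_gt0 h0 x) E).
have [G [H [GH G0 Gle Hle]]] : exists G H : R, [/\ (G + H = w * sC)%R, (0 <= G)%R,
    (forall x, sphere n.+2 x -> (eps * G)%:E <= kernelH p g x) &
    (forall x, sphere n.+2 x -> (eps * H)%:E <= kernelH p h x)].
  have mI : mfT (fun y : V => (\1_C y)%:E : \bar R) by apply/measurable_EFinP.
  have prodP f : mfT f -> (forall y, 0 <= f y) -> (forall y, f y <= w%:E) ->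
      [/\ mfT (fun y => (\1_C y)%:E * f y),
        (forall y, 0 <= (\1_C y)%:E * f y), sphint (fun y => (\1_C y)%:E * f y) \is a fin_num &
        (forall x, sphere n.+2 x ->
          (eps * fine (sphint (fun y => ((\1_C y)%:E * f y)%E)))%:E <= kernelH p f x)].
    move=> mf f0 fw.
    have mm : mfT (fun y => (\1_C y)%:E * f y) by exact: emeasurable_funM.
    have mm0 y : 0 <= (\1_C y)%:E * f y by rewrite mule_ge0// lee_fin.
    have ff : sphint (fun y => (\1_C y)%:E * f y) \is a fin_num.
      apply: (@sphint_bounded_fin _ _ w) => // y.
      apply: le_trans (fw y); rewrite -[leRHS]mul1e; apply: lee_wpmul2r => //.
      by rewrite lee_fin.
    split => // x x1; rewrite EFinM (fineK ff) epsE.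
    exact: (kernelH_minor plsc p_gt0 omega_gt0 x1 mf f0 mC b_ge0 bB B_gt0 pC pB).
  have [mIg Ig0 Gfin Gle] := prodP g mg g0 gw; have [mIh Ih0 Hfin Hle] := prodP h mh h0 hw.
  exists (fine (sphint (fun y => ((\1_C y)%:E * g y)%E))), (fine (sphint (fun y => ((\1_C y)%:E * h y)%E))).
  split; [|exact: fine_ge0 (sphint_ge0 Ig0)|exact: Gle|exact: Hle].
  have sfin : sph_meas C \is a fin_num.
    by apply: (@sphint_bounded_fin _ _ 1%R) => // y; rewrite lee_fin.
  rewrite sCE; apply: (fine_sum Gfin Hfin sfin).
  rewrite -(sphintD mIg Ig0 mIh Ih0) /sph_meas -(sphintZl w0 mI); last by move=> y; rewrite lee_fin.
  congr sphint; apply/funext => y; rewrite -ge0_muleDr//.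
  by rewrite muleC /g /h -EFinD; congr (_%:E * _); ring.
have bound x : sphere n.+2 x -> exists2 a : R, kernelH p g x = a%:E & (eps * G <= a <= eps * G + rho * w)%R.
  move=> x1; have [a [c [aE cE acw]]] := adde_fin (kernelH_ge0 p_gt0 g0 x) (kernelH_ge0 p_gt0 h0 x) (Ksum x x1).
  exists a; first exact: aE.
  have := Gle x x1; have := Hle x x1; rewrite aE cE !lee_fin => Hc Ga.
  apply/andP; split; first exact: Ga.
  rewrite rhoE (_ : G = w * sC - H)%R; last by rewrite -GH addrK.
  rewrite (_ : _ + _ = w - eps * H)%R; last by ring.
  by rewrite -acw lerBrDr lerD2l.
(* Read off from the bounds at one point of the sphere; it keeps the default value [m'] used off the
   sphere within the new range. *)
have rw0 : (0 <= rho * w)%R.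
  have pole1 := sphere_pole n.+1.
  have [a _ /andP[h1 h2]] := bound _ pole1.
  by have := le_trans h1 h2; rewrite lerDl.
pose m' : R := (m + eps * G)%R.
have mE : mfT (EFin \o phi) by apply/measurable_EFinP.
have phi0 y : 0 <= (EFin \o phi) y by rewrite lee_fin (le_trans m0)//; case/andP: (phiI y).
exists m', (fun x => if dotv x x == 1%R then fine (kernelH p (EFin \o phi) x) else m'); split.
- apply: measurable_fun_ifT; [exact: measurable_sphere| |exact: measurable_cst].
  apply: (measurableT_comp (f := fine)); first exact: fine_measurable.
  exact: (measurable_kernelH plsc p_gt0 mE phi0).
- by rewrite addr_ge0// mulr_ge0.
- move=> x; case: eqP => [x1|_]; last by rewrite lexx lerDl rw0.
  have [a Ka /andP[h1 h2]] := bound _ x1.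
  by rewrite (Kphi _ x1) Ka /= /m' lerD2l h1 -addrA lerD2l.
- move=> x x1; rewrite (_ : dotv x x == 1%R); last exact/eqP.
  have [a Ka _] := bound _ x1.
  by rewrite (Kphi _ x1) Ka.
Qed.

(** The [p]-weighted integral is carried through the induction together with the range: by
    stationarity it remains that of the indicator of [A], so the target value is an average of each
    [phi]. *)
Lemma Hn_oscillation (A : set V) k : borel_sph A ->
  exists (m : R) (phi : V -> R), [/\ mfT phi, (0 <= m)%R,
    (forall x, m <= phi x <= m + rho ^+ k)%R,
    (forall x, sphere n.+2 x -> Hn p k x A = (phi x)%:E) &
    sphint (fun x => (p x)%:E * (phi x)%:E) = sphint (fun x => (p x)%:E * (\1_A x)%:E)].
Proof.
move=> [_ mA]; elim: k => [|k [m [phi [mphi m0 phiI phiE +]]]].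
  exists 0%R, (\1_A); split => //.
  by move=> x; rewrite add0r expr0 indicE ler0n lern1 leq_b1.
have [m' [phi' [mphi' m'0 phi'I phi'E]]] := oscillation_step mphi m0 phiI.
have mE : mfT (EFin \o phi) by apply/measurable_EFinP.
have phi0 y : 0 <= (EFin \o phi) y by rewrite lee_fin (le_trans m0)//; case/andP: (phiI y).
move=> phiS; exists m', phi'; split.
- exact: mphi'.
- exact: m'0.
- by move=> x; rewrite exprS; exact: phi'I.
- by move=> x x1; rewrite -phi'E; [exact: (H_opE plsc p_gt0 mE phi0 x1 phiE)|exact: x1].
- apply: (etrans _ phiS); transitivity (sphint (fun x => (p x)%:E * kernelH p (EFin \o phi) x)).
    by apply: eq_sphint => x x1; apply: (congr1 (fun u => (p x)%:E * u)); rewrite phi'E.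
  exact: (kernelH_stationary plsc p_gt0 omega_gt0 mE phi0 (fun=> erefl)).
Qed.

Let P (y : V) : R := if dotv y y == 1%R then p y else 0%R.

Let P_sphere y : sphere n.+2 y -> p y = P y.
Proof. by rewrite /P /sphere/= => ->; rewrite eqxx. Qed.

Let P_ge0 y : 0 <= (P y)%:E.
Proof. by rewrite lee_fin /P; case: eqP => // y1; rewrite ltW//; exact: p_gt0. Qed.

Let mP : mfT (fun y => (P y)%:E).
Proof. by apply/measurable_EFinP; exact: (measurable_lsc plsc p_gt0). Qed.

Lemma dist_le (m w a : R) (T T' : \bar R) : m%:E <= T -> T <= (m + w)%:E ->
  (m <= a <= m + w)%R -> T' = T -> `|a%:E - T'| <= w%:E.
Proof.
move=> + + + ->; case: T => [r| |] //=.
rewrite !lee_fin => lo hi /andP[h1 h2]; rewrite ler_norml.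
apply/andP; split; first by rewrite lerBrDr addrC lerBlDr (le_trans hi)// lerD2r.
by rewrite lerBlDr (le_trans h2)// addrC lerD2l.
Qed.

Lemma ereal_pos_fin (a : \bar R) : 0 < a < +oo -> (0 < fine a)%R /\ (fine a)%:E = a.
Proof. by case: a => [a| |] /andP[]//=; rewrite lte_fin. Qed.

(** Both [Hn p k x A] and the target value, a normalised [p]-average of [phi], lie in
    [[m, m + rho ^+ k]]. *)
Lemma Hn_target (A : set V) k x : 0 < Zconst p < +oo -> borel_sph A -> sphere n.+2 x ->
  `|Hn p k x A - target p A| <= (rho ^+ k)%:E.
Proof.
move=> /ereal_pos_fin; rewrite /target; set z := fine _ => -[z0 +] bA x1.
move: z z0 => z z0 zE.
have {}zE : z%:E = sphint (fun y => (P y)%:E).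
  by rewrite zE; apply: eq_sphint => y /P_sphere ->.
have [m [phi [mphi m0 phiI phiE +]]] := Hn_oscillation k bA.
have phi0 y : (0 <= phi y)%R by rewrite (le_trans m0)//; case/andP: (phiI y).
have mphiE : mfT (fun y => (phi y)%:E) by apply/measurable_EFinP.
have zV : (0 <= z^-1)%R by rewrite invr_ge0 ltW.
have scale (c : R) : (0 <= c)%R -> (z^-1)%:E * sphint (fun y => c%:E * (P y)%:E) = c%:E.
  move=> c0; rewrite (sphintZl c0 mP P_ge0) -zE -!EFinM mulrCA mulVf ?gt_eqF//.
  by rewrite mulr1.
move=> {zE}.
have w0 : (0 <= m + rho ^+ k)%R.
  by have /andP[h1 h2] := phiI 0%R; exact: le_trans m0 (le_trans h1 h2).
have lo : m%:E <= (z^-1)%:E * sphint (fun y => (P y)%:E * (phi y)%:E).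
  rewrite -{1}(scale m m0); apply: lee_wpmul2l; first by rewrite lee_fin.
  apply: le_sphint.
  - exact: emeasurable_funM.
  - by move=> y; rewrite mule_ge0.
  - exact: emeasurable_funM.
  - move=> y; rewrite [leLHS]muleC; apply: lee_wpmul2l => //.
    by rewrite lee_fin; case/andP: (phiI y).
have hi : (z^-1)%:E * sphint (fun y => (P y)%:E * (phi y)%:E) <= (m + rho ^+ k)%:E.
  rewrite -(scale _ w0); apply: lee_wpmul2l; first by rewrite lee_fin.
  apply: le_sphint.
  - exact: emeasurable_funM.
  - by move=> y; rewrite mule_ge0// lee_fin.
  - exact: emeasurable_funM.
  - move=> y; rewrite [leRHS]muleC; apply: lee_wpmul2l => //.
    by rewrite lee_fin; case/andP: (phiI y).
rewrite (phiE _ x1) => phiS; apply: (dist_le lo hi (phiI x)).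
apply: (congr1 (fun u => (z^-1)%:E * u)); apply: (etrans (esym phiS)).
by apply: eq_sphint => y /P_sphere ->.
Qed.

End contraction.

(** If the unit tangent directions had mass zero, polar coordinates would make every bounded
    integral over the sphere vanish. Applied to the indicator of [C], this gives positivity without
    computing the mass. *)
Lemma omega_gt0 (R : realType) (n : nat) (f : 'rV[R]_n.+2 -> \bar R) :
  mfT f -> (forall y, 0 <= f y)%E -> (forall y, f y <= 1)%E ->
  (0 < sphint f)%E -> 0 < omega R n.
Proof.
move=> mf f0 f1 fpos; rewrite lt_neqAle omega_ge0 andbT; apply/eqP => om0.
move: fpos; apply/negP; rewrite -leNgt (sphint_polar_at (sphere_pole R n.+1) mf f0).
rewrite integral0_eq// => t _.
pose h (v : 'rV[R]_n.+1) := f (geod (pole R n.+1) (tangent (pole R n.+1) v) t).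
have mh : mfT h.
  by apply: (measurableT_comp mf); apply: measurable_geod => //; exact: measurable_tangent.
suff -> : sphint h = 0%E by rewrite mule0.
apply/eqP; rewrite eq_le (sphint_ge0 (fun v => f0 _)) andbT.
apply: (@le_trans _ _ (sphint (fun _ : 'rV[R]_n.+1 => 1%E))); last by rewrite omegaE -om0.
exact: (le_sphint mh (fun v => f0 _) (measurable_cst _) (fun v => f1 _)).
Qed.

Theorem mainTheorem2 (R : realType) (d : nat) (p : 'rV[R]_d -> R)
  (C : set 'rV[R]_d) :
  (3 <= d)%N ->
  (forall x, sphere d x -> 0 < p x) ->
  lsc_sph p ->
  (0 < Zconst p < +oo)%E ->
  borel_sph C ->
  (0 < sph_meas C)%E ->
  (0 < ereal_inf [set (p y)%:E | y in C])%E ->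
  (ereal_sup [set (p y)%:E | y in sphere d] < +oo)%E ->
  let beta := fine (ereal_inf [set (p y)%:E | y in C]) /
              fine (ereal_sup [set (p y)%:E | y in sphere d]) in
  let rho := 1 - beta / (2 * pi) * (fine (sph_meas C) / sph_mass d.-1) in
  forall n : nat,
    (ereal_sup [set dTV (Hn p n x) (target p) | x in sphere d]
       <= (rho ^+ n)%:E)%E.
Proof.
case: d p C => [//|[//|n]] p C _ p_gt0 plsc Zp [CS mC] C_gt0 inf_gt0 sup_fin beta rho k.
have ind0 y : (0 <= (\1_C y : R)%:E)%E by rewrite lee_fin indicE.
have ind1 y : ((\1_C y : R)%:E <= 1)%E by rewrite lee_fin indicE lern1 leq_b1.
have mI : mfT (\1_C : 'rV[R]_n.+2 -> R) by exact: measurable_indic.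
have mIE : mfT (fun y : 'rV[R]_n.+2 => (\1_C y : R)%:E) by apply/measurable_EFinP.
have om0 : 0 < omega R n := omega_gt0 mIE ind0 ind1 C_gt0.
(* A point of [C] bounds the infimum from above and the supremum from below, so that both are real
   numbers and [fine] loses nothing. *)
have [y0 Cy0] : exists y, C y.
  apply: contrapT => /forallNP C0; move: C_gt0; apply/negP; rewrite -leNgt.
  rewrite /sph_meas (eq_sphint (g := fun=> 0%E)).
    by rewrite (sphintE (f := fun=> 0%E))// integral0.
  by move=> y _; rewrite indicE memNset.
have infC y : C y -> (ereal_inf [set (p y)%:E | y in C] <= (p y)%:E)%E.
  by move=> Cy; apply: ereal_inf_lbound; exists y.
have supS y : sphere n.+2 y -> ((p y)%:E <= ereal_sup [set (p y)%:E | y in sphere n.+2])%E.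
  by move=> Sy; apply: ereal_sup_ubound; exists y.
move: infC supS inf_gt0 sup_fin; rewrite /rho /beta => {rho beta}.
move: (ereal_inf _) (ereal_sup _) => I S infC supS I0 Soo.
have p0 := p_gt0 _ (CS _ Cy0).
have IE : I = (fine I)%:E.
  by rewrite fineK// fin_numE gt_eqF ?(lt_trans _ I0)//= lt_eqF// (le_lt_trans (infC _ Cy0))// ltry.
have SE : S = (fine S)%:E.
  by rewrite fineK// fin_numE gt_eqF ?(lt_le_trans _ (supS _ (CS _ Cy0))) ?ltNyr//= lt_eqF.
rewrite SE IE in infC supS I0; move: (fine I) (fine S) infC supS I0 => b B infC supS b0.
rewrite lte_fin in b0.
have pC y : C y -> b <= p y by move=> /infC; rewrite lee_fin.
have pB y : sphere n.+2 y -> p y <= B by move=> /supS; rewrite lee_fin.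
have bB : b <= B by rewrite (le_trans (pC _ Cy0))// pB//; exact: CS.
have B0 : 0 < B by exact: lt_le_trans bB.
set eps := b / B / (2 * pi * omega R n).
(* Only a regrouping of the given constant: [eps] is the minorization constant
   [beta / (2 * pi * omega)]. *)
set rho := 1 - eps * fine (sph_meas C).
have -> : 1 - b / B / (2 * pi) * (fine (sph_meas C) / sph_mass n.+2.-1) = rho.
  rewrite /rho /eps /= -/(omega R n) [(2 * pi * _)^-1]invfM.
  by move: (fine _) => s; ring.
apply: ge_ereal_sup => _ [x x1 <-]; apply: ge_ereal_sup => _ [A bA <-].
exact: (Hn_target plsc p_gt0 om0 mI (ltW b0) bB B0 pC pB erefl erefl erefl k Zp bA x1).
Qed.
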